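(* The Boolean entropy $\Gamma$ and Boolean Fisher information $\Psi$ satisfy the following properties, where all appearing variables are assumed to be self-adjoint in some non-commutative probability space and to have symmetric laws. (1) We have the bounds $$\tau\left(\frac{2}{X^2+\tilde X^2}\right)\ \le\ \Psi(X)\ \le\ \tau\left(\frac{1}{X^2}\right),$$ where $\tilde X$ is a classically independent copy of $X$. If $X$ is not invertible, these expressions are understood as $\tau\left(\frac{2}{X^2+\tilde X^2}\right)=\iint\frac{2}{x^2+y^2}\,d\mu(x)\,d\mu(y)$ and $\tau\left(\frac{1}{X^2}\right)=\int x^{-2}\,d\mu(x)$, with $\mu$ the law of $X$. (2) $\Gamma$ is upper semicontinuous with respect to the weak topology of probability measures with compact support, and $\Psi$ is lower semicontinuous. In particular, if $(X_k)_{k\in\mathbb{N}}$ is a sequence of random variables such that $X_k\to X$ in the sense of operator norm, then $$\Gamma(X)\ge\limsup_{k\to+\infty}\Gamma(X_k),\qquad \Psi(X)\le\liminf_{k\to+\infty}\Psi(X_k).$$ (3) If $X$ and $Y$ are Boolean independent, then for any $\theta\in[0,1]$, $$\Gamma(\sqrt{\theta}X+\sqrt{1-\theta}Y)\ge\theta\Gamma(X)+(1-\theta)\Gamma(Y),$$ $$\Psi(\sqrt{\theta}X+\sqrt{1-\theta}Y)\le\theta\Psi(X)+(1-\theta)\Psi(Y).$$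
   Context: A non-commutative probability space $(\mathcal{M},\tau)$ is a von Neumann algebra $\mathcal{M}$ with a nondegenerate normal state $\tau$, not necessarily faithful. For self-adjoint $A\in\mathcal{M}$, the law of $A$ is the unique probability measure $\mu$ on $\mathbb{R}$ with $\tau(A^k)=\int x^k\,d\mu(x)$ for all $k\in\mathbb{N}$. Two self-adjoint $X,Y\in\mathcal{M}$ are Boolean independent if for all finite sequences of integers $k_1,k_2,\ldots\ge 1$, $\tau(X^{k_1}Y^{k_2}X^{k_3}\cdots)=\tau(X^{k_1})\tau(Y^{k_2})\tau(X^{k_3})\cdots$ and $\tau(Y^{k_1}X^{k_2}Y^{k_3}\cdots)=\tau(Y^{k_1})\tau(X^{k_2})\tau(Y^{k_3})\cdots$. For $X$ with law $\mu$, the Boolean entropy is $\Gamma(X)=\Gamma(\mu)=\int\log|x|\,d\mu(x)\in[-\infty,+\infty)$, and for symmetric $\mu$ the Boolean Fisher information is $\Psi(X)=\Psi(\mu)=\iint\frac{\log x^2-\log y^2}{x^2-y^2}\,d\mu(x)\,d\mu(y)\in(0,+\infty]$, the integrand being understood with its continuous extension on the diagonal $x^2=y^2$.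
   Formalization: In (2) the weak topology on compactly supported probability measures is the one tested by all continuous functions, not only bounded ones; with bounded ones upper semicontinuity of Γ fails (mass 1/n at ±exp(n²)). On measures supported in a common compact set the two agree. *)

(* Defs.v *)
From HB Require Import structures.
From mathcomp Require Import all_boot all_order all_algebra.
From mathcomp Require Import all_classical all_reals all_analysis.
From mathcomp Require Import complex sesquilinear.

Set Implicit Arguments.
Unset Strict Implicit.
Unset Printing Implicit Defensive.

Import Order.TTheory GRing.Theory Num.Theory.
Import numFieldNormedType.Exports.

Local Open Scope classical_set_scope.
Local Open Scope ring_scope.

(* Complex Hilbert spaces. The inner product is linear in its first argument. *)

Definition dnorm (R : realType) (H : lmodType R[i])
    (form : {dot H for Num.Def.conjC}) (u : H) : R :=
  Num.sqrt (complex.Re (form u u)).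

Record hilbertSpace (R : realType) := HilbertSpace {
  hcarrier :> lmodType R[i] ;
  hdot : {dot hcarrier for Num.Def.conjC} ;
  hcomplete : forall u : nat -> hcarrier,
    (forall e : R, 0 < e -> exists N : nat, forall m n : nat,
       (N <= m)%N -> (N <= n)%N -> dnorm hdot (u m - u n) < e) ->
    exists l : hcarrier, (fun n => dnorm hdot (u n - l)) @ \oo --> (0 : R)
}.

Definition hnorm (R : realType) (H : hilbertSpace R) (u : H) : R :=
  dnorm (hdot H) u.

(* Operators are functions H -> H, with the pointwise vector space structure of
   functions and with composition as product. *)

Definition bounded_op (R : realType) (H : hilbertSpace R) (A : H -> H) : Prop :=
  linear A /\ exists c : R, forall u, hnorm (A u) <= c * hnorm u.

Definition opnorm (R : realType) (H : hilbertSpace R) (A : H -> H) : R :=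
  sup [set hnorm (A u) | u in [set u | hnorm u <= 1]].

Definition is_adjoint (R : realType) (H : hilbertSpace R) (A B : H -> H) : Prop :=
  forall u v, hdot H (A u) v = hdot H u (B v).

Definition selfadjoint (R : realType) (H : hilbertSpace R) (A : H -> H) : Prop :=
  is_adjoint A A.

Definition le_op (R : realType) (H : hilbertSpace R) (A B : H -> H) : Prop :=
  forall u, 0 <= hdot H ((B - A) u) u.

Definition commutant (R : realType) (H : hilbertSpace R) (S : set (H -> H)) :
    set (H -> H) :=
  [set A | bounded_op A /\ forall B, S B -> A \o B = B \o A].

(* A *-closed set of bounded operators equal to its bicommutant; it is then
   automatically a unital weakly closed algebra. *)
Definition von_neumann_algebra (R : realType) (H : hilbertSpace R)
    (M : set (H -> H)) : Prop :=
  (forall A, M A -> exists2 B, M B & is_adjoint A B) /\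
  commutant (commutant M) = M.

(* Only the values of tau on M matter. *)
Definition state (R : realType) (H : hilbertSpace R) (M : set (H -> H))
    (tau : (H -> H) -> R[i]) : Prop :=
  [/\ forall (a : R[i]) A B, M A -> M B -> tau (a *: A + B) = a * tau A + tau B,
      forall A A', M A -> M A' -> is_adjoint A A' -> 0 <= tau (A' \o A)
    & tau id = 1].

Definition sa_part (R : realType) (H : hilbertSpace R) (M : set (H -> H)) :
    set (H -> H) :=
  [set A | M A /\ selfadjoint A].

(* tau preserves suprema of upward directed families of self-adjoint elements. *)
Definition normal (R : realType) (H : hilbertSpace R) (M : set (H -> H))
    (tau : (H -> H) -> R[i]) : Prop :=
  forall (D : set (H -> H)) (A : H -> H),
    D !=set0 -> D `<=` sa_part M ->
    (forall B C, D B -> D C -> exists E, [/\ D E, le_op B E & le_op C E]) ->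
    sa_part M A -> (forall B, D B -> le_op B A) ->
    (forall C, sa_part M C -> (forall B, D B -> le_op B C) -> le_op A C) ->
    complex.Re (tau A) = sup [set complex.Re (tau B) | B in D].

(* The GNS representation of tau is faithful; this is weaker than faithfulness
   of tau. *)
Definition nondegenerate_state (R : realType) (H : hilbertSpace R)
    (M : set (H -> H)) (tau : (H -> H) -> R[i]) : Prop :=
  forall A, M A ->
    (forall B C, M B -> M C -> tau (B \o A \o C) = 0) -> A = 0.

Record ncProbSpace (R : realType) := NcProbSpace {
  nc_hilbert :> hilbertSpace R ;
  nc_alg : set (nc_hilbert -> nc_hilbert) ;
  nc_tau : (nc_hilbert -> nc_hilbert) -> R[i] ;
  nc_von_neumann : von_neumann_algebra nc_alg ;
  nc_state : state nc_alg nc_tau ;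
  nc_normal : normal nc_alg nc_tau ;
  nc_nondegenerate : nondegenerate_state nc_alg nc_tau
}.

Arguments nc_alg {R} n _.
Arguments nc_tau {R} n _.

Definition sa_var (R : realType) (P : ncProbSpace R) (X : P -> P) : Prop :=
  sa_part (nc_alg P) X.

Definition is_inverse (R : realType) (P : ncProbSpace R) (A Z : P -> P) : Prop :=
  [/\ nc_alg P Z, A \o Z = id & Z \o A = id].

Definition invertible_op (R : realType) (P : ncProbSpace R) (A : P -> P) : Prop :=
  exists Z, is_inverse A Z.

(* The k-th power of an operator X is iter k X. *)
Definition has_law (R : realType) (P : ncProbSpace R) (X : P -> P)
    (mu : probability R R) : Prop :=
  forall k : nat,
    mu.-integrable setT (fun x : R => (x ^+ k)%:E) /\
    nc_tau P (iter k X) = real_complex R (\int[mu]_x (x ^+ k))%R.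

Definition symmetric_law (R : realType) (mu : probability R R) : Prop :=
  forall A : set R, measurable A -> mu (-%R @^-1` A) = mu A.

(* X^k1 Y^k2 X^k3 ... for s = [:: k1; k2; k3; ...] *)
Fixpoint alt_word (T : Type) (X Y : T -> T) (s : seq nat) : T -> T :=
  if s is k :: s' then iter k X \o alt_word Y X s' else id.

Fixpoint alt_moment (R : realType) (P : ncProbSpace R) (X Y : P -> P)
    (s : seq nat) : R[i] :=
  if s is k :: s' then nc_tau P (iter k X) * alt_moment Y X s' else 1.

Definition boolean_independent (R : realType) (P : ncProbSpace R)
    (X Y : P -> P) : Prop :=
  forall s : seq nat, all (leq 1) s ->
    nc_tau P (alt_word X Y s) = alt_moment X Y s /\
    nc_tau P (alt_word Y X s) = alt_moment Y X s.

Definition classically_independent (R : realType) (P : ncProbSpace R)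
    (X Y : P -> P) : Prop :=
  X \o Y = Y \o X /\
  forall m n : nat, nc_tau P (iter m X \o iter n Y) =
                    nc_tau P (iter m X) * nc_tau P (iter n Y).

(* lne 0 = -oo and, in \bar R, 0^-1 = +oo. *)
Definition boolean_entropy (R : realType) (mu : probability R R) : \bar R :=
  (\int[mu]_x lne `|x|%:E)%E.

(* On the diagonal x^2 = y^2 this is the continuous extension 1/x^2. *)
Definition fisher_kernel (R : realType) (x y : R) : \bar R :=
  if x ^+ 2 == y ^+ 2 then ((x ^+ 2)%:E^-1)%E
  else ((lne (x ^+ 2)%:E - lne (y ^+ 2)%:E) / (x ^+ 2 - y ^+ 2)%:E)%E.

Definition boolean_fisher (R : realType) (mu : probability R R) : \bar R :=
  (\int[mu]_x \int[mu]_y fisher_kernel x y)%E.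

Definition inv_sq_integral (R : realType) (mu : probability R R) : \bar R :=
  (\int[mu]_x (x ^+ 2)%:E^-1)%E.

Definition inv_sum_sq_integral (R : realType) (mu : probability R R) : \bar R :=
  (\int[mu]_x \int[mu]_y (2%:E * (x ^+ 2 + y ^+ 2)%:E^-1))%E.

(* Compactly supported probability measures, with the weak topology: the coarsest
   one for which mu |-> \int f dmu is continuous for all continuous f : R -> R.
   On the measures supported in a fixed compact set this is the usual topology
   of weak convergence. Without a common bound on the supports, bounded
   continuous test functions would not do: the entropy is not upper
   semicontinuous for them, as log |x| is unbounded at infinity. *)

Definition compactly_supported (R : realType) (mu : probability R R) : Prop :=
  exists K : set R, [/\ compact K, measurable K & mu (~` K) = 0%E].

Definition csProb (R : realType) : Type :=
  {mu : probability R R | compactly_supported mu}.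

HB.instance Definition _ (R : realType) := gen_eqMixin (csProb R).
HB.instance Definition _ (R : realType) := gen_choiceMixin (csProb R).

Definition test_integral (R : realType) (f : {f : R -> R | continuous f})
    (mu : csProb R) : R :=
  \int[sval mu]_x (sval f x).

HB.instance Definition _ (R : realType) :=
  Topological.copy (csProb R)
    (sup_topology (fun f : {f : R -> R | continuous f} =>
       Topological.class (initial_topology (test_integral f)))).

Definition symmetric_csProb (R : realType) : set (csProb R) :=
  [set mu | symmetric_law (sval mu)].

Definition upper_semicontinuous (R : realType) (T : topologicalType)
    (f : T -> \bar R) : Prop :=
  forall (x : T) (a : R), (f x < a%:E)%E ->
    exists2 V, nbhs x V & forall y, V y -> (f y < a%:E)%E.

(* Main.v *)
Require Import Defs.
From HB Require Import structures.
From mathcomp Require Import all_boot all_order all_algebra.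
From mathcomp Require Import all_classical all_reals all_analysis.
From mathcomp Require Import complex sesquilinear measurable_realfun.
From mathcomp Require Import ring lra zify.

Set Implicit Arguments.
Unset Strict Implicit.
Unset Printing Implicit Defensive.

Import Order.TTheory GRing.Theory Num.Theory.
Import numFieldNormedType.Exports.

Local Open Scope classical_set_scope.
Local Open Scope ring_scope.

(* Write g_m(t) = \int 1/(x^2 + t) dm(x). Partial fractions give
     (log u - log v) / (u - v) = \int_0^oo dt / ((u + t)(v + t)),
     log u = log T - \int_0^T dt / (u + t) + O(u / T),
   so that Psi(m) = \int_0^oo g_m(t)^2 dt is the increasing limit of Riemann sums of g_m^2, and
   2 Gamma(m) is, up to a vanishing error controlled by the second moment, the limit of
   log 2^n minus Riemann sums of g_m. Everything is thereby reduced to g_m at finitely many t > 0.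
   (1) The scalar bounds follow from the arithmetic-geometric inequality and from convexity of
       s |-> 1/(s + t)^2; the operator versions from Neumann polynomials p_n(A) -> A^-1.
   (2) For fixed t, g_m(t) is continuous in m.
   (3) Expanding the resolvent of (X + Y)^2 and factoring by Boolean independence gives
       1/(t g_{X+Y}(t)) = 1/(t g_X(t)) + 1/(t g_Y(t)) - 1. With the tangent line of the concave
       function w |-> w / (theta + (1 - theta) t w), integrated against the law of X and of Y, this
       bounds g of sqrt(theta) X + sqrt(1 - theta) Y by a weighted harmonic mean of g_X and g_Y.
   Since normality is the only continuity assumed of tau, its boundedness on self-adjoint elements,
   which yields compactly supported laws, is derived from the Neumann series. *)

(** * Riemann sums on the half-line *)

(** A law is known here only through its moments. Apart from the Neumann series behind the
    boundedness of tau, resolvents of operators are therefore replaced by truncated geometric series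
    in [1 - (X^2 + t) / c], whose remainder is uniformly small on the compact support of the law.
    This is why the operator arguments carry a bound [c] and a remainder to be sent to zero. Riemann
    sums stand in for integrals over [t] because convergence and inequalities of transforms hold
    node by node and survive finite sums, and because a double integral factors at each node. The
    step [2^-n] with [4^n] nodes refines the mesh and exhausts the half-line along a single index;
    right endpoints avoid [t = 0], where the transform of a law charging the origin would be
    infinite. The entropy may be [-oo] and the Fisher information [+oo]. Finite quantities are
    compared at each level [n], and only then is the limit taken in the extended reals. *)

Lemma sum_ord_double (V : nmodType) (f : nat -> V) N :
  \sum_(i < (N + N)%N) f i = \sum_(i < N) (f i.*2 + f i.*2.+1).
Proof.
elim: N => [|N IH]; first by rewrite !big_ord0.
by rewrite addnS addSn !big_ord_recr /= IH -!addrA addnn.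
Qed.

Definition mesh (R : realType) (n : nat) : R := 2 ^- n.

Definition node (R : realType) (n i : nat) : R := i.+1%:R * mesh R n.

Definition riemann (R : realType) (n : nat) (F : R -> R) : R :=
  \sum_(i < (4 ^ n)%N) mesh R n * F (node R n i).

Section RiemannSums.
Variable R : realType.
Implicit Types (F G Phi : R -> R) (n i : nat).

Lemma mesh_gt0 n : 0 < mesh R n.
Proof. by rewrite /mesh invr_gt0 exprn_gt0. Qed.

Lemma mesh_le1 n : mesh R n <= 1.
Proof. by rewrite /mesh invf_le1 ?exprn_ege1 ?exprn_gt0// ler1n. Qed.

Lemma meshS n : mesh R n = mesh R n.+1 + mesh R n.+1.
Proof.
rewrite /mesh exprS invfM -mulrDl; suff -> : 2^-1 + 2^-1 = 1 :> R by rewrite mul1r.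
by field.
Qed.

Lemma mesh_le n : mesh R n <= n.+1%:R^-1.
Proof.
by rewrite /mesh lef_pV2 ?posrE ?exprn_gt0// -natrX ler_nat ltn_expl.
Qed.

Lemma cvg_mesh : (mesh R n) @[n --> \oo] --> 0.
Proof.
apply: (squeeze_cvgr _ (cvg_cst 0) (@cvg_harmonic R)).
by near=> n; rewrite (ltW (mesh_gt0 n))/= mesh_le.
Unshelve. all: by end_near. Qed.

Lemma node_gt0 n i : 0 < node R n i.
Proof. by rewrite /node mulr_gt0// mesh_gt0. Qed.

Lemma nodeS n i : node R n i.+1 = node R n i + mesh R n.
Proof. by rewrite /node -[i.+2]addn1 natrD mulrDl mul1r. Qed.

Lemma node_double n i : node R n i = node R n.+1 i.*2.+1.
Proof.
rewrite /node (meshS n) mulrDr -mulrDl -natrD.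
by congr (_%:R * _); lia.
Qed.

Lemma node_le n i j : (i <= j)%N -> node R n i <= node R n j.
Proof. by move=> ij; rewrite /node ler_pM2r ?mesh_gt0// ler_nat ltnS. Qed.

(** The index [4 ^ n] is one past the last node of [riemann n]; it closes the interval when the
    nodes serve as left endpoints. *)
Lemma node_last n : node R n (4 ^ n)%N = 2 ^+ n + mesh R n.
Proof.
rewrite /node -addn1 natrD mulrDl mul1r; congr (_ + _).
have -> : (4 ^ n)%N%:R = 2 ^+ n * 2 ^+ n :> R by rewrite natrX -exprMn -natrM.
by rewrite /mesh mulfK// expf_neq0.
Qed.

(** Halving a cell and sampling a decreasing function at the two right ends can only raise its
    contribution; the nodes of level [n.+1] beyond [2^n] add nonnegative terms. *)
Lemma riemann_nondecreasing F n :
  (forall t, 0 < t -> 0 <= F t) ->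
  (forall s t, 0 < s -> s <= t -> F t <= F s) ->
  riemann n F <= riemann n.+1 F.
Proof.
move=> F0 Fd; rewrite /riemann.
apply: (@le_trans _ _
  (\sum_(i < (4 ^ n + 4 ^ n)%N) mesh R n.+1 * F (node R n.+1 i))).
  rewrite (sum_ord_double (fun i => mesh R n.+1 * F (node R n.+1 i))).
  apply: ler_sum => i _.
  rewrite {1}(meshS n) mulrDl.
  by apply: lerD; rewrite ler_pM2l ?mesh_gt0//; apply: Fd;
    rewrite ?node_gt0// (node_double n i) node_le.
rewrite -(big_mkord xpredT (fun i => mesh R n.+1 * F (node R n.+1 i))).
rewrite -(big_mkord xpredT (fun i => mesh R n.+1 * F (node R n.+1 i))).
rewrite (@big_cat_nat _ _ _ (4 ^ n + 4 ^ n)%N 0%N (4 ^ n.+1))//=; last by rewrite expnS; lia.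
rewrite lerDl sumr_ge0// => i _.
by rewrite mulr_ge0 ?F0 ?node_gt0// ltW// mesh_gt0.
Qed.

Lemma riemann_le_primitive F Phi n :
  (forall t h, 0 <= t -> 0 < h -> h * F (t + h) <= Phi (t + h) - Phi t) ->
  riemann n F <= Phi (2 ^+ n) - Phi 0.
Proof.
move=> FPhi; rewrite /riemann.
have -> : 2 ^+ n = (4 ^ n)%N%:R * mesh R n :> R.
  by have := node_last n; rewrite /node -addn1 natrD mulrDl mul1r => /addIr.
elim: (4 ^ n)%N => [|N IH]; first by rewrite big_ord0 mul0r subrr.
rewrite big_ord_recr /=.
have := FPhi (N%:R * mesh R n) (mesh R n).
rewrite mulr_ge0 ?ler0n ?(ltW (mesh_gt0 n))// mesh_gt0 => /(_ isT isT).
have -> : N%:R * mesh R n + mesh R n = node R n N.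
  by rewrite /node -addn1 natrD mulrDl mul1r.
rewrite {3}/node in IH *; lra.
Qed.

(** Read as left endpoints, the nodes cover the interval from [mesh] to [2^n + mesh]. The primitive
    is evaluated at positive points only, so the bound remains usable when it is singular at 0. *)
Lemma riemann_ge_primitive F Phi n :
  (forall t h, 0 < t -> 0 < h -> Phi (t + h) - Phi t <= h * F t) ->
  Phi (2 ^+ n + mesh R n) - Phi (mesh R n) <= riemann n F.
Proof.
move=> FPhi; rewrite /riemann -node_last.
elim: (4 ^ n)%N => [|N IH]; first by rewrite big_ord0 /node mul1r subrr.
rewrite big_ord_recr /=.
have := FPhi (node R n N) (mesh R n) (node_gt0 _ _) (mesh_gt0 _).
by rewrite -nodeS; lra.
Qed.

Lemma riemannD n F G : riemann n (fun t => F t + G t) = riemann n F + riemann n G.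
Proof. by rewrite /riemann -big_split; apply: eq_bigr => i _; rewrite mulrDr. Qed.

Lemma riemannZ n a F : riemann n (fun t => a * F t) = a * riemann n F.
Proof. by rewrite /riemann mulr_sumr; apply: eq_bigr => i _; rewrite mulrCA. Qed.

Lemma le_riemann n F G :
  (forall t, 0 < t -> F t <= G t) -> riemann n F <= riemann n G.
Proof.
by move=> FG; apply: ler_sum => i _; rewrite ler_pM2l ?mesh_gt0// FG// node_gt0.
Qed.

Lemma riemann_ge0 n F : (forall t, 0 < t -> 0 <= F t) -> 0 <= riemann n F.
Proof.
by move=> F0; apply: sumr_ge0 => i _; rewrite mulr_ge0 ?F0 ?node_gt0// ltW// mesh_gt0.
Qed.

Lemma ln_le_subr1 (x : R) : 0 < x -> ln x <= x - 1.
Proof.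
move=> x0; have := @expR_ge1Dx R (ln x); rewrite lnK ?posrE//; lra.
Qed.

Lemma ln_ge_1subV (x : R) : 0 < x -> 1 - x^-1 <= ln x.
Proof.
move=> x0; have := @ln_le_subr1 x^-1; rewrite invr_gt0 lnV ?posrE// => /(_ x0); lra.
Qed.

End RiemannSums.

(** * The Fisher kernel as an integral of resolvents *)

Definition resolvent_kernel (R : realType) (n : nat) (u v : R) : R :=
  riemann n (fun t => (u + t)^-1 * (v + t)^-1).

Section Kernel.
Variable R : realType.
Implicit Types (u v t h : R) (n : nat).

Lemma ln_increment p h : 0 < p -> 0 < h ->
  h * (p + h)^-1 <= ln (p + h) - ln p <= h * p^-1.
Proof.
move=> p0 h0; have ph0 : 0 < p + h by rewrite addr_gt0.
have r0 : 0 < (p + h) / p by rewrite divr_gt0.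
rewrite -ln_div ?posrE//; apply/andP; split.
  apply: le_trans (ln_ge_1subV r0); rewrite invf_div le_eqVlt; apply/orP; left.
  by apply/eqP; field; rewrite gt_eqF.
apply: le_trans (ln_le_subr1 r0) _; rewrite le_eqVlt; apply/orP; left.
by apply/eqP; field; rewrite gt_eqF.
Qed.

(** The middle term is the logarithm of the cross-ratio [r = (p + h) q / (p (q + h))], and
    [1 - 1/r <= ln r <= r - 1]. The outer terms are the values at [s = h] and [s = 0] of the
    integrand [(q - p) / ((p + s) (q + s))], times [h]. *)
Lemma ln_increment_diff p q h : 0 < p -> p < q -> 0 < h ->
  h * ((p + h)^-1 * (q + h)^-1) * (q - p) <=
    (ln (p + h) - ln p) - (ln (q + h) - ln q) <= h * (p^-1 * q^-1) * (q - p).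
Proof.
move=> p0 pq h0; have q0 := lt_trans p0 pq.
have ph0 : 0 < p + h by rewrite addr_gt0.
have qh0 : 0 < q + h by rewrite addr_gt0.
have -> : (ln (p + h) - ln p) - (ln (q + h) - ln q) =
    ln (((p + h) * q) / (p * (q + h))).
  by rewrite ln_div ?posrE ?mulr_gt0// !lnM ?posrE//; ring.
have r0 : 0 < ((p + h) * q) / (p * (q + h)) by rewrite divr_gt0// mulr_gt0.
have hqp : 0 <= h * (q - p) by rewrite mulr_ge0 ?subr_ge0// ltW.
apply/andP; split.
  apply: le_trans (ln_ge_1subV r0).
  have -> : 1 - ((p + h) * q / (p * (q + h)))^-1 = h * (q - p) * ((p + h)^-1 * q^-1).
    by field; rewrite !gt_eqF.
  rewrite mulrAC; apply: ler_wpM2l => //; rewrite ler_pM2l ?invr_gt0// lef_pV2 ?posrE//.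
  by rewrite lerDl ltW.
apply: le_trans (ln_le_subr1 r0) _.
have -> : (p + h) * q / (p * (q + h)) - 1 = h * (q - p) * (p^-1 * (q + h)^-1).
  by field; rewrite !gt_eqF.
rewrite [leRHS]mulrAC; apply: ler_wpM2l => //; rewrite ler_pM2l ?invr_gt0// lef_pV2 ?posrE//.
by rewrite lerDl ltW.
Qed.

Lemma resolvent_kernel_ge0 n u v : 0 <= u -> 0 <= v -> 0 <= resolvent_kernel n u v.
Proof.
move=> u0 v0; apply: riemann_ge0 => t t0.
by rewrite mulr_ge0// invr_ge0 addr_ge0// ltW.
Qed.

Lemma resolvent_kernelC n u v : resolvent_kernel n u v = resolvent_kernel n v u.
Proof. by apply: eq_bigr => i _; rewrite [_^-1 * _]mulrC. Qed.

Lemma resolvent_kernel_nondecreasing u v : 0 <= u -> 0 <= v ->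
  {homo (fun n => resolvent_kernel n u v) : m n / (m <= n)%N >-> m <= n}.
Proof.
move=> u0 v0; apply/nondecreasing_seqP => n; apply: riemann_nondecreasing => [t t0|s t s0 st].
  by rewrite mulr_ge0// invr_ge0 addr_ge0// ltW.
have t0 := lt_le_trans s0 st.
by rewrite ler_pM// ?lef_pV2 ?posrE ?lerD2l// ?invr_ge0 ?addr_ge0 ?ltr_wpDl// ltW.
Qed.

(** Termwise [2 a b <= a^2 + b^2]; it reduces the upper bound of (1) to the diagonal of the
    kernel. *)
Lemma resolvent_kernel_le_mean n u v : 0 <= u -> 0 <= v ->
  resolvent_kernel n u v <= 2^-1 * (resolvent_kernel n u u + resolvent_kernel n v v).
Proof.
move=> u0 v0; rewrite /resolvent_kernel -riemannD -riemannZ.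
apply: le_riemann => t t0; have := sqr_ge0 ((u + t)^-1 - (v + t)^-1); nra.
Qed.

(** At each node, [(u + t) (v + t)] is at most the square of [(u + v) / 2 + t]. The diagonal kernel
    at the midpoint tends to [2 / (u + v)], the integrand of the lower bound of (1). *)
Lemma resolvent_kernel_midpoint n u v : 0 <= u -> 0 <= v ->
  resolvent_kernel n ((u + v) / 2) ((u + v) / 2) <= resolvent_kernel n u v.
Proof.
move=> u0 v0; apply: le_riemann => t t0.
have ut : 0 < u + t by rewrite ltr_wpDl.
have vt : 0 < v + t by rewrite ltr_wpDl.
have mt : 0 < (u + v) / 2 + t by lra.
rewrite -!invfM lef_pV2 ?posrE ?mulr_gt0//.
by have := sqr_ge0 (u - v); nra.
Qed.

Lemma resolvent_kernel_upper n u v : 0 < u -> u < v ->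
  resolvent_kernel n u v <= (ln v - ln u) / (v - u).
Proof.
move=> u0 uv; have v0 := lt_trans u0 uv; have d0 : 0 < v - u by rewrite subr_gt0.
pose Phi t := (ln (u + t) - ln (v + t)) / (v - u).
apply: (@le_trans _ _ (Phi (2 ^+ n) - Phi 0)).
  apply: riemann_le_primitive => t h t0 h0; rewrite /Phi !addrA -mulrBl ler_pdivlMr//.
  have ut : 0 < u + t by lra.
  have uvt : u + t < v + t by lra.
  by have /andP[] := ln_increment_diff ut uvt h0; lra.
rewrite /Phi !addr0 -mulrBl ler_pM2r ?invr_gt0//.
have T0 : 0 < 2 ^+ n :> R by rewrite exprn_gt0.
have : ln (u + 2 ^+ n) <= ln (v + 2 ^+ n) by rewrite ler_ln ?posrE; lra.
by lra.
Qed.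

Lemma resolvent_kernel_lower n u v : 0 <= u -> u < v ->
  (ln (v + mesh R n) - ln (u + mesh R n)) / (v - u) - mesh R n
    <= resolvent_kernel n u v.
Proof.
move=> u0 uv; have v0 := le_lt_trans u0 uv; have d0 : 0 < v - u by rewrite subr_gt0.
have m0 := mesh_gt0 R n.
pose Phi t := (ln (u + t) - ln (v + t)) / (v - u).
apply: (@le_trans _ _ (Phi (2 ^+ n + mesh R n) - Phi (mesh R n))); last first.
  apply: riemann_ge_primitive => t h t0 h0; rewrite /Phi !addrA -mulrBl ler_pdivrMr//.
  have ut : 0 < u + t by lra.
  have uvt : u + t < v + t by lra.
  by have /andP[] := ln_increment_diff ut uvt h0; lra.
(* Only the tail beyond [T = 2^n + mesh] is left: [ln (v + T) - ln (u + T)] is at most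
   [(v - u) / (u + T)], and [1 / (u + T)] is at most the mesh. *)
rewrite -[leLHS]addrC /Phi -mulNr opprB lerD2r ler_pdivlMr//.
have T0 : 0 < 2 ^+ n :> R by rewrite exprn_gt0.
have uT : 0 < u + (2 ^+ n + mesh R n) by lra.
have /andP[_] := ln_increment uT d0.
rewrite (_ : u + (2 ^+ n + mesh R n) + (v - u) = v + (2 ^+ n + mesh R n)); last by ring.
suff : (v - u) / (u + (2 ^+ n + mesh R n)) <= (v - u) * mesh R n by lra.
rewrite ler_pM2l// /mesh lef_pV2 ?posrE ?exprn_gt0//.
by move: m0; rewrite /mesh; lra.
Qed.

Lemma resolvent_kernel_diag_upper n u : 0 < u -> resolvent_kernel n u u <= u^-1.
Proof.
move=> u0; pose Phi t := - (u + t)^-1.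
apply: (@le_trans _ _ (Phi (2 ^+ n) - Phi 0)).
  apply: riemann_le_primitive => t h t0 h0; rewrite /Phi !addrA.
  have ut : 0 < u + t by lra.
  have uth : 0 < u + t + h by lra.
  have -> : - (u + t + h)^-1 - - (u + t)^-1 = h * ((u + t)^-1 * (u + t + h)^-1).
    by field; rewrite !gt_eqF.
  rewrite ler_pM2l// ler_pM2r ?invr_gt0// lef_pV2 ?posrE//; lra.
rewrite /Phi addr0 opprK gerDr oppr_le0 invr_ge0 addr_ge0 ?exprn_ge0// ltW//.
Qed.

Lemma resolvent_kernel_diag_lower n u : 0 <= u ->
  (u + mesh R n)^-1 - mesh R n <= resolvent_kernel n u u.
Proof.
move=> u0; have m0 := mesh_gt0 R n; pose Phi t := - (u + t)^-1.
apply: (@le_trans _ _ (Phi (2 ^+ n + mesh R n) - Phi (mesh R n))); last first.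
  apply: riemann_ge_primitive => t h t0 h0; rewrite /Phi !addrA.
  have ut : 0 < u + t by lra.
  have uth : 0 < u + t + h by lra.
  have -> : - (u + t + h)^-1 - - (u + t)^-1 = h * ((u + t)^-1 * (u + t + h)^-1).
    by field; rewrite !gt_eqF.
  rewrite ler_pM2l// ler_pM2l ?invr_gt0// lef_pV2 ?posrE//; lra.
rewrite /Phi opprK addrC lerD2r lerN2.
have T0 : 0 < 2 ^+ n :> R by rewrite exprn_gt0.
by rewrite [leRHS]/mesh lef_pV2 ?posrE//; lra.
Qed.

Lemma ler_nat_exp2 n : n%:R <= 2 ^+ n :> R.
Proof. by rewrite -natrX ler_nat ltnW// ltn_expl. Qed.

Lemma cvg_inv_mesh u : 0 <= u -> ((u + mesh R n)^-1)%:E @[n --> \oo] --> (u%:E^-1)%E.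
Proof.
rewrite inver le_eqVlt eq_sym => /orP[/eqP ->|u0].
  rewrite eqxx; apply/cvgeryP/cvgryPge => A; near=> n.
  rewrite add0r /mesh invrK; apply: le_trans (ler_nat_exp2 n).
  by near: n; exact: nbhs_infty_ger.
rewrite gt_eqF//; apply: cvg_EFin; first by near=> n.
apply: cvgV; first by rewrite gt_eqF.
by rewrite -[X in _ --> X]addr0; apply: cvgD; [exact: cvg_cst|exact: cvg_mesh].
Unshelve. all: by end_near. Qed.

Lemma cvg_resolvent_kernel_diag u : 0 <= u ->
  (resolvent_kernel n u u)%:E @[n --> \oo] --> (u%:E^-1)%E.
Proof.
move=> u0; have lower : (((u + mesh R n)^-1)%:E - (mesh R n)%:E)%E @[n --> \oo] -->
    (u%:E^-1 - 0%:E)%E.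
  apply: cvgeB; [exact: fin_num_adde_defl|exact: cvg_inv_mesh|].
  by apply: cvg_EFin; [near=> n|exact: cvg_mesh].
rewrite sube0 in lower; apply: (squeeze_cvge _ lower (cvg_cst _)); near=> n.
rewrite -EFinB lee_fin resolvent_kernel_diag_lower//= inver.
case: eqVneq => [_|uN0]; first exact: leey.
by rewrite lee_fin resolvent_kernel_diag_upper// lt_neqAle eq_sym uN0.
Unshelve. all: by end_near. Qed.

(** A single vanishing square makes the quotient [+oo] on either side: [lne 0 = -oo] is divided by a
    negative number when [x = 0], and is subtracted and divided by a positive one when [y = 0]. *)
Lemma fisher_kernelE (x y : R) : fisher_kernel x y =
  if x ^+ 2 == y ^+ 2 then ((x ^+ 2)%:E^-1)%E
  else if (x ^+ 2 == 0) || (y ^+ 2 == 0) then +oo%E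
  else ((ln (y ^+ 2) - ln (x ^+ 2)) / (y ^+ 2 - x ^+ 2))%:E.
Proof.
rewrite /fisher_kernel; case: eqP => [//|].
have := sqr_ge0 y; have := sqr_ge0 x.
move: (x ^+ 2) (y ^+ 2) => u v u0 v0 /eqP uv.
have uv0 : (u - v == 0) = false by rewrite subr_eq0 (negbTE uv).
rewrite inver uv0.
have [u00|uN0]/= := eqVneq u 0.
  have v_gt0 : 0 < v by rewrite lt_neqAle v0 -u00 uv.
  by rewrite u00 lexx lt_geF//= mulNyr ltr0_sg ?invr_lt0 ?sub0r ?oppr_lt0// mulN1e.
have u_gt0 : 0 < u by rewrite lt_neqAle u0 eq_sym uN0.
have [v00|vN0]/= := eqVneq v 0.
  by rewrite v00 lexx lt_geF//= subr0 mulyr gtr0_sg ?invr_gt0// mul1e.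
have v_gt0 : 0 < v by rewrite lt_neqAle v0 eq_sym vN0.
rewrite !lt_geF//= -EFinB -EFinM; congr EFin.
by field; rewrite -(opprB u v) oppr_eq0 uv0.
Qed.

Lemma fisher_kernelC (x y : R) : fisher_kernel x y = fisher_kernel y x.
Proof.
rewrite !fisher_kernelE eq_sym; case: eqVneq => [->//|xy].
rewrite orbC; case: ifP => // _; congr EFin.
by field; rewrite -(opprB (x ^+ 2)) oppr_eq0 subr_eq0 eq_sym xy.
Qed.

Lemma cvg_resolvent_kernel (x y : R) :
  (resolvent_kernel n (x ^+ 2) (y ^+ 2))%:E @[n --> \oo] --> fisher_kernel x y.
Proof.
wlog xy : x y / x ^+ 2 <= y ^+ 2 => [H|].
  have [/H//|/ltW/H] := leP (x ^+ 2) (y ^+ 2).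
  by rewrite fisher_kernelC; under eq_fun do rewrite resolvent_kernelC.
rewrite fisher_kernelE; have := sqr_ge0 y; have := sqr_ge0 x.
move: (x ^+ 2) (y ^+ 2) xy => u v uv u0 v0.
case: eqVneq => [->|/eqP uNv]; first exact: cvg_resolvent_kernel_diag.
have {uNv}uv : u < v by rewrite lt_neqAle uv andbT; exact/eqP.
have {}v0 : 0 < v by exact: le_lt_trans uv.
rewrite (gt_eqF v0) orbF; case: eqVneq => [u00|uN0].
  (* At [u = 0] the lower bound contains [- ln (mesh R n) = n ln 2] and so exceeds every [A]. *)
  apply/cvgeryP/cvgryPge => A; near=> n.
  apply: le_trans (resolvent_kernel_lower n u0 uv).
  rewrite u00 subr0 add0r lerBrDr ler_pdivlMr//.
  have ln2 : 0 < ln 2 :> R by rewrite ln_gt0// ltr1n.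
  have : ln v <= ln (v + mesh R n).
    by rewrite ler_ln ?posrE ?addr_gt0 ?mesh_gt0// lerDl ltW// mesh_gt0.
  have -> : ln (mesh R n) = - (n%:R * ln 2).
    by rewrite /mesh lnV ?posrE ?exprn_gt0// lnXn// mulr_natl.
  suff : (A + 1) * v <= ln v + n%:R * ln 2.
    suff : (A + mesh R n) * v <= (A + 1) * v by lra.
    by rewrite ler_pM2r// lerD2l mesh_le1.
  by rewrite -lerBlDl -ler_pdivrMr//; near: n; exact: nbhs_infty_ger.
have {}u0 : 0 < u by rewrite lt_neqAle eq_sym uN0.
apply: cvg_EFin; first by near=> n.
have lower : (ln (v + mesh R n) - ln (u + mesh R n)) / (v - u) - mesh R n @[n --> \oo]
    --> (ln v - ln u) / (v - u).
  rewrite -[X in _ --> X]subr0; apply: cvgB; last exact: cvg_mesh.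
  have ln_shift w : 0 < w -> ln (w + mesh R n) @[n --> \oo] --> ln w.
    move=> w0; apply: (continuous_cvg _ (continuous_ln w0)).
    by rewrite -[X in _ --> X]addr0; apply: cvgD; [exact: cvg_cst|exact: cvg_mesh].
  by apply: cvgMl; apply: cvgB; exact: ln_shift.
apply: (squeeze_cvgr _ lower (cvg_cst _)).
by near=> n; rewrite /= resolvent_kernel_lower ?resolvent_kernel_upper// ltW.
Unshelve. all: by end_near. Qed.

End Kernel.

(** * The logarithm as a Riemann sum of resolvents *)

Section LogSum.
Variable R : realType.
Implicit Types (u t h : R) (n : nat).

(** The error [u * mesh R n] bounds [ln (u + 2^n) - ln (2^n)]. With [u = x^2] it integrates to the
    second moment times the mesh. *)
Lemma log_sum_lower n u : 0 < u ->
  ln u <= ln (2 ^+ n) + u * mesh R n - riemann n (fun t => (u + t)^-1).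
Proof.
move=> u0; have T0 : 0 < 2 ^+ n :> R by rewrite exprn_gt0.
have : riemann n (fun t => (u + t)^-1) <= ln (u + 2 ^+ n) - ln (u + 0).
  apply: (@riemann_le_primitive _ _ (fun t => ln (u + t))) => t h t0 h0; rewrite !addrA.
  have ut : 0 < u + t by lra.
  by have /andP[] := ln_increment ut h0.
have /andP[_] := ln_increment T0 u0; rewrite addr0 (addrC _ u) -/(mesh R n); lra.
Qed.

(** Here the nodes are left endpoints, so the sum dominates an integral starting at the mesh. The
    logarithm comes out regularised as [ln (u + mesh R n)], which is finite at [u = 0]. *)
Lemma log_sum_upper n u : 0 <= u ->
  ln (2 ^+ n) - riemann n (fun t => (u + t)^-1) <= ln (u + mesh R n).
Proof.
move=> u0; have T0 : 0 < 2 ^+ n :> R by rewrite exprn_gt0.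
have m0 := mesh_gt0 R n.
have : ln (u + (2 ^+ n + mesh R n)) - ln (u + mesh R n) <= riemann n (fun t => (u + t)^-1).
  apply: (@riemann_ge_primitive _ _ (fun t => ln (u + t))) => t h t0 h0; rewrite !addrA.
  have ut : 0 < u + t by lra.
  by have /andP[] := ln_increment ut h0.
have : ln (2 ^+ n) <= ln (u + (2 ^+ n + mesh R n)) by rewrite ler_ln ?posrE; lra.
by lra.
Qed.

End LogSum.

(** * Entropy and Fisher information through the Stieltjes transform *)

(** Both sides are suprema over the simple functions below the integrand, and a larger integrand
    admits more of them. This form applies directly to iterated integrals of [fisher_kernel]. *)
Lemma ge0_le_integralT d (T : measurableType d) (R : realType)
    (mu : {measure set T -> \bar R}) (f g : T -> \bar R) :
  (forall x, 0 <= f x)%E -> (forall x, f x <= g x)%E ->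
  (\int[mu]_x f x <= \int[mu]_x g x)%E.
Proof.
move=> f0 fg; rewrite !ge0_integralTE// => [|x]; last exact: le_trans (fg x).
by apply: ereal_sup_le => _ [h hf <-]; exists h => // x; exact: le_trans (fg x).
Qed.

Lemma le_integralT d (T : measurableType d) (R : realType)
    (mu : {measure set T -> \bar R}) (f g : T -> \bar R) :
  (forall x, f x <= g x)%E -> (\int[mu]_x f x <= \int[mu]_x g x)%E.
Proof.
move=> fg; rewrite integralE [leRHS]integralE.
apply: leeB; apply: ge0_le_integralT => // x; rewrite ?funeposE ?funenegE.
  by rewrite ge_max !le_max fg lexx orbT.
by rewrite ge_max !le_max leeN2 fg lexx orbT.
Qed.

(** Up to sign, the Cauchy transform at [- t] of the law of [X^2]. *)
Definition stieltjes (R : realType) (mu : probability R R) (t : R) : R :=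
  (\int[mu]_x (x ^+ 2 + t)^-1)%R.

Section Stieltjes.
Variables (R : realType) (mu : probability R R).
Implicit Types (t x : R) (n : nat) (f g : R -> R).

Lemma bounded_integrable f (M : R) : measurable_fun setT f ->
  (forall x, `|f x| <= M) -> mu.-integrable setT (EFin \o f).
Proof.
move=> mf fM; apply: measurable_bounded_integrable => //.
  by rewrite ltey_eq fin_num_measure.
by exists M; split; [exact: num_real|move=> y My x _; exact: le_trans (ltW My)].
Qed.

Lemma integral_EFin f : mu.-integrable setT (EFin \o f) ->
  (\int[mu]_x (f x)%:E = (\int[mu]_x f x)%R%:E)%E.
Proof. by move=> fi; rewrite /Rintegral fineK//; exact: integrable_fin_num. Qed.

Lemma continuous_resolvent t : 0 < t -> continuous (fun x : R => (x ^+ 2 + t)^-1).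
Proof.
move=> t0 x; apply: cvgV; first by rewrite gt_eqF// ltr_wpDl// sqr_ge0.
by apply: cvgD; [exact: exprn_continuous|exact: cvg_cst].
Qed.

Lemma resolvent_gt0 t x : 0 < t -> 0 < (x ^+ 2 + t)^-1.
Proof. by move=> t0; rewrite invr_gt0 ltr_wpDl// sqr_ge0. Qed.

Lemma resolvent_le t x : 0 < t -> (x ^+ 2 + t)^-1 <= t^-1.
Proof.
by move=> t0; rewrite lef_pV2 ?posrE ?lerDr ?sqr_ge0// ltr_wpDl// sqr_ge0.
Qed.

Lemma measurable_resolvent t : 0 < t ->
  measurable_fun setT (fun x : R => (x ^+ 2 + t)^-1).
Proof. by move=> t0; apply: continuous_measurable_fun; exact: continuous_resolvent. Qed.

Lemma resolvent_integrable t : 0 < t ->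
  mu.-integrable setT (EFin \o (fun x : R => (x ^+ 2 + t)^-1)).
Proof.
move=> t0; apply: (@bounded_integrable _ t^-1); first exact: measurable_resolvent.
by move=> x; rewrite gtr0_norm ?resolvent_gt0// resolvent_le.
Qed.

Lemma Rintegral_cstT (c : R) : (\int[mu]_x c)%R = c.
Proof. by rewrite Rintegral_cst// [X in fine X]probability_setT mulr1. Qed.

Lemma integrable_cst (c : R) : mu.-integrable setT (EFin \o (fun _ : R => c)).
Proof. by apply: (@bounded_integrable _ `|c|). Qed.

Lemma stieltjes_gt0 t : 0 < t -> 0 < stieltjes mu t.
Proof.
move=> t0; rewrite lt_neqAle; apply/andP; split; last first.
  by apply: Rintegral_ge0 => x _; rewrite ltW// resolvent_gt0.
apply/eqP => /esym g0.
have : (\int[mu]_x `|((x ^+ 2 + t)^-1)%:E| = 0)%E.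
  under eq_integral do rewrite gee0_abs ?lee_fin ?(ltW (resolvent_gt0 _ _))//.
  by rewrite integral_EFin ?[(\int[mu]_x _)%R]g0//; exact: resolvent_integrable.
have /measurable_EFinP mres := measurable_resolvent t0.
move/(ae_eq_integral_abs mu measurableT mres) => [N [mN N0 sub]].
have : (mu setT <= mu N)%E.
  apply: le_measure; rewrite ?inE// => x _; apply: sub => /(_ Logic.I) /eqP.
  by rewrite /cst eqe gt_eqF// resolvent_gt0.
by rewrite N0 (@probability_setT _ _ _ mu) lee_fin ler10.
Qed.

Lemma integrableZ_EFin (c : R) f : mu.-integrable setT (EFin \o f) ->
  mu.-integrable setT (EFin \o (fun x => c * f x)).
Proof. by move=> fi; exact: (integrableZl measurableT c fi). Qed.

Lemma integrableD_EFin f g : mu.-integrable setT (EFin \o f) ->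
  mu.-integrable setT (EFin \o g) -> mu.-integrable setT (EFin \o (fun x => f x + g x)).
Proof. by move=> fi gi; exact: (integrableD measurableT fi gi). Qed.

Lemma integrable_riemann (F : R -> R -> R) n :
  (forall t, 0 < t -> mu.-integrable setT (EFin \o F t)) ->
  mu.-integrable setT (EFin \o (fun x => riemann n (fun t => F t x))).
Proof.
move=> Fi; have -> : EFin \o (fun x => riemann n (fun t => F t x)) =
    fun x => (\sum_(i < (4 ^ n)%N) (mesh R n * F (node R n i) x)%:E)%E.
  by apply/funext => x /=; rewrite sumEFin.
by apply: integrable_sum => // i _; apply: integrableZ_EFin; apply: Fi; exact: node_gt0.
Qed.

Lemma Rintegral_riemann (F : R -> R -> R) n :
  (forall t, 0 < t -> mu.-integrable setT (EFin \o F t)) ->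
  (\int[mu]_x riemann n (fun t => F t x))%R = riemann n (fun t => (\int[mu]_x F t x)%R).
Proof.
move=> Fi; apply: EFin_inj; rewrite -integral_EFin; last exact: integrable_riemann.
under eq_integral do rewrite -sumEFin.
rewrite integral_sum//; last first.
  by move=> i; apply: integrableZ_EFin; apply: Fi; exact: node_gt0.
rewrite -sumEFin; apply: eq_bigr => i _.
have Fni := Fi _ (node_gt0 R n i).
by rewrite integral_EFin ?RintegralZl//; exact: integrableZ_EFin.
Qed.

Lemma cvg_integral_nondecreasing (h : nat -> R -> \bar R) (l : R -> \bar R) :
  (forall n, measurable_fun setT (h n)) -> (forall n x, 0 <= h n x)%E ->
  (forall x, {homo h^~ x : m n / (m <= n)%N >-> (m <= n)%E}) ->
  (forall x, h n x @[n --> \oo] --> l x) ->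
  (\int[mu]_x h n x)%E @[n --> \oo] --> (\int[mu]_x l x)%E.
Proof.
move=> mh h0 hnd hl; have := @cvg_monotone_convergence _ _ _ mu _ measurableT h mh.
move=> /(_ (fun n x _ => h0 n x) (fun x _ => hnd x)).
suff -> : (\int[mu]_x limn (h^~ x) = \int[mu]_x l x)%E by [].
by apply: eq_integral => x _; apply/cvg_lim => //; exact: hl.
Qed.

Lemma resolvent_kernel_integral n x :
  (\int[mu]_y (resolvent_kernel n (x ^+ 2) (y ^+ 2))%:E)%E =
  (riemann n (fun t => (x ^+ 2 + t)^-1 * stieltjes mu t))%:E.
Proof.
have int_F t : 0 < t ->
    mu.-integrable setT (EFin \o (fun y : R => (x ^+ 2 + t)^-1 * (y ^+ 2 + t)^-1)).
  by move=> t0; apply: integrableZ_EFin; exact: resolvent_integrable.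
rewrite integral_EFin; last exact: integrable_riemann.
rewrite Rintegral_riemann//; congr EFin; apply: eq_bigr => i _; congr (_ * _).
by rewrite RintegralZl//; exact/resolvent_integrable/node_gt0.
Qed.

Lemma integrable_stieltjes_sum n :
  mu.-integrable setT
    (EFin \o (fun x => riemann n (fun t => (x ^+ 2 + t)^-1 * stieltjes mu t))).
Proof.
apply: (@integrable_riemann (fun t x => (x ^+ 2 + t)^-1 * stieltjes mu t)) => t t0.
under [X in EFin \o X]eq_fun do rewrite mulrC.
by apply: integrableZ_EFin; exact: resolvent_integrable.
Qed.

(** At each node the integrand is a function of [x] times a function of [y], so the iterated
    integral is the square of one transform. *)
Lemma integral_resolvent_kernel n :
  (\int[mu]_x \int[mu]_y (resolvent_kernel n (x ^+ 2) (y ^+ 2))%:E)%E =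
  (riemann n (fun t => stieltjes mu t ^+ 2))%:E.
Proof.
under eq_integral do rewrite resolvent_kernel_integral.
rewrite integral_EFin; last exact: integrable_stieltjes_sum.
have int_F t : 0 < t ->
    mu.-integrable setT (EFin \o (fun x : R => (x ^+ 2 + t)^-1 * stieltjes mu t)).
  move=> t0; under [X in EFin \o X]eq_fun do rewrite mulrC.
  by apply: integrableZ_EFin; exact: resolvent_integrable.
rewrite Rintegral_riemann//; congr EFin; apply: eq_bigr => i _; congr (_ * _).
by rewrite RintegralZr//; exact/resolvent_integrable/node_gt0.
Qed.

Lemma resolvent_kernel_nondecreasingE x y :
  {homo (fun n => (resolvent_kernel n (x ^+ 2) (y ^+ 2))%:E) :
    m n / (m <= n)%N >-> (m <= n)%E}.
Proof.
by move=> m n mn; rewrite lee_fin resolvent_kernel_nondecreasing// sqr_ge0.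
Qed.

Lemma measurable_resolvent_kernel n x :
  measurable_fun setT (fun y : R => resolvent_kernel n (x ^+ 2) (y ^+ 2)).
Proof.
apply: measurable_sum => i; apply: measurable_funM => //; apply: measurable_funM => //.
exact: (measurable_resolvent (node_gt0 R n i)).
Qed.

Lemma cvg_inner_fisher x :
  (riemann n (fun t => (x ^+ 2 + t)^-1 * stieltjes mu t))%:E @[n --> \oo]
    --> (\int[mu]_y fisher_kernel x y)%E.
Proof.
under eq_fun do rewrite -resolvent_kernel_integral.
apply: cvg_integral_nondecreasing => [n|n y|y|y].
- by apply/measurable_EFinP; exact: measurable_resolvent_kernel.
- by rewrite lee_fin resolvent_kernel_ge0// sqr_ge0.
- exact: resolvent_kernel_nondecreasingE.
- exact: cvg_resolvent_kernel.
Qed.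

(** Monotone convergence in the inner integral, then in the outer one. *)
Lemma cvg_boolean_fisher :
  (riemann n (fun t => stieltjes mu t ^+ 2))%:E @[n --> \oo] --> boolean_fisher mu.
Proof.
under eq_fun do rewrite -integral_resolvent_kernel.
have inner_ge0 n x :
    (0 <= \int[mu]_y (resolvent_kernel n (x ^+ 2) (y ^+ 2))%:E)%E.
  by apply: integral_ge0 => y _; rewrite lee_fin resolvent_kernel_ge0// sqr_ge0.
apply: cvg_integral_nondecreasing => [n|n x|x m n mn|x].
- have -> : (fun x : R => \int[mu]_y (resolvent_kernel n (x ^+ 2) (y ^+ 2))%:E)%E =
      EFin \o (fun x => riemann n (fun t => (x ^+ 2 + t)^-1 * stieltjes mu t)).
    by apply/funext => x; rewrite resolvent_kernel_integral.
  exact: measurable_int (integrable_stieltjes_sum n).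
- exact: inner_ge0.
- apply: ge0_le_integralT => y; first by rewrite lee_fin resolvent_kernel_ge0// sqr_ge0.
  exact: resolvent_kernel_nondecreasingE.
- by under eq_fun do rewrite resolvent_kernel_integral; exact: cvg_inner_fisher.
Qed.

(** With the convergence above, this makes [boolean_fisher] a supremum of finite sums of squared
    transforms, hence lower semicontinuous for any convergence under which the transforms are
    continuous. *)
Lemma riemann_le_boolean_fisher n :
  ((riemann n (fun t => stieltjes mu t ^+ 2))%:E <= boolean_fisher mu)%E.
Proof.
rewrite -integral_resolvent_kernel.
apply: ge0_le_integralT => x.
  by apply: integral_ge0 => y _; rewrite lee_fin resolvent_kernel_ge0// sqr_ge0.
apply: ge0_le_integralT => y; first by rewrite lee_fin resolvent_kernel_ge0// sqr_ge0.
rewrite -(cvg_lim _ (@cvg_resolvent_kernel R x y))//; apply: lime_ge.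
  by apply/cvg_ex; exists (fisher_kernel x y); exact: cvg_resolvent_kernel.
by exists n => // m nm; exact: resolvent_kernel_nondecreasingE.
Qed.

End Stieltjes.

(** * Scalar bounds on the Fisher information *)

Section FisherBounds.
Variables (R : realType) (mu : probability R R).
Implicit Types (t x y : R) (n : nat).

Lemma resolvent_kernel_diag_le n x :
  ((resolvent_kernel n (x ^+ 2) (x ^+ 2))%:E <= (x ^+ 2)%:E^-1)%E.
Proof.
have kcvg := @cvg_resolvent_kernel_diag R _ (sqr_ge0 x).
rewrite -(cvg_lim _ kcvg)//; apply: lime_ge; first by apply/cvg_ex; exists (x ^+ 2)%:E^-1%E.
by exists n => // m nm; exact: resolvent_kernel_nondecreasingE.
Qed.

(** The kernel is at most the mean of its two diagonal values. Integrated over both variables, that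
    mean gives back the single integral of the diagonal, which lies below [1 / x^2]. *)
Lemma boolean_fisher_le_inv_sq : (boolean_fisher mu <= inv_sq_integral mu)%E.
Proof.
have fcvg := @cvg_boolean_fisher R mu.
rewrite -(cvg_lim _ fcvg)//; apply: lime_le; first by apply/cvg_ex; exists (boolean_fisher mu).
near=> n; rewrite -integral_resolvent_kernel.
pose k x := resolvent_kernel n (x ^+ 2) (x ^+ 2).
have k_int : mu.-integrable setT (EFin \o k).
  apply: (@integrable_riemann R mu
    (fun t x => (x ^+ 2 + t)^-1 * (x ^+ 2 + t)^-1)) => t t0.
  apply: (@bounded_integrable _ _ _ (t^-1 * t^-1)).
    by apply: measurable_funM; exact: measurable_resolvent.
  move=> x; rewrite normrM gtr0_norm ?resolvent_gt0//.
  by rewrite ler_pM ?resolvent_le// ltW// resolvent_gt0.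
have k_half x : mu.-integrable setT (EFin \o (fun y => 2^-1 * (k x + k y))).
  apply: integrableZ_EFin.
  by apply: integrableD_EFin => //; exact: integrable_cst.
have k_halfE x : (\int[mu]_y (2^-1 * (k x + k y)))%R = 2^-1 * (k x + (\int[mu]_y k y)%R).
  rewrite RintegralZl//; last first.
    by apply: integrableD_EFin => //; exact: integrable_cst.
  by rewrite RintegralD ?Rintegral_cstT//; exact: integrable_cst.
have ksq : (\int[mu]_x \int[mu]_y (resolvent_kernel n (x ^+ 2) (y ^+ 2))%:E <=
    \int[mu]_x (2^-1 * (k x + (\int[mu]_y k y)%R))%:E)%E.
  apply: le_integralT => x; rewrite -k_halfE -integral_EFin//.
  by apply: le_integralT => y; rewrite lee_fin resolvent_kernel_le_mean// sqr_ge0.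
apply: le_trans ksq _.
have kc_int : mu.-integrable setT (EFin \o (fun x => k x + (\int[mu]_y k y)%R)).
  by apply: integrableD_EFin => //; exact: integrable_cst.
rewrite integral_EFin; last exact: integrableZ_EFin.
rewrite RintegralZl// RintegralD ?Rintegral_cstT//; last exact: integrable_cst.
rewrite (_ : 2^-1 * _ = (\int[mu]_y k y)%R); last by field.
rewrite -integral_EFin//; apply: le_integralT => x; exact: resolvent_kernel_diag_le.
Unshelve. all: by end_near. Qed.

Lemma inv_sum_sq_le_boolean_fisher : (inv_sum_sq_integral mu <= boolean_fisher mu)%E.
Proof.
have inv_ge0 x y : (0 <= 2%:E * (x ^+ 2 + y ^+ 2)%:E^-1 :> \bar R)%E.
  rewrite inver; case: ifP => [_|_]; first by rewrite mulry gtr0_sg// mul1e leey.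
  by rewrite lee_fin mulr_ge0// invr_ge0 addr_ge0// sqr_ge0.
apply: ge0_le_integralT => x; first by apply: integral_ge0 => y _; exact: inv_ge0.
apply: ge0_le_integralT => y; first exact: inv_ge0.
(* The claim becomes a comparison of limits: [2 / (x^2 + y^2)] is the limit of the diagonal kernel
   at [m], also for [m = 0], where both are [+oo]. *)
set m := (x ^+ 2 + y ^+ 2) / 2.
have m0 : 0 <= m by rewrite divr_ge0// addr_ge0// sqr_ge0.
have -> : (2%:E * (x ^+ 2 + y ^+ 2)%:E^-1 = m%:E^-1 :> \bar R)%E.
  rewrite !inver /m mulf_eq0 invr_eq0 pnatr_eq0 orbF.
  case: ifP => [_|/negbT N0]; first by rewrite mulry gtr0_sg// mul1e.
  by rewrite -EFinM; congr EFin; field.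
have mcvg := @cvg_resolvent_kernel_diag R _ m0.
rewrite -(cvg_lim _ mcvg)// -(cvg_lim _ (@cvg_resolvent_kernel R x y))//.
apply: lee_lim.
- by apply/cvg_ex; exists (m%:E^-1)%E.
- by apply/cvg_ex; exists (fisher_kernel x y); exact: cvg_resolvent_kernel.
- by near=> n; rewrite lee_fin resolvent_kernel_midpoint// sqr_ge0.
Unshelve. all: by end_near. Qed.

End FisherBounds.

(** The entropy with its singularity at 0 smoothed. The integrand is continuous and decreases to
    [ln |x|], so [boolean_entropy] is an infimum of weakly continuous functionals. *)
Definition log_energy (R : realType) (mu : probability R R) (n : nat) : R :=
  (\int[mu]_x (2^-1 * ln (x ^+ 2 + mesh R n)))%R.

Section Entropy.
Variables (R : realType) (mu : probability R R).
Hypothesis mu_sq : mu.-integrable setT (EFin \o (fun x : R => x ^+ 2)).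
Implicit Types (x : R) (n : nat).

Lemma ln_normE x : x != 0 -> ln `|x| = 2^-1 * ln (x ^+ 2).
Proof.
move=> x0; rewrite -(real_normK (num_real x)) lnXn ?normr_gt0//.
by field.
Qed.

Lemma continuous_half_log (t : R) : 0 < t ->
  continuous (fun x : R => 2^-1 * ln (x ^+ 2 + t)).
Proof.
move=> t0 x; apply: cvgMr; apply: (continuous_cvg _ (continuous_ln _)).
  by rewrite ltr_wpDl// sqr_ge0.
by apply: cvgD; [exact: exprn_continuous|exact: cvg_cst].
Qed.

Lemma half_log_le x n : 2^-1 * ln (x ^+ 2 + mesh R n) <= x ^+ 2.
Proof.
have x0 := sqr_ge0 x; have m0 := mesh_gt0 R n; have m1 := mesh_le1 R n.
have /ln_le_subr1 : 0 < x ^+ 2 + mesh R n by lra.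
by lra.
Qed.

Lemma half_log_ge x n : 2^-1 * ln (mesh R n) <= 2^-1 * ln (x ^+ 2 + mesh R n).
Proof.
have x0 := sqr_ge0 x; have m0 := mesh_gt0 R n.
by rewrite ler_pM2l// ler_ln ?posrE; lra.
Qed.

Lemma half_log_integrable n :
  mu.-integrable setT (EFin \o (fun x : R => 2^-1 * ln (x ^+ 2 + mesh R n))).
Proof.
have m0 := mesh_gt0 R n.
pose g x := x ^+ 2 + `|2^-1 * ln (mesh R n)|.
apply: (@le_integrable _ _ _ mu setT measurableT _ (EFin \o g)).
- by apply/measurable_EFinP; apply: continuous_measurable_fun; exact: continuous_half_log.
- move=> x _; rewrite /= lee_fin (@ger0_norm _ (g x)) ?addr_ge0 ?sqr_ge0//.
  have := half_log_ge x n; have := half_log_le x n; have := sqr_ge0 x.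
  rewrite /g; move: (2^-1 * ln (mesh R n)) => a; move: (2^-1 * _) => b; rewrite ler_norml.
  have := ler_norm (- a); rewrite normrN; have := normr_ge0 a.
  by move: (`|a|) => c; lra.
- by apply: integrableD_EFin => //; exact: integrable_cst.
Qed.

Lemma cvg_half_log x :
  (2^-1 * ln (x ^+ 2 + mesh R n))%:E @[n --> \oo] --> (lne `|x|%:E)%E.
Proof.
have [->|x0] := eqVneq x 0.
  rewrite normr0 /= lexx; apply/cvgeNyPle => A; near=> n.
  rewrite expr0n add0r lee_fin /mesh lnV ?posrE ?exprn_gt0// lnXn//.
  have ln2 : 0 < ln 2 :> R by rewrite ln_gt0// ltr1n.
  suff : - A * 2 <= n%:R * ln 2 by rewrite -mulr_natl; lra.
  by rewrite -ler_pdivrMr//; near: n; exact: nbhs_infty_ger.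
have nx0 : 0 < `|x| by rewrite normr_gt0.
rewrite lne_EFin//.
rewrite ln_normE//.
apply: cvg_EFin; first by near=> n.
apply: cvgMr; apply: (continuous_cvg _ (continuous_ln _)); first by rewrite exprn_even_gt0.
by rewrite -[X in _ --> X]addr0; apply: cvgD; [exact: cvg_cst|exact: cvg_mesh].
Unshelve. all: by end_near. Qed.

Lemma half_log_nonincreasing x :
  {homo (fun n => (2^-1 * ln (x ^+ 2 + mesh R n))%:E) :
    m n / (m <= n)%N >-> (n <= m)%E}.
Proof.
move=> m n mn; rewrite lee_fin ler_pM2l//.
have x0 := sqr_ge0 x; have m0 := mesh_gt0 R n.
rewrite ler_ln ?posrE ?ltr_wpDl ?mesh_gt0// lerD2l /mesh.
by rewrite lef_pV2 ?posrE ?exprn_gt0// ler_eXn2l// ltr1n.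
Qed.

Lemma cvg_maxe (u v : nat -> \bar R) (a b : \bar R) :
  u n @[n --> \oo] --> a -> v n @[n --> \oo] --> b ->
  maxe (u n) (v n) @[n --> \oo] --> maxe a b.
Proof.
move=> ua vb.
exact: (continuous_cvg _ (@max_continuous _ (\bar R) (a, b)) (cvg_pair ua vb)).
Qed.

(** Positive and negative parts are treated apart: the former are dominated by [x^2], the latter
    increase with [n]. Dominated convergence keeps the first limit finite, while monotone
    convergence allows the second to be infinite. *)
Lemma cvg_log_energy : (log_energy mu n)%:E @[n --> \oo] --> boolean_entropy mu.
Proof.
pose f n x := (2^-1 * ln (x ^+ 2 + mesh R n))%:E.
have mf n : measurable_fun setT (f n) by exact: measurable_int (half_log_integrable n).
have -> : (fun n => (log_energy mu n)%:E) =
    (fun n => \int[mu]_x (f n)^\+ x - \int[mu]_x (f n)^\- x)%E.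
  by apply/funext => n; rewrite -integralE -integral_EFin//; exact: half_log_integrable.
rewrite /boolean_entropy integralE.
have cvg_pos x : (f n)^\+%E x @[n --> \oo] --> ((fun x => lne `|x|%:E) ^\+ x)%E.
  rewrite funeposE; under eq_fun do rewrite funeposE.
  by apply: cvg_maxe; [exact: cvg_half_log|exact: cvg_cst].
have cvg_neg x : (f n)^\-%E x @[n --> \oo] --> ((fun x => lne `|x|%:E) ^\- x)%E.
  rewrite funenegE; under eq_fun do rewrite funenegE.
  by apply: cvg_maxe; [apply: cvgeN; exact: cvg_half_log|exact: cvg_cst].
have fp_le n x : (`|(f n)^\+ x| <= (x ^+ 2)%:E)%E.
  by rewrite gee0_abs// funeposE ge_max !lee_fin half_log_le sqr_ge0.
have mfp n : measurable_fun setT (f n)^\+%E by exact: measurable_funepos.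
have mlp : measurable_fun setT ((fun x => lne `|x|%:E) ^\+)%E.
  by apply: (emeasurable_fun_cvg (fun n => (f n)^\+%E)).
have lp_le x : (((fun x => lne `|x|%:E) ^\+)%E x <= (x ^+ 2)%:E)%E.
  rewrite -(cvg_lim _ (cvg_pos x))//; apply: lime_le.
    by apply/cvg_ex; eexists; exact: cvg_pos.
  by near=> n; apply: le_trans (fp_le n x); rewrite gee0_abs.
apply: cvgeB.
- apply: fin_num_adde_defr; apply: integrable_fin_num => //.
  apply: (le_integrable _ mlp _ mu_sq) => // x _.
  by rewrite [leRHS]gee0_abs ?lee_fin ?sqr_ge0// gee0_abs.
- apply: (dominated_cvg measurableT mfp (fun x _ => cvg_pos x) _ mu_sq) => // n x _.
- apply: cvg_integral_nondecreasing cvg_neg => [n|n x|x m n mn].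
  + exact: measurable_funeneg.
  + exact: funeneg_ge0.
  + rewrite !funenegE ge_max !le_max leeN2 half_log_nonincreasing// lexx orbT; by [].
Unshelve. all: by end_near. Qed.

Lemma boolean_entropy_le_log_energy n : (boolean_entropy mu <= (log_energy mu n)%:E)%E.
Proof.
have ecvg := cvg_log_energy; rewrite -(cvg_lim _ ecvg)//; apply: lime_le.
  by apply/cvg_ex; exists (boolean_entropy mu).
exists n => // m nm; rewrite -!integral_EFin; try exact: half_log_integrable.
by apply: le_integralT => x; exact: half_log_nonincreasing.
Qed.

Lemma riemann_resolvent_integrable n :
  mu.-integrable setT (EFin \o (fun x : R => riemann n (fun t => (x ^+ 2 + t)^-1))).
Proof.
apply: (@integrable_riemann R mu (fun t x => (x ^+ 2 + t)^-1)) => t.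
exact: resolvent_integrable.
Qed.

(** [log_sum_lower] at [u = x^2], halved; at [x = 0] the integrand is [-oo]. Together with
    [stieltjes_le_log_energy] it brackets the entropy by sums of transforms, so that entropies of
    different laws are compared through their transforms, up to the mesh times a second moment. *)
Lemma boolean_entropy_le_stieltjes n :
  (boolean_entropy mu <= (2^-1 * (ln (2 ^+ n) + mesh R n * (\int[mu]_x (x ^+ 2))%R
     - riemann n (stieltjes mu)))%:E)%E.
Proof.
pose S x := riemann n (fun t => (x ^+ 2 + t)^-1).
pose f x := 2^-1 * (ln (2 ^+ n) + (mesh R n * x ^+ 2 + (- 1) * S x)).
have Si : mu.-integrable setT (EFin \o S) by exact: riemann_resolvent_integrable.
have mSi := integrableZ_EFin (- 1) Si; have mqi := integrableZ_EFin (mesh R n) mu_sq.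
have li := integrable_cst mu (ln (2 ^+ n)).
have sumi := integrableD_EFin mqi mSi; have fi := integrableD_EFin li sumi.
have -> : 2^-1 * (ln (2 ^+ n) + mesh R n * (\int[mu]_x (x ^+ 2))%R
    - riemann n (stieltjes mu)) = (\int[mu]_x f x)%R.
  rewrite RintegralZl// RintegralD// Rintegral_cstT RintegralD// !RintegralZl//.
  rewrite (@Rintegral_riemann R mu (fun t x => (x ^+ 2 + t)^-1)).
    by rewrite -/(stieltjes mu) mulN1r addrA.
  by move=> t; exact: resolvent_integrable.
rewrite -integral_EFin; last exact: integrableZ_EFin.
apply: le_integralT => x; have [->|x0] := eqVneq x 0.
  by rewrite normr0 /= lexx leNye.
have nx0 : 0 < `|x| by rewrite normr_gt0.
rewrite lne_EFin// lee_fin /f.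
rewrite ln_normE//.
rewrite ler_pM2l//; have := @log_sum_lower R n (x ^+ 2).
rewrite exprn_even_gt0//= => /(_ x0); rewrite -/(S x); lra.
Qed.

Lemma stieltjes_le_log_energy n :
  2^-1 * (ln (2 ^+ n) - riemann n (stieltjes mu)) <= log_energy mu n.
Proof.
pose S x := riemann n (fun t => (x ^+ 2 + t)^-1).
have Si : mu.-integrable setT (EFin \o S) by exact: riemann_resolvent_integrable.
have mSi := integrableZ_EFin (- 1) Si.
have li := integrable_cst mu (ln (2 ^+ n)).
have sumi := integrableD_EFin li mSi.
have -> : 2^-1 * (ln (2 ^+ n) - riemann n (stieltjes mu)) =
    (\int[mu]_x (2^-1 * (ln (2 ^+ n) + (- 1) * S x)))%R.
  rewrite RintegralZl// RintegralD// Rintegral_cstT RintegralZl//.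
  rewrite (@Rintegral_riemann R mu (fun t x => (x ^+ 2 + t)^-1)) ?mulN1r//.
  by move=> t; exact: resolvent_integrable.
apply: le_Rintegral => //; [exact: integrableZ_EFin|exact: half_log_integrable|].
move=> x _; rewrite ler_pM2l// mulN1r; apply: log_sum_upper; exact: sqr_ge0.
Qed.

End Entropy.

(** * Semicontinuity *)

Lemma cvg_riemann (R : realType) (T : Type) (A : set_system T) {FA : Filter A}
    (F_ : T -> R -> R) (F : R -> R) n :
  (forall t, 0 < t -> F_ k t @[k --> A] --> F t) ->
  riemann n (F_ k) @[k --> A] --> riemann n F.
Proof.
move=> cF; rewrite /riemann; elim: (4 ^ n)%N => [|N IH].
  under eq_fun do rewrite big_ord0; rewrite big_ord0; exact: cvg_cst.
under eq_fun do rewrite big_ord_recr; rewrite big_ord_recr /=.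
by apply: cvgD => //; apply: cvgMr; apply: cF; exact: node_gt0.
Qed.

Lemma cvg_sqr (R : realType) (T : Type) (A : set_system T) {FA : Filter A}
    (f : T -> R) (l : R) : f k @[k --> A] --> l -> f k ^+ 2 @[k --> A] --> l ^+ 2.
Proof. by move=> fl; under eq_fun do rewrite expr2; rewrite expr2; exact: cvgM. Qed.

Lemma le_limn_esup (R : realType) (u v : nat -> \bar R) :
  (forall k, (u k <= v k)%E) -> (limn_esup u <= limn_esup v)%E.
Proof.
move=> uv; apply: le_ereal_inf_tmp => _ [V FV <-].
apply: (@le_trans _ _ (ereal_sup [set u x | x in V])).
  by apply: ereal_inf_lbound; exists V.
apply: ge_ereal_sup => _ [k Vk <-]; apply: le_trans (uv k) _.
by apply: ereal_sup_ubound; exists k.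
Qed.

Lemma le_limn_einf (R : realType) (u v : nat -> \bar R) :
  (forall k, (u k <= v k)%E) -> (limn_einf u <= limn_einf v)%E.
Proof.
move=> uv; have := @le_limn_esup R (-%E \o v) (-%E \o u).
by rewrite !limn_esupN leeN2; apply => k /=; rewrite leeN2.
Qed.

Section SequentialSemicontinuity.
Variables (R : realType) (mu_ : nat -> probability R R) (mu : probability R R).
Implicit Types (n k : nat).

Hypothesis g_cvg : forall t, 0 < t ->
  stieltjes (mu_ k) t @[k --> \oo] --> stieltjes mu t.

(** At a fixed level the Riemann sums converge in [k] and stay below the Fisher informations; the
    level tends to infinity afterwards. *)
Lemma boolean_fisher_seq_lsc :
  (boolean_fisher mu <= limn_einf (fun k => boolean_fisher (mu_ k)))%E.
Proof.
have fcvg := @cvg_boolean_fisher R mu.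
rewrite -(cvg_lim _ fcvg)//; apply: lime_le; first by apply/cvg_ex; exists (boolean_fisher mu).
near=> n.
have gcvg : (riemann n (fun t => stieltjes (mu_ k) t ^+ 2))%:E @[k --> \oo] -->
    (riemann n (fun t => stieltjes mu t ^+ 2))%:E.
  apply: cvg_EFin; first by near=> k.
  by apply: cvg_riemann => t t0; apply: cvg_sqr; exact: g_cvg.
have [<- _] := cvg_limn_einf_sup gcvg.
by apply: le_limn_einf => k; exact: riemann_le_boolean_fisher.
Unshelve. all: by end_near. Qed.

Hypothesis mu_sq_ : forall k, (mu_ k).-integrable setT (EFin \o (fun x : R => x ^+ 2)).
Hypothesis mu_sq : mu.-integrable setT (EFin \o (fun x : R => x ^+ 2)).
Hypothesis m2_cvg :
  (\int[mu_ k]_x (x ^+ 2))%R @[k --> \oo] --> (\int[mu]_x (x ^+ 2))%R.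

Lemma boolean_entropy_seq_usc :
  (limn_esup (fun k => boolean_entropy (mu_ k)) <= boolean_entropy mu)%E.
Proof.
set m2 := (\int[mu]_x (x ^+ 2))%R.
(* The added term is the gap between the two brackets of the entropy; it vanishes as the level
   grows. *)
have ecvg : (log_energy mu n)%:E + (2^-1 * (mesh R n * m2))%:E @[n --> \oo] -->
    (boolean_entropy mu + 0%:E)%E.
  apply: cvgeD; first exact: fin_num_adde_defl.
    exact: cvg_log_energy.
  apply: cvg_EFin; first by near=> n.
  rewrite [X in _ --> X](_ : 0 = 2^-1 * (0 * m2)); last by rewrite mul0r mulr0.
  by apply: cvgMr; apply: cvgMl; exact: cvg_mesh.
rewrite -[leRHS]adde0 -(cvg_lim _ ecvg)//; apply: lime_ge.
  by apply/cvg_ex; eexists; exact: ecvg.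
near=> n.
have bcvg : (2^-1 * (ln (2 ^+ n) + mesh R n * (\int[mu_ k]_x (x ^+ 2))%R
     - riemann n (stieltjes (mu_ k))))%:E @[k --> \oo] -->
    (2^-1 * (ln (2 ^+ n) + mesh R n * m2 - riemann n (stieltjes mu)))%:E.
  apply: cvg_EFin; first by near=> k.
  apply: cvgMr; apply: cvgB; last exact: cvg_riemann.
  by apply: cvgD; [exact: cvg_cst|apply: cvgMr].
apply: (@le_trans _ _ (2^-1 * (ln (2 ^+ n) + mesh R n * m2 - riemann n (stieltjes mu)))%:E).
  have [_ <-] := cvg_limn_einf_sup bcvg.
  by apply: le_limn_esup => k; exact: boolean_entropy_le_stieltjes.
by rewrite -EFinD lee_fin; have := stieltjes_le_log_energy mu_sq n; lra.
Unshelve. all: by end_near. Qed.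

End SequentialSemicontinuity.

Section WeakTopology.
Variable R : realType.

Lemma compactly_supported_integrable (mu : probability R R) (f : R -> R) :
  compactly_supported mu -> continuous f -> mu.-integrable setT (EFin \o f).
Proof.
move=> [K [cK mK K0]] cf; have mf := continuous_measurable_fun cf.
apply/(negligible_integrable (measurableC mK) measurableT _ K0).
  exact/measurable_EFinP.
rewrite setDE setCK setTI; apply: measurable_bounded_integrable => //.
- by rewrite ltey_eq fin_num_measure.
- exact: measurable_funS mf.
- have : compact (f @` K).
    by apply: continuous_compact => //; apply: continuous_subspaceT.
  move/compact_bounded => [M [Mr MP]]; exists M; split => // y My x Kx.
  by apply: MP My _ _; exists x.
Qed.

(** The supremum topology is finer than each of the initial topologies that generate it. *)
Lemma test_integral_continuous (f : {f : R -> R | continuous f}) :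
  continuous (@test_integral R f).
Proof.
move=> mu; pose Tc (f : {f : R -> R | continuous f}) :=
  Topological.class (initial_topology (@test_integral R f)).
have nbhs_sup := @cvg_sup (csProb R) _ Tc (nbhs mu) mu (nbhs_filter mu).
have nbhs_mu := nbhs_sup.1 (@cvg_id _ (nbhs mu)) f.
exact: (cvg_trans (cvg_app (@test_integral R f) nbhs_mu)
  (@initial_continuous _ _ (@test_integral R f) mu)).
Qed.

Lemma stieltjes_continuous t : 0 < t ->
  continuous (fun mu : csProb R => stieltjes (sval mu) t).
Proof.
move=> t0.
exact: (@test_integral_continuous (exist _ _ (@continuous_resolvent R t t0))).
Qed.

Lemma log_energy_continuous n :
  continuous (fun mu : csProb R => log_energy (sval mu) n).
Proof.
exact: (@test_integral_continuous (exist _ _ (@continuous_half_log R _ (mesh_gt0 R n)))).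
Qed.

(** If the entropy is below [a], some regularised entropy already is. That functional is continuous
    and bounds the entropy from above, so its strict sublevel set is the required neighbourhood. *)
Lemma boolean_entropy_usc :
  upper_semicontinuous (fun mu : csProb R => boolean_entropy (sval mu)).
Proof.
move=> mu a Gmu.
have sq_int (nu : csProb R) : (sval nu).-integrable setT (EFin \o (fun x : R => x ^+ 2)).
  apply: compactly_supported_integrable; first exact: (svalP nu).
  exact: exprn_continuous.
have [n En] : exists n, log_energy (sval mu) n < a.
  apply: contrapT => /forallNP En; have ecvg := cvg_log_energy (sq_int mu).
  suff : (a%:E <= boolean_entropy (sval mu))%E by rewrite leNgt Gmu.
  rewrite -(cvg_lim _ ecvg)//; apply: lime_ge; first by apply/cvg_ex; eexists; exact: ecvg.
  by near=> n; rewrite lee_fin leNgt; exact/negP/En.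
exists [set nu : csProb R | log_energy (sval nu) n < a].
  exact: (cvgr_lt _ (@log_energy_continuous n mu) _ En).
move=> nu /=; rewrite -lte_fin; apply: le_lt_trans.
exact: boolean_entropy_le_log_energy.
Unshelve. all: by end_near. Qed.

Lemma boolean_fisher_lsc :
  lower_semicontinuous (fun mu : csProb R => boolean_fisher (sval mu)).
Proof.
move=> mu a Pmu.
have [n Rn] : exists n, a < riemann n (fun t => stieltjes (sval mu) t ^+ 2).
  apply: contrapT => /forallNP Rn; have fcvg := @cvg_boolean_fisher R (sval mu).
  suff : (boolean_fisher (sval mu) <= a%:E)%E by rewrite leNgt Pmu.
  rewrite -(cvg_lim _ fcvg)//; apply: lime_le; first by apply/cvg_ex; eexists; exact: fcvg.
  by near=> n; rewrite lee_fin leNgt; exact/negP/Rn.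
exists [set nu : csProb R | a < riemann n (fun t => stieltjes (sval nu) t ^+ 2)].
  have : riemann n (fun t => stieltjes (sval nu) t ^+ 2) @[nu --> mu] -->
      riemann n (fun t => stieltjes (sval mu) t ^+ 2).
    have fmu := nbhs_filter mu.
    apply: (@cvg_riemann _ _ _ fmu) => t t0; apply: (@cvg_sqr _ _ _ fmu).
    exact: stieltjes_continuous.
  by move/cvgr_gt; apply.
move=> nu /=; rewrite -lte_fin => /lt_le_trans; apply.
exact: riemann_le_boolean_fisher.
Unshelve. all: by end_near. Qed.

Lemma boolean_fisher_symmetric_lsc :
  lower_semicontinuous (fun mu : set_type (@symmetric_csProb R) =>
    boolean_fisher (sval (set_val mu))).
Proof.
move=> mu a /boolean_fisher_lsc[V nV aV].
exists (set_val @^-1` V); last by move=> nu /aV.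
exact: (@initial_continuous _ _ set_val mu V nV).
Qed.

End WeakTopology.

(** * Bounded operators and states *)

(** The discriminant argument shared by the Cauchy-Schwarz inequalities of the inner product and of
    the state. The leading coefficient may vanish, since a state need not be faithful. *)
Lemma sqr_le_of_quadratic_ge0 (R : realFieldType) (a b c : R) : 0 <= c ->
  (forall x, 0 <= a + 2 * x * b + x ^+ 2 * c) -> b ^+ 2 <= a * c.
Proof.
rewrite le_eqVlt => /predU1P[<-|c0] q0.
  rewrite mulr0; have [->|b0] := eqVneq b 0; first by rewrite expr0n.
  (* For [c = 0] the polynomial is affine, and this is the point where it equals [-1]. *)
  have := q0 (- (a + 1) / (2 * b)).
  have -> : a + 2 * (- (a + 1) / (2 * b)) * b + (- (a + 1) / (2 * b)) ^+ 2 * 0 = -1.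
    by field.
  by rewrite ler0N1.
(* The minimiser of the parabola. *)
have := q0 (- b / c).
have -> : a + 2 * (- b / c) * b + (- b / c) ^+ 2 * c = (a * c - b ^+ 2) / c.
  by field; rewrite gt_eqF.
by rewrite pmulr_lge0 ?invr_gt0// subr_ge0.
Qed.

Section RealInnerProduct.
Variables (R : realType) (H : hilbertSpace R).
Local Notation rc := (real_complex R).
Implicit Types (u v w : H) (z : R[i]) (r : R).

Definition rdot u v : R := complex.Re (hdot H u v).

Lemma ReD z z' : complex.Re (z + z') = complex.Re z + complex.Re z'.
Proof. by case: z z' => [? ?] [? ?]. Qed.

Lemma ReN z : complex.Re (- z) = - complex.Re z.
Proof. by case: z. Qed.

Lemma ReMl r z : complex.Re (rc r * z) = r * complex.Re z.
Proof. by case: z => a b /=; rewrite mul0r subr0. Qed.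

Lemma Re_conjC z : complex.Re (Num.Def.conjC z) = complex.Re z.
Proof. by case: z. Qed.

Lemma Im_conjC z : complex.Im (Num.Def.conjC z) = - complex.Im z.
Proof. by case: z. Qed.

Lemma hdotDl u v w : hdot H (u + v) w = hdot H u w + hdot H v w.
Proof. by rewrite linearDl. Qed.

Lemma hdotDr u v w : hdot H u (v + w) = hdot H u v + hdot H u w.
Proof. by rewrite linearDr. Qed.

Lemma hdotZl z u v : hdot H (z *: u) v = z * hdot H u v.
Proof. by rewrite linearZl_LR. Qed.

Lemma hdotZr z u v : hdot H u (z *: v) = Num.Def.conjC z * hdot H u v.
Proof. by rewrite linearZr_LR. Qed.

Lemma rdotDl u v w : rdot (u + v) w = rdot u w + rdot v w.
Proof. by rewrite /rdot linearDl ReD. Qed.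

Lemma rdotZl r u v : rdot (rc r *: u) v = r * rdot u v.
Proof. by rewrite /rdot linearZl_LR ReMl. Qed.

Lemma hdotC u v : hdot H u v = Num.Def.conjC (hdot H v u).
Proof. by rewrite hermC expr0 mul1r. Qed.

Lemma rdotC u v : rdot u v = rdot v u.
Proof. by rewrite /rdot hdotC Re_conjC. Qed.

Lemma rdotDr u v w : rdot u (v + w) = rdot u v + rdot u w.
Proof. by rewrite !(rdotC u) rdotDl. Qed.

Lemma rdotZr r u v : rdot u (rc r *: v) = r * rdot u v.
Proof. by rewrite !(rdotC u) rdotZl. Qed.

Lemma rdotNl u v : rdot (- u) v = - rdot u v.
Proof. by rewrite /rdot linearNl ReN. Qed.

Lemma rdotNr u v : rdot u (- v) = - rdot u v.
Proof. by rewrite rdotC rdotNl rdotC. Qed.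

Lemma rdotBl u v w : rdot (u - v) w = rdot u w - rdot v w.
Proof. by rewrite rdotDl rdotNl. Qed.

Lemma rdot0l u : rdot 0 u = 0.
Proof. by rewrite /rdot linear0l. Qed.

Lemma rdot_gt0 u : u != 0 -> 0 < rdot u u.
Proof.
by move=> u0; have := @neq0_dnorm_gt0 _ _ _ (hdot H) u u0; rewrite ltcE => /andP[].
Qed.

Lemma rdot_ge0 u : 0 <= rdot u u.
Proof. by have [->|/rdot_gt0/ltW//] := eqVneq u 0; rewrite rdot0l. Qed.

Lemma hnorm_ge0 u : 0 <= hnorm u.
Proof. exact: sqrtr_ge0. Qed.

Lemma hnorm_sqr u : hnorm u ^+ 2 = rdot u u.
Proof. by rewrite sqr_sqrtr// rdot_ge0. Qed.

Lemma hnorm0 : hnorm (0 : H) = 0.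
Proof. by apply/eqP; rewrite -(sqrf_eq0 (hnorm _)) hnorm_sqr rdot0l. Qed.

Lemma hnorm0_eq0 u : hnorm u = 0 -> u = 0.
Proof.
move=> u0; apply/eqP/negPn/negP => /rdot_gt0.
by rewrite -hnorm_sqr u0 expr0n ltxx.
Qed.

Lemma rdot_cauchy_schwarz u v : `|rdot u v| <= hnorm u * hnorm v.
Proof.
rewrite -(@ler_pXn2r _ 2)// ?nnegrE ?mulr_ge0 ?hnorm_ge0//.
rewrite exprMn !hnorm_sqr real_normK ?num_real//.
apply: sqr_le_of_quadratic_ge0 => [|x]; first exact: rdot_ge0.
have := rdot_ge0 (u + rc x *: v).
by rewrite rdotDl !rdotDr !rdotZl !rdotZr (rdotC v u); lra.
Qed.

Lemma hnormD u v : hnorm (u + v) <= hnorm u + hnorm v.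
Proof.
rewrite -(@ler_pXn2r _ 2)// ?nnegrE ?addr_ge0 ?hnorm_ge0//.
rewrite hnorm_sqr sqrrD !hnorm_sqr rdotDl !rdotDr (rdotC v u).
have := rdot_cauchy_schwarz u v; have := ler_norm (rdot u v); lra.
Qed.

Lemma hnormZ r u : hnorm (rc r *: u) = `|r| * hnorm u.
Proof.
apply/eqP; rewrite -(@eqrXn2 _ 2)// ?mulr_ge0 ?hnorm_ge0//.
by rewrite exprMn !hnorm_sqr rdotZl rdotZr real_normK ?num_real// mulrA expr2.
Qed.

Lemma hnormN u : hnorm (- u) = hnorm u.
Proof.
apply/eqP; rewrite -(@eqrXn2 _ 2)// ?hnorm_ge0//.
by rewrite !hnorm_sqr rdotNl rdotNr opprK.
Qed.

Lemma hnormB u v : hnorm (u - v) = hnorm (v - u).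
Proof. by rewrite -opprB hnormN. Qed.

(** The carrier of a [hilbertSpace] is a bare module, so convergence of vectors is phrased with the
    norm. *)
Definition hlim (s : nat -> H) (l : H) := hnorm (s n - l) @[n --> \oo] --> 0.

Lemma hlim_unique s l l' : hlim s l -> hlim s l' -> l = l'.
Proof.
move=> sl sl'; apply/subr0_eq/hnorm0_eq0/eqP; rewrite eq_le hnorm_ge0 andbT.
have : hnorm (s n - l) + hnorm (s n - l') @[n --> \oo] --> 0.
  by rewrite -[X in _ --> X]addr0; exact: cvgD.
move=> s0; rewrite -(cvg_lim _ s0)//; apply: limr_ge; first by apply/cvg_ex; eexists; exact: s0.
near=> n; have -> : l - l' = (l - s n) + (s n - l') by rewrite addrA subrK.
by rewrite (hnormB (s n) l); exact: hnormD.
Unshelve. all: by end_near. Qed.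

Lemma hlim_le s t l m (c : R) : hlim s l ->
  (forall n, hnorm (t n - m) <= c * hnorm (s n - l)) -> hlim t m.
Proof.
move=> sl ts; have cs : c * hnorm (s n - l) @[n --> \oo] --> 0.
  by rewrite -[X in _ --> X](mulr0 c); exact: cvgMr.
apply: (squeeze_cvgr _ (cvg_cst 0) cs).
by near=> n; rewrite hnorm_ge0 ts.
Unshelve. all: by end_near. Qed.

Lemma hlimD s t l m : hlim s l -> hlim t m -> hlim (fun n => s n + t n) (l + m).
Proof.
move=> sl tm; have st : hnorm (s n - l) + hnorm (t n - m) @[n --> \oo] --> 0.
  by rewrite -[X in _ --> X]addr0; exact: cvgD.
apply: (squeeze_cvgr _ (cvg_cst 0) st).
by near=> n; rewrite hnorm_ge0 opprD addrACA hnormD.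
Unshelve. all: by end_near. Qed.

Lemma cvg_rdotl s l v : hlim s l -> rdot (s n) v @[n --> \oo] --> rdot l v.
Proof.
move=> sl; have c0 : hnorm (s n - l) * hnorm v @[n --> \oo] --> 0.
  by rewrite -[X in _ --> X](mul0r (hnorm v)); exact: cvgMl.
have lo : rdot l v - hnorm (s n - l) * hnorm v @[n --> \oo] --> rdot l v.
  by rewrite -[X in _ --> X]subr0; apply: cvgB => //; exact: cvg_cst.
have hi : rdot l v + hnorm (s n - l) * hnorm v @[n --> \oo] --> rdot l v.
  by rewrite -[X in _ --> X]addr0; apply: cvgD => //; exact: cvg_cst.
apply: (squeeze_cvgr _ lo hi); near=> n.
by rewrite -ler_distl -rdotBl rdot_cauchy_schwarz.
Unshelve. all: by end_near.
Qed.

End RealInnerProduct.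

Section VonNeumannAlgebra.
Variables (R : realType) (P : ncProbSpace R).
Local Notation rc := (real_complex R).
Local Notation M := (nc_alg P).
Local Notation tau := (nc_tau P).
Implicit Types (A B C T : P -> P) (r : R) (n k : nat).

Lemma nc_bicommutant : commutant (commutant M) = M.
Proof. by case: (nc_von_neumann P). Qed.

Lemma nc_bounded A : M A -> bounded_op A.
Proof. by rewrite -nc_bicommutant => -[]. Qed.

Lemma nc_linear A : M A -> linear A.
Proof. by move=> /nc_bounded[]. Qed.

Lemma linop0 A : linear A -> A 0 = 0.
Proof. by move=> lA; have := lA (-1) 0 0; rewrite scaler0 addr0 scaleN1r addNr. Qed.

Lemma linopD A u v : linear A -> A (u + v) = A u + A v.
Proof. by move=> lA; have := lA 1 u v; rewrite !scale1r. Qed.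

Lemma linopZ A a u : linear A -> A (a *: u) = a *: A u.
Proof. by move=> lA; have := lA a u 0; rewrite (linop0 lA) !addr0. Qed.

Lemma linopB A u v : linear A -> A (u - v) = A u - A v.
Proof. by move=> lA; rewrite linopD// -scaleN1r linopZ// scaleN1r. Qed.

Lemma bounded_op_comp A B : bounded_op A -> bounded_op B -> bounded_op (A \o B).
Proof.
move=> [lA [a Aa]] [lB [b Bb]]; split=> [c u v|]; first by rewrite /= lB lA.
exists (`|a| * `|b|) => u; apply: (@le_trans _ _ (`|a| * hnorm (B u))).
  by apply: le_trans (Aa _) _; rewrite ler_wpM2r ?hnorm_ge0 ?ler_norm.
rewrite -mulrA ler_wpM2l//; apply: le_trans (Bb _) _.
by rewrite ler_wpM2r ?hnorm_ge0 ?ler_norm.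
Qed.

Lemma bounded_op_scale a A : bounded_op A -> exists c, forall u, hnorm (a *: A u) <= c * hnorm u.
Proof.
move=> [_ [b Ab]].
have nZ (u : P) : hnorm (a *: u) = Num.sqrt (complex.Re a ^+ 2 + complex.Im a ^+ 2) * hnorm u.
  apply/eqP; rewrite -(@eqrXn2 _ 2)// ?mulr_ge0 ?hnorm_ge0 ?sqrtr_ge0//.
  rewrite exprMn !hnorm_sqr sqr_sqrtr ?addr_ge0 ?sqr_ge0//.
  rewrite /rdot hdotZl hdotZr.
  case: a => x y /=; case: (hdot _ u u) => p q /=; apply/eqP; ring.
exists (Num.sqrt (complex.Re a ^+ 2 + complex.Im a ^+ 2) * b) => u.
by rewrite nZ -mulrA ler_wpM2l// sqrtr_ge0.
Qed.

Lemma bounded_op_lin a A B : bounded_op A -> bounded_op B -> bounded_op (a *: A + B).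
Proof.
move=> bA bB; split=> [c u v|].
  have [lA _] := bA; have [lB _] := bB.
  by rewrite !fctE lA lB scalerDr !scalerA mulrC -!scalerA addrACA -scalerDr.
have [c Ac] := bounded_op_scale a bA; have [_ [b Bb]] := bB.
exists (c + b) => u; rewrite mulrDl; apply: le_trans (hnormD _ _) _.
by rewrite lerD// Ac.
Qed.

Lemma bounded_op_id : bounded_op (id : P -> P).
Proof. by split=> //; exists 1 => u; rewrite mul1r. Qed.

(** The entry point to the algebra: products, linear combinations and the limit of the Neumann
    series are all recognised as members because they commute with the commutant. *)
Lemma nc_mem A : bounded_op A -> (forall C, commutant M C -> A \o C = C \o A) -> M A.
Proof. by move=> bA cA; rewrite -nc_bicommutant; split. Qed.

Lemma nc_commute A C : M A -> commutant M C -> A \o C = C \o A.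
Proof. by rewrite -{1}nc_bicommutant => -[_ cA] /cA. Qed.

Lemma nc_id : M id.
Proof. by apply: nc_mem; first exact: bounded_op_id. Qed.

Lemma nc_comp A B : M A -> M B -> M (A \o B).
Proof.
move=> MA MB; apply: nc_mem => [|C cC]; first by apply: bounded_op_comp; exact: nc_bounded.
by rewrite -compA (nc_commute MB cC) compA (nc_commute MA cC).
Qed.

Lemma nc_lin a A B : M A -> M B -> M (a *: A + B).
Proof.
move=> MA MB; apply: nc_mem => [|C cC]; first by apply: bounded_op_lin; exact: nc_bounded.
have [[lC _] _] := cC; apply/funext => u /=; rewrite !fctE lC.
by have /(congr1 (@^~ u))/= -> := nc_commute MA cC; have /(congr1 (@^~ u))/= -> := nc_commute MB cC.
Qed.

Lemma nc_zero : M 0.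
Proof. by rewrite -(addNr (id : P -> P)) -scaleN1r; apply: nc_lin; exact: nc_id. Qed.

Lemma nc_add A B : M A -> M B -> M (A + B).
Proof. by move=> MA MB; rewrite -[A]scale1r; exact: nc_lin. Qed.

Lemma nc_scale a A : M A -> M (a *: A).
Proof. by move=> MA; rewrite -[_ *: _]addr0; apply: nc_lin => //; exact: nc_zero. Qed.

Lemma nc_sub A B : M A -> M B -> M (A - B).
Proof. by move=> MA MB; rewrite -scaleN1r addrC; exact: nc_lin. Qed.

Lemma nc_iter k A : M A -> M (iter k A).
Proof.
move=> MA; elim: k => [|k IH]; first exact: nc_id.
by rewrite [iter _ _](_ : _ = A \o iter k A)//; exact: nc_comp.
Qed.

Lemma nc_sum I (s : seq I) (F : I -> P -> P) :
  (forall i, M (F i)) -> M (\sum_(i <- s) F i).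
Proof.
move=> MF; elim: s => [|i s IH]; first by rewrite big_nil; exact: nc_zero.
by rewrite big_cons; exact: nc_add.
Qed.

Definition retau A : R := complex.Re (tau A).

Lemma tau_lin a A B : M A -> M B -> tau (a *: A + B) = a * tau A + tau B.
Proof. by case: (nc_state P) => + _ _; apply. Qed.

Lemma tau_id : tau id = 1.
Proof. by case: (nc_state P). Qed.

Lemma tau_adj_ge0 A A' : M A -> M A' -> is_adjoint A A' -> 0 <= tau (A' \o A).
Proof. by case: (nc_state P) => _ + _; apply. Qed.

Lemma tau_zero : tau 0 = 0.
Proof.
have := tau_lin (-1) nc_id nc_id; rewrite scaleN1r addNr mulN1r => ->.
by rewrite addNr.
Qed.

Lemma tau_add A B : M A -> M B -> tau (A + B) = tau A + tau B.
Proof. by move=> MA MB; have := tau_lin 1 MA MB; rewrite scale1r mul1r. Qed.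

Lemma tau_scale a A : M A -> tau (a *: A) = a * tau A.
Proof. by move=> MA; have := tau_lin a MA nc_zero; rewrite !addr0 tau_zero addr0. Qed.

Lemma retau_id : retau id = 1.
Proof. by rewrite /retau tau_id. Qed.

Lemma retau_add A B : M A -> M B -> retau (A + B) = retau A + retau B.
Proof. by move=> MA MB; rewrite /retau tau_add// ReD. Qed.

Lemma retau_scale r A : M A -> retau (rc r *: A) = r * retau A.
Proof. by move=> MA; rewrite /retau tau_scale// ReMl. Qed.

Lemma retau_sub A B : M A -> M B -> retau (A - B) = retau A - retau B.
Proof.
move=> MA MB; have -> : A - B = A + rc (-1) *: B.
  by rewrite [rc (-1)]rmorphN1 scaleN1r.
rewrite retau_add ?retau_scale//; last exact: nc_scale.
by rewrite mulN1r.
Qed.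

Lemma retau_sum I (s : seq I) (F : I -> P -> P) : (forall i, M (F i)) ->
  retau (\sum_(i <- s) F i) = \sum_(i <- s) retau (F i).
Proof.
move=> MF; elim: s => [|i s IH]; first by rewrite !big_nil /retau tau_zero.
by rewrite !big_cons retau_add ?IH//; exact: nc_sum.
Qed.

Lemma retau_adj_ge0 A A' : M A -> M A' -> is_adjoint A A' -> 0 <= retau (A' \o A).
Proof. by move=> MA MA' AA'; have := tau_adj_ge0 MA MA' AA'; rewrite lecE => /andP[]. Qed.

Lemma adjoint_sym A A' : is_adjoint A A' -> is_adjoint A' A.
Proof. by move=> AA' u v; rewrite hdotC -AA' -hdotC. Qed.

Lemma adjoint_comp A A' B B' :
  is_adjoint A A' -> is_adjoint B B' -> is_adjoint (A \o B) (B' \o A').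
Proof. by move=> AA' BB' u v /=; rewrite AA' BB'. Qed.

Lemma adjoint_lin a A A' B B' : is_adjoint A A' -> is_adjoint B B' ->
  is_adjoint (a *: A + B) (Num.Def.conjC a *: A' + B').
Proof.
move=> AA' BB' u v; have -> : (a *: A + B) u = a *: A u + B u by [].
have -> : (Num.Def.conjC a *: A' + B') v = Num.Def.conjC a *: A' v + B' v by [].
by rewrite hdotDl hdotZl AA' BB' hdotDr hdotZr conjCK.
Qed.

Lemma adjoint_rlin r A A' B B' : is_adjoint A A' -> is_adjoint B B' ->
  is_adjoint (rc r *: A + B) (rc r *: A' + B').
Proof.
move=> AA' BB'; have := adjoint_lin (rc r) AA' BB'.
suff -> : Num.Def.conjC (rc r) = rc r by [].
by apply/eqP; rewrite eq_complex Re_conjC Im_conjC /= oppr0 !eqxx.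
Qed.

Lemma selfadjoint_id : selfadjoint (id : P -> P).
Proof. by []. Qed.

(** Positivity at [i A + 1] makes [tau (A' A) + i tau A - i tau A' + 1] real; its imaginary part is
    the difference of the two real parts. *)
Lemma retau_adjoint A A' : M A -> M A' -> is_adjoint A A' -> retau A' = retau A.
Proof.
move=> MA MA' AA'; have [lA' _] := nc_bounded MA'.
have adj := adjoint_lin 'i%C AA' selfadjoint_id.
have := tau_adj_ge0 (nc_lin 'i%C MA nc_id) (nc_lin _ MA' nc_id) adj.
have -> : (Num.Def.conjC 'i%C *: A' + id) \o ('i%C *: A + id) =
    A' \o A + (('i%C *: A + Num.Def.conjC 'i%C *: A') + id).
  apply/funext => u; rewrite /= !fctE /= (linopD _ _ lA') (linopZ _ _ lA') scalerDr scalerA.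
  have -> : Num.Def.conjC 'i%C * 'i%C = 1 :> R[i] by simpc.
  by rewrite scale1r -!addrA; congr (_ + _); rewrite addrCA.
have MAA := nc_comp MA' MA; have MiA := nc_scale 'i%C MA.
have MiA' := nc_scale (Num.Def.conjC 'i%C) MA'.
rewrite !tau_add ?tau_scale ?tau_id//; try by do ?[apply: nc_add|exact: nc_id].
have := tau_adj_ge0 MA MA' AA'; rewrite !lecE /retau.
case: (tau (A' \o A)) => p q; case: (tau A) => a b; case: (tau A') => c d /=.
move=> /andP[/eqP-> _] /andP[/eqP + _]; lra.
Qed.

Lemma retau_cauchy_schwarz A A' B B' : M A -> M A' -> M B -> M B' ->
  is_adjoint A A' -> is_adjoint B B' ->
  retau (A' \o B) ^+ 2 <= retau (A' \o A) * retau (B' \o B).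
Proof.
move=> MA MA' MB MB' AA' BB'.
have [lA' _] := nc_bounded MA'; have [lB' _] := nc_bounded MB'.
have sym : retau (B' \o A) = retau (A' \o B).
  apply: retau_adjoint; [exact: nc_comp|exact: nc_comp|].
  exact: adjoint_comp (adjoint_sym AA') BB'.
apply: sqr_le_of_quadratic_ge0 => [|x]; first exact: retau_adj_ge0.
have := retau_adj_ge0 (nc_lin (rc x) MB MA) (nc_lin _ MB' MA') (adjoint_rlin x BB' AA').
have -> : (rc x *: B' + A') \o (rc x *: B + A) =
    A' \o A + (rc x *: ((A' \o B) + (B' \o A)) + rc x *: (rc x *: (B' \o B))).
  apply/funext => u /=; rewrite !fctE /= (linopD _ _ lB') (linopD _ _ lA').
  rewrite (linopZ _ _ lB') (linopZ _ _ lA') !scalerDr.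
  by rewrite [LHS](AC (2*2) (4*((3*2)*1))).
have MAA := nc_comp MA' MA; have MAB := nc_comp MA' MB.
have MBA := nc_comp MB' MA; have MBB := nc_comp MB' MB.
have MS := nc_add MAB MBA; have MxB := nc_scale (rc x) MBB.
rewrite retau_add//; last by apply: nc_add; exact: nc_scale.
rewrite retau_add ?retau_scale ?retau_add ?sym//; try exact: nc_scale.
by lra.
Qed.

End VonNeumannAlgebra.

(** * Boundedness of a normal state on self-adjoint elements *)

Section StateBound.
Variables (R : realType) (P : ncProbSpace R) (B : P -> P).
Local Notation rc := (real_complex R).
Local Notation M := (nc_alg P).
Hypotheses (MB : M B) (saB : selfadjoint B).
Hypothesis halfB : forall u, hnorm (B u) <= 2^-1 * hnorm u.
Implicit Types (u v : P) (n k m : nat).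

Let lB : linear B := nc_linear MB.

(** Only even powers of the self-adjoint [B] enter, so that the partial sums increase in the
    operator order. Their limit is the inverse of [1 - B^2]. *)
Definition neumann_sum n : P -> P := \sum_(k < n) iter (k + k)%N B.

Lemma neumann_sumE n u : neumann_sum n u = \sum_(k < n) iter (k + k)%N B u.
Proof. by rewrite /neumann_sum fct_sumE. Qed.

Lemma selfadjoint_iter k : selfadjoint (iter k B).
Proof.
elim: k => [|k IH]; first exact: selfadjoint_id.
have -> : iter k.+1 B = B \o iter k B by [].
move=> u v; rewrite (adjoint_comp saB IH u v) /=; congr (hdot _ _ _).
by rewrite -iterS iterSr.
Qed.

Lemma hnorm_iter_half k u : hnorm (iter k B u) <= 2^-1 ^+ k * hnorm u.
Proof.
elim: k => [|k IH]; first by rewrite expr0 mul1r.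
by rewrite iterS exprS -mulrA; apply: le_trans (halfB _) _; rewrite ler_pM2l.
Qed.

(** The term of index [k] has norm at most [2^-(2k)]; weakened to [2^-k], it telescopes. *)
Lemma neumann_cauchy m n u : (n <= m)%N ->
  hnorm (neumann_sum m u - neumann_sum n u) <= 2 * (2^-1 ^+ n - 2^-1 ^+ m) * hnorm u.
Proof.
elim: m => [|m IH]; first by rewrite leqn0 => /eqP->; rewrite !subrr hnorm0 mulr0 mul0r.
rewrite leq_eqVlt => /predU1P[->|]; first by rewrite !subrr hnorm0 mulr0 mul0r.
rewrite ltnS => /IH {}IH.
rewrite neumann_sumE big_ord_recr /= -neumann_sumE addrAC.
apply: le_trans (hnormD _ _) _.
have := hnorm_iter_half (m + m) u.
have : 2^-1 ^+ (m + m) * hnorm u <= 2^-1 ^+ m * hnorm u.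
  rewrite ler_wpM2r ?hnorm_ge0// exprD ler_piMr ?exprn_ge0 ?exprn_ile1//; lra.
rewrite exprS; move: IH; move: (2^-1 ^+ m) (2^-1 ^+ n) => x y; lra.
Qed.

Lemma neumann_limit u : exists l, hlim (neumann_sum^~ u) l.
Proof.
apply: hcomplete => e e0.
have [N NP] : exists N, 2 * 2^-1 ^+ N * hnorm u < e.
  have c0 : 2 * 2^-1 ^+ N * hnorm u @[N --> \oo] --> 0.
    rewrite [X in _ --> X](_ : 0 = 2 * 0 * hnorm u); last by rewrite mulr0 mul0r.
    by apply: cvgMl; apply: cvgMr; apply: cvg_expr; rewrite ger0_norm//; lra.
  by have [N _ /(_ N (leqnn N))] := cvgr_lt _ c0 _ e0; exists N.
exists N => m n; wlog nm : m n / (n <= m)%N => [H Nm Nn|Nm Nn].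
  have [/H|/ltnW/H] := leqP n m; first exact.
  by rewrite -/(hnorm _) hnormB; apply.
apply: le_lt_trans NP; apply: le_trans (neumann_cauchy _ nm) _.
rewrite ler_wpM2r ?hnorm_ge0// ler_pM2l//.
have m0 : 0 <= 2^-1 ^+ m :> R by rewrite exprn_ge0.
have : 2^-1 ^+ n <= 2^-1 ^+ N :> R by apply: ler_wiXn2l => //; lra.
by lra.
Qed.

Definition neumann u : P := sval (cid (neumann_limit u)).

Lemma neumannP u : hlim (neumann_sum^~ u) (neumann u).
Proof. by rewrite /neumann; case: cid. Qed.

Lemma nc_neumann_sum n : M (neumann_sum n).
Proof. by apply: nc_sum => k; exact: nc_iter. Qed.

Lemma neumann_linear : linear neumann.
Proof.
move=> a u v; apply: (hlim_unique (neumannP (a *: u + v))).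
have [c Ac] := bounded_op_scale a (bounded_op_id P).
have -> : neumann_sum^~ (a *: u + v) = fun n => a *: neumann_sum n u + neumann_sum n v.
  by apply/funext => n; rewrite (nc_linear (nc_neumann_sum n)).
apply: hlimD; last exact: neumannP.
apply: (hlim_le (c := c) (neumannP u)) => n.
by rewrite -scalerBr; exact: Ac.
Qed.

Lemma neumann_tail n u : hnorm (neumann u - neumann_sum n u) <= 2 * 2^-1 ^+ n * hnorm u.
Proof.
have c0 : hnorm (neumann_sum m u - neumann u) + 2 * 2^-1 ^+ n * hnorm u @[m --> \oo]
    --> 0 + 2 * 2^-1 ^+ n * hnorm u.
  by apply: cvgD; [exact: neumannP|exact: cvg_cst].
rewrite -[leRHS]add0r -(cvg_lim _ c0)//; apply: limr_ge; first by apply/cvg_ex; eexists; exact: c0.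
exists n => // m /= nm.
have -> : neumann u - neumann_sum n u =
    (neumann u - neumann_sum m u) + (neumann_sum m u - neumann_sum n u).
  by rewrite addrA subrK.
apply: le_trans (hnormD _ _) _.
rewrite hnormB lerD2l; apply: le_trans (neumann_cauchy _ nm) _.
by rewrite ler_wpM2r ?hnorm_ge0// ler_pM2l// lerBlDr lerDl exprn_ge0.
Qed.

(** An element of the commutant is bounded, so its commutation with the partial sums passes to the
    pointwise limit. *)
Lemma nc_neumann : M neumann.
Proof.
apply: nc_mem => [|C cC].
  split; first exact: neumann_linear.
  exists 2 => u; have := neumann_tail 0 u.
  by rewrite neumann_sumE big_ord0 subr0 expr0 mulr1.
have [[lC [c Cc]] _] := cC; apply/funext => u /=.
apply: (hlim_unique (neumannP (C u))).
apply: (hlim_le (c := c) (neumannP u)) => n.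
have /(congr1 (@^~ u))/= -> := nc_commute (nc_neumann_sum n) cC.
by rewrite -linopB//; exact: Cc.
Qed.

Lemma selfadjoint_neumann_sum n : selfadjoint (neumann_sum n).
Proof.
move=> u v; rewrite !neumann_sumE linear_sumlz linear_sumr /=.
by apply: eq_bigr => k _; exact: selfadjoint_iter.
Qed.

(** Testing on [i u] recovers the imaginary part of the inner product from real parts. *)
Lemma rdot_adjoint A A' : linear A -> linear A' ->
  (forall u v : P, rdot (A u) v = rdot u (A' v)) -> is_adjoint A A'.
Proof.
move=> lA lA' AA' u v; apply/eqP; rewrite eq_complex.
have re := AA' u v; have im := AA' ('i%C *: u) v.
rewrite linopZ// /rdot !hdotZl in im; rewrite /rdot in re.
rewrite re eqxx /=; apply/eqP; move: im.
by case: (hdot P (A u) v) => a b; case: (hdot P u (A' v)) => c d /=; lra.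
Qed.

Lemma selfadjoint_neumann : selfadjoint neumann.
Proof.
apply: rdot_adjoint => [||u v]; try exact: neumann_linear.
have cu := cvg_rdotl (v := v) (neumannP u); have cv := cvg_rdotl (v := u) (neumannP v).
rewrite [RHS]rdotC -(cvg_lim _ cu)// -(cvg_lim _ cv)//.
congr (lim (_ @ \oo)); apply/funext => n.
by rewrite [RHS]rdotC /rdot selfadjoint_neumann_sum.
Qed.

(** The complex order behind [le_op] also demands a vanishing imaginary part, which self-adjointness
    supplies. *)
Lemma le_opP A C : M A -> M C -> selfadjoint A -> selfadjoint C ->
  le_op A C <-> forall u : P, rdot (A u) u <= rdot (C u) u.
Proof.
move=> MA MC sA sC; split => AC u.
  by have := AC u; rewrite lecE => /andP[_]; rewrite -/(rdot _ _) /= rdotBl subr_ge0.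
have im0 A' : selfadjoint A' -> complex.Im (hdot P (A' u) u) = 0.
  move=> sA'; have := congr1 (@complex.Im R) (hdotC (A' u) u).
  by rewrite Im_conjC -sA'; lra.
rewrite lecE; have -> : (C - A) u = C u - A u by [].
apply/andP; split; last by rewrite -/(rdot _ _) rdotBl subr_ge0.
rewrite hdotDl; have -> : hdot P (- A u) u = - hdot P (A u) u by exact: linearNl.
move: (im0 _ sC) (im0 _ sA).
by case: (hdot P (C u) u) => a b; case: (hdot P (A u) u) => c d /= -> ->; rewrite subr0.
Qed.

Lemma rdot_iter_ge0 k u : 0 <= rdot (iter (k + k)%N B u) u.
Proof.
rewrite iterD /rdot selfadjoint_iter; exact: rdot_ge0.
Qed.

Lemma rdot_neumann_sum_nondecreasing u :
  {homo (fun n => rdot (neumann_sum n u) u) : m n / (m <= n)%N >-> m <= n}.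
Proof.
apply/nondecreasing_seqP => n.
by rewrite [in leRHS]neumann_sumE big_ord_recr -neumann_sumE rdotDl lerDl rdot_iter_ge0.
Qed.

(* Normality is applied to the increasing partial sums and to their translates by scalars. *)
Lemma retau_neumann_sum_bounded :
  exists C, forall n, retau (neumann_sum n) <= C.
Proof.
have shifted (a : R) : retau neumann + a =
    sup [set retau (neumann_sum n) + a | n in setT].
  pose S n := neumann_sum n + rc a *: id; pose T := neumann + rc a *: id.
  have Mid : M (rc a *: id) by apply: nc_scale; exact: nc_id.
  have MS n : M (S n) by apply: nc_add => //; exact: nc_neumann_sum.
  have MT : M T by apply: nc_add => //; exact: nc_neumann.
  have sadd (A : P -> P) : selfadjoint A -> selfadjoint (A + rc a *: id).
    by move=> sA; rewrite addrC; exact: adjoint_rlin.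
  have sS n : selfadjoint (S n) by apply: sadd; exact: selfadjoint_neumann_sum.
  have sT : selfadjoint T by apply: sadd; exact: selfadjoint_neumann.
  have SE n u : rdot (S n u) u = rdot (neumann_sum n u) u + rdot (rc a *: u) u.
    by rewrite -rdotDl.
  have le_S m n : (m <= n)%N -> le_op (S m) (S n).
    move=> mn; apply/le_opP => // u; rewrite !SE lerD2r.
    exact: rdot_neumann_sum_nondecreasing.
  have -> : retau neumann + a = complex.Re (nc_tau P T).
    rewrite -/(retau T) retau_add ?retau_scale ?retau_id ?mulr1//; try exact: nc_id.
    exact: nc_neumann.
  rewrite (nc_normal (D := range S) (A := T)).
  - have tS n : complex.Re (nc_tau P (S n)) = retau (neumann_sum n) + a.
      rewrite -/(retau (S n)) retau_add ?retau_scale ?retau_id ?mulr1//; try exact: nc_id.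
      exact: nc_neumann_sum.
    congr sup; apply/seteqP; split => [_ [_ [n _ <-] <-]|_ [n _ <-]]; first by exists n.
    by exists (S n); [exists n|].
  - by exists (S 0%N), 0%N.
  - by move=> _ [n _ <-]; split.
  - move=> _ _ [m _ <-] [n _ <-]; exists (S (maxn m n)); split; first by exists (maxn m n).
      by apply: le_S; exact: leq_maxl.
    by apply: le_S; exact: leq_maxr.
  - by split.
  - move=> _ [n _ <-]; apply/le_opP => // u; rewrite SE [leRHS]rdotDl lerD2r.
    have cu := cvg_rdotl (v := u) (neumannP u); rewrite -(cvg_lim _ cu)//.
    apply: limr_ge; first by apply/cvg_ex; eexists; exact: cu.
    by exists n => // m /= nm; exact: rdot_neumann_sum_nondecreasing.
  - move=> C [MC sC] SC; apply/le_opP => // u; rewrite [leLHS]rdotDl -lerBrDr.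
    have cu := cvg_rdotl (v := u) (neumannP u); rewrite -(cvg_lim _ cu)//.
    apply: limr_le; first by apply/cvg_ex; eexists; exact: cu.
    near=> n; rewrite lerBrDr; have /le_opP := SC (S n) (ex_intro2 _ _ n Logic.I erefl).
    by move=> /(_ (MS n) MC (sS n) sC u); rewrite SE.
have [[C CP]|unb] := pselect (has_ubound [set retau (neumann_sum n) | n in setT]).
  by exists C => n; apply: CP; exists n.
(* If the traces were unbounded, [sup] would take its junk value 0 in [shifted], whatever [a] is. *)
have out a : retau neumann + a = 0.
  rewrite shifted sup_out// => -[_ [C CP]]; apply: unb; exists (C - a) => _ [n _ <-].
  by rewrite lerBrDr; apply: CP; exists n.
by have := out 0; have := out 1; lra.
Unshelve. all: by end_near. Qed.

Lemma retau_iter_ge0 k : 0 <= retau (iter (k + k)%N B).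
Proof.
have -> : iter (k + k)%N B = iter k B \o iter k B by apply/funext => u; rewrite iterD.
apply: retau_adj_ge0; [exact: nc_iter|exact: nc_iter|exact: selfadjoint_iter].
Qed.

(** Each even moment is one of the nonnegative terms of a bounded partial sum. *)
Lemma retau_iter_bounded : exists C, forall k, retau (iter (k + k)%N B) <= C.
Proof.
have [C CP] := retau_neumann_sum_bounded; exists C => k; apply: le_trans (CP k.+1).
rewrite retau_sum; last by move=> i; exact: nc_iter.
rewrite big_ord_recr /= lerDr sumr_ge0// => i _; exact: retau_iter_ge0.
Qed.

Lemma retau_iter_sqr k : retau (iter k B) ^+ 2 <= retau (iter (k + k)%N B).
Proof.
have MBk := nc_iter k MB; have Mid := nc_id P.
have := retau_cauchy_schwarz Mid Mid MBk MBk (@selfadjoint_id _ P) (selfadjoint_iter k).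
rewrite (_ : id \o id = id)// retau_id mul1r.
by have -> : iter (k + k)%N B = iter k B \o iter k B by apply/funext => u; rewrite iterD.
Qed.

(** Iterating Cauchy-Schwarz bounds the power [2^(n+1)] of [retau B] by the trace of the same power
    of [B], which stays bounded. A value of modulus above 1 would make these powers grow without
    limit, by Bernoulli's inequality. *)
Lemma retau_half_le1 : `|retau B| <= 1.
Proof.
have [C CP] := retau_iter_bounded.
have pow n : (retau B ^+ 2) ^+ (2 ^ n) <= retau (iter (2 ^ n + 2 ^ n)%N B).
  elim: n => [|n IH]; first by rewrite expn0 expr1; exact: (retau_iter_sqr 1).
  apply: le_trans (retau_iter_sqr _).
  rewrite expnS mul2n -addnn exprD -expr2 ler_pXn2r// nnegrE.
    exact: exprn_ge0 (sqr_ge0 _).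
  exact: retau_iter_ge0.
rewrite leNgt; apply/negP => B1.
have b1 : 1 < retau B ^+ 2 by rewrite -real_normK ?num_real// exprn_egt1.
have bernoulli (b : R) m : 1 <= b -> m%:R * (b - 1) <= b ^+ m.
  move=> b_ge1; elim: m => [|m IH]; first by rewrite mul0r expr0.
  rewrite exprSr -addn1 natrD; have := exprn_ege1 m b_ge1.
  by move: IH; move: (b ^+ m) => x; nra.
have [n _ /(_ n (leqnn n))] := nbhs_infty_gtr (C / (retau B ^+ 2 - 1)).
rewrite /= ltr_pdivrMr ?subr_gt0// ltNge => /negP; apply.
apply: le_trans (CP (2 ^ n)%N); apply: le_trans (pow n); apply: le_trans (bernoulli _ _ (ltW b1)).
by rewrite ler_pM2r ?subr_gt0// ler_nat ltnW// ltn_expl.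
Qed.

End StateBound.

(** The factor 2 comes from rescaling [B] to norm at most [1/2]. It becomes harmless once the bound
    is applied to high powers of an operator. *)
Lemma retau_le_norm (R : realType) (P : ncProbSpace R) (B : P -> P) (c : R) :
  nc_alg P B -> selfadjoint B -> 0 < c -> (forall u, hnorm (B u) <= c * hnorm u) ->
  `|retau B| <= 2 * c.
Proof.
move=> MB sB c0 Bc; pose B' := real_complex R (2 * c)^-1 *: B.
have c2 : 0 < 2 * c by rewrite mulr_gt0.
have /retau_half_le1 : nc_alg P B' by exact: nc_scale.
have /[swap]/[apply] : selfadjoint B'.
  rewrite /B' -[_ *: _]addr0; apply: adjoint_rlin => // u v.
  by rewrite -[(0 : P -> P) u]/(0 : P) -[(0 : P -> P) v]/(0 : P) linear0l linear0r.
rewrite retau_scale// normrM gtr0_norm ?invr_gt0// ler_pdivrMl// mulr1; apply => u.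
rewrite -[B' u]/(real_complex R _ *: B u) hnormZ gtr0_norm ?invr_gt0// ler_pdivrMl//.
by have := Bc u; lra.
Qed.

(** * Polynomial functional calculus *)

Definition polop (R : realType) (P : ncProbSpace R) (X : P -> P) (p : {poly R}) : P -> P :=
  fun u => \sum_(i < size p) real_complex R p`_i *: iter i X u.

Section PolynomialCalculus.
Variables (R : realType) (P : ncProbSpace R) (X : P -> P).
Local Notation rc := (real_complex R).
Local Notation M := (nc_alg P).
Implicit Types (p q : {poly R}) (u : P).

Lemma polop_widen n p u : (size p <= n)%N ->
  polop X p u = \sum_(i < n) rc p`_i *: iter i X u.
Proof.
move=> pn; rewrite /polop (big_ord_widen n (fun i => rc p`_i *: iter i X u))//.
rewrite big_mkcond; apply: eq_bigr => i _; case: ltnP => // /leq_sizeP/(_ i (leqnn i))->.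
by rewrite rmorph0 scale0r.
Qed.

Lemma polopD p q : polop X (p + q) = polop X p + polop X q.
Proof.
apply/funext => u; pose n := maxn (size p) (size q).
have -> : (polop X p + polop X q) u = polop X p u + polop X q u by [].
rewrite !(@polop_widen n) ?leq_maxl ?leq_maxr ?size_polyD//.
by rewrite -big_split; apply: eq_bigr => i _; rewrite coefD rmorphD scalerDl.
Qed.

Lemma polopZ a p : polop X (a *: p) = rc a *: polop X p.
Proof.
apply/funext => u; rewrite -[RHS]/(rc a *: polop X p u).
rewrite !(@polop_widen (size p)) ?size_scale_leq// scaler_sumr.
by apply: eq_bigr => i _; rewrite coefZ rmorphM scalerA.
Qed.

Lemma polopC a : polop X a%:P = rc a *: id.
Proof.
apply/funext => u; rewrite (@polop_widen 1) ?size_polyC_leq1//.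
by rewrite big_ord1 coefC.
Qed.

Lemma polop1 : polop X 1 = id.
Proof. by rewrite polopC; apply/funext => u; rewrite /= rmorph1 [LHS]scale1r. Qed.

Hypothesis lX : linear X.

Lemma linear_iter k : linear (iter k X).
Proof.
by elim: k => [//|k IH a u v]; have H := IH a u v; rewrite !iterS H lX.
Qed.

Lemma linop_sum (A : P -> P) I (s : seq I) (F : I -> P) : linear A ->
  A (\sum_(i <- s) F i) = \sum_(i <- s) A (F i).
Proof.
move=> lA; elim: s => [|i s IH]; first by rewrite !big_nil linop0.
by rewrite !big_cons linopD// IH.
Qed.

Lemma polopXl p : polop X ('X * p) = X \o polop X p.
Proof.
apply/funext => u /=; rewrite (@polop_widen (size p).+1); last first.
  by apply: leq_trans (size_polyMleq _ _) _; rewrite size_polyX.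
rewrite big_ord_recl coefXM eqxx rmorph0 scale0r add0r.
rewrite [polop X p u]/polop linop_sum//; apply: eq_bigr => i _.
by rewrite coefXM /= linopZ.
Qed.

Lemma polopM p q : polop X (p * q) = polop X p \o polop X q.
Proof.
elim/poly_ind: p q => [|p c IH] q.
  rewrite mul0r; apply/funext => u /=.
  by rewrite /polop size_poly0 !big_ord0.
rewrite mulrDl -mulrA polopD IH polopXl mul_polyC polopZ polopD polopC.
have -> : polop X (p * 'X) = polop X p \o X.
  rewrite IH -['X]mulr1 polopXl polop1; exact/funext.
exact/funext.
Qed.

Lemma polopX : polop X 'X = X.
Proof. by rewrite -['X]mulr1 polopXl polop1. Qed.

Lemma polop_linear p : linear (polop X p).
Proof.
move=> a u v; rewrite /polop scaler_sumr -big_split; apply: eq_bigr => i _.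
by rewrite linear_iter scalerDr !scalerA mulrC.
Qed.

Hypotheses (MX : M X) (sX : selfadjoint X).

Lemma nc_polop p : M (polop X p).
Proof.
elim/poly_ind: p => [|p c IH].
  have -> : polop X 0 = 0 by apply/funext => u; rewrite /polop size_poly0 big_ord0.
  exact: nc_zero.
rewrite polopD polopM polopX polopC; apply: nc_add; first exact: nc_comp.
by apply: nc_scale; exact: nc_id.
Qed.

Lemma selfadjoint_polop p : selfadjoint (polop X p).
Proof.
move=> u v; rewrite /polop linear_sumlz linear_sumr /=; apply: eq_bigr => k _.
rewrite hdotZl hdotZr selfadjoint_iter//; congr (_ * _).
by apply/eqP; rewrite eq_complex Re_conjC Im_conjC /= oppr0 !eqxx.
Qed.

Section Law.
Variable mu : probability R R.
Hypothesis lawX : has_law X mu.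

Lemma law_moment_integrable k : mu.-integrable setT (EFin \o (fun x : R => x ^+ k)).
Proof. by case: (lawX k). Qed.

Lemma law_moment k : nc_tau P (iter k X) = rc (\int[mu]_x (x ^+ k))%R.
Proof. by case: (lawX k). Qed.

End Law.

End PolynomialCalculus.

Definition moments_integrable (R : realType) (mu : probability R R) :=
  forall k : nat, mu.-integrable setT (EFin \o (fun x : R => x ^+ k)).

Section PolynomialIntegral.
Variables (R : realType) (mu : probability R R).
Hypothesis mom : moments_integrable mu.
Implicit Types (p : {poly R}) (x : R).

Lemma integrable_horner p : mu.-integrable setT (EFin \o (fun x => p.[x])).
Proof.
have -> : EFin \o (fun x => p.[x]) = fun x => (\sum_(i < size p) (p`_i * x ^+ i)%:E)%E.
  by apply/funext => x /=; rewrite horner_coef sumEFin.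
by apply: integrable_sum => // i _; apply: integrableZ_EFin; exact: mom.
Qed.

Lemma Rintegral_horner p :
  (\int[mu]_x p.[x])%R = \sum_(i < size p) p`_i * (\int[mu]_x (x ^+ i))%R.
Proof.
apply: EFin_inj; rewrite -integral_EFin; last exact: integrable_horner.
under eq_integral do rewrite horner_coef -sumEFin.
rewrite integral_sum//; last by move=> i; apply: integrableZ_EFin; exact: mom.
rewrite -sumEFin; apply: eq_bigr => i _; have momi := mom i.
by rewrite integral_EFin ?RintegralZl//; exact: integrableZ_EFin.
Qed.

End PolynomialIntegral.

(** The bridge between state and law: estimates of polynomials on the support turn into estimates of
    traces. *)
Lemma retau_polop (R : realType) (P : ncProbSpace R) (X : P -> P) (mu : probability R R)
    (p : {poly R}) : nc_alg P X -> has_law X mu ->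
  nc_tau P (polop X p) = real_complex R (\int[mu]_x p.[x])%R.
Proof.
move=> MX lawX; rewrite Rintegral_horner; last by move=> k; exact: law_moment_integrable lawX k.
have -> : polop X p = \sum_(i < size p) real_complex R p`_i *: iter i X.
  by apply/funext => u; rewrite fct_sumE.
pose F (i : 'I_(size p)) : P -> P := real_complex R p`_i *: iter i X.
rewrite rmorph_sum; suff : forall s : seq 'I_(size p), nc_tau P (\sum_(i <- s) F i) =
    \sum_(i <- s) real_complex R (p`_i * (\int[mu]_x (x ^+ i))%R) by apply.
elim=> [|i s IH]; first by rewrite !big_nil tau_zero.
have MF j : nc_alg P (F j) by apply: nc_scale; exact: nc_iter.
rewrite !big_cons tau_add ?IH//; last exact: nc_sum.
by congr (_ + _); rewrite tau_scale ?(law_moment lawX) ?rmorphM//; exact: nc_iter.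
Qed.

Lemma law_moments_integrable (R : realType) (P : ncProbSpace R) (X : P -> P)
    (mu : probability R R) : has_law X mu -> moments_integrable mu.
Proof. by move=> lawX k; exact: law_moment_integrable lawX k. Qed.

(** Geometric series of [1 / (X^2 + t)] in powers of [1 - (X^2 + t) / c], cut after [n] terms. It
    approximates where [x^2 + t <= c]; the value [t = 0] serves to bound traces of operator
    inverses. *)
Definition resolvent_poly (R : realType) (c t : R) (n : nat) : {poly R} :=
  c^-1 *: \sum_(k < n) (1 - c^-1 *: ('X^2 + t%:P)) ^+ k.

Section ResolventPoly.
Variables (R : realType) (c t : R).
Hypotheses (c0 : 0 < c).
Implicit Types (x : R) (n : nat).

Lemma resolvent_polyM n :
  ('X^2 + t%:P) * resolvent_poly c t n = 1 - (1 - c^-1 *: ('X^2 + t%:P)) ^+ n.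
Proof.
rewrite /resolvent_poly -scalerAr scalerAl.
set s := 1 - c^-1 *: ('X^2 + t%:P).
have -> : c^-1 *: ('X^2 + t%:P) = - (s - 1) by rewrite /s addrAC subrr add0r opprK.
by rewrite mulNr -subrX1 opprB.
Qed.

Lemma horner_base x : (1 - c^-1 *: ('X^2 + t%:P)).[x] = 1 - (x ^+ 2 + t) / c.
Proof. by rewrite !hornerE mulrC. Qed.

Lemma horner_resolvent_poly n x :
  (x ^+ 2 + t) * (resolvent_poly c t n).[x] = 1 - (1 - (x ^+ 2 + t) / c) ^+ n.
Proof.
have := congr1 (fun p : {poly R} => p.[x]) (resolvent_polyM n).
rewrite /= hornerM hornerD hornerXn hornerC => ->.
by rewrite hornerD hornerN hornerC horner_exp horner_base.
Qed.

Lemma resolvent_poly_approx n x : 0 < t -> x ^+ 2 + t <= c ->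
  0 <= (x ^+ 2 + t)^-1 - (resolvent_poly c t n).[x] <= (1 - t / c) ^+ n / t.
Proof.
move=> t0 xc; have x0 := sqr_ge0 x; have y0 : 0 < x ^+ 2 + t by lra.
have -> : (x ^+ 2 + t)^-1 - (resolvent_poly c t n).[x] =
    (1 - (x ^+ 2 + t) / c) ^+ n / (x ^+ 2 + t).
  have := horner_resolvent_poly n x; move: (_ ^+ n) (_.[x]) y0 => r e y0 H.
  apply: (mulfI (lt0r_neq0 y0)); rewrite mulrBr H mulrCA mulfV ?gt_eqF//; lra.
have s0 : 0 <= 1 - (x ^+ 2 + t) / c by rewrite subr_ge0 ler_pdivrMr// mul1r.
rewrite divr_ge0 ?exprn_ge0 ?(ltW y0)//= ler_pM ?exprn_ge0 ?invr_ge0 ?(ltW y0)//.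
  have st : (1 - (x ^+ 2 + t) / c) <= 1 - t / c.
    by rewrite lerB// ler_pM2r ?invr_gt0//; lra.
  by rewrite lerXn2r// nnegrE (le_trans s0).
by rewrite lef_pV2 ?posrE//; lra.
Qed.

End ResolventPoly.

(** With [s = x^2 / c] it reads [(1 - x^2 / c)^n <= (c / n) / (x^2 + c / n)]: the remainder of a
    geometric series is controlled by a resolvent at [t = c / n]. *)
Lemma one_subX_le (R : realFieldType) (s : R) n : 0 <= s <= 1 ->
  (1 - s) ^+ n * (1 + n%:R * s) <= 1.
Proof.
move=> /andP[s0 s1]; elim: n => [|n IH]; first by rewrite mul0r addr0 mulr1.
apply: le_trans IH; rewrite exprS -addn1 natrD.
have : 0 <= (1 - s) ^+ n by rewrite exprn_ge0// subr_ge0.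
have : 0 <= n%:R :> R by [].
by move: (_ ^+ n) => r; move: (n%:R) => k k0 r0; rewrite mulrAC [leRHS]mulrC ler_wpM2r//; nra.
Qed.

(** * Support of the law and the bounds by operator inverses *)

Definition supported (R : realType) (mu : probability R R) (b : R) :=
  mu [set x | b < `|x|] = 0%E.

Section Supported.
Variables (R : realType) (mu : probability R R) (b : R).
Hypothesis mub : supported mu b.
Implicit Types (f : R -> R).

Lemma measurable_outside (a : R) : measurable [set x : R | a < `|x|].
Proof.
have mn : measurable_fun setT (fun x : R => `|x|).
  by apply: continuous_measurable_fun; exact: norm_continuous.
have -> : [set x : R | a < `|x|] = [set: R] `&` (fun x : R => `|x|) @^-1` `]a, +oo[.
  by rewrite setTI; apply/seteqP; split => x /=; rewrite in_itv/= andbT.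
exact: mn.
Qed.

Lemma le_integral_supported f (g : R -> \bar R) :
  mu.-integrable setT (EFin \o f) -> (forall x, 0 <= g x)%E ->
  (forall x, `|x| <= b -> ((f x)%:E <= g x)%E) ->
  ((\int[mu]_x f x)%R%:E <= \int[mu]_x g x)%E.
Proof.
move=> fi g0 fg; rewrite -integral_EFin//.
have mN := measurable_outside b.
rewrite (negligible_integral mN measurableT fi mub) integral_mkcond.
apply: le_integralT => x; rewrite patchE; case: ifPn => [|_]; last exact: g0.
by rewrite inE => -[_ /negP]; rewrite -leNgt; exact: fg.
Qed.

Lemma le_Rintegral_supported f g :
  mu.-integrable setT (EFin \o f) -> mu.-integrable setT (EFin \o g) ->
  (forall x, `|x| <= b -> f x <= g x) ->
  (\int[mu]_x f x <= \int[mu]_x g x)%R.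
Proof.
move=> fi gi fg; have gi' := integrableZ_EFin (- 1) gi.
have : ((\int[mu]_x (f x + (- 1) * g x))%R%:E <= \int[mu]_x (cst 0 x))%E.
  apply: le_integral_supported => //; first exact: integrableD_EFin.
  by move=> x xb; rewrite lee_fin; have := fg x xb; lra.
by rewrite integral0 lee_fin RintegralD// RintegralZl//; lra.
Qed.

Lemma supportedW a : b <= a -> supported mu a.
Proof.
move=> ba; apply/eqP; rewrite eq_le measure_ge0 andbT -[leRHS]mub.
apply: le_measure; rewrite ?inE; try exact: measurable_outside.
by move=> x /=; exact: le_lt_trans.
Qed.

Hypothesis mom : moments_integrable mu.

Lemma stieltjes_approx c t n : 0 < t -> b ^+ 2 + t <= c ->
  0 <= stieltjes mu t - (\int[mu]_x (resolvent_poly c t n).[x])%R <= (1 - t / c) ^+ n / t.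
Proof.
move=> t0 bc; have b20 := sqr_ge0 b; have c0 : 0 < c by lra.
have pi := integrable_horner mom (resolvent_poly c t n).
have pNi := integrableZ_EFin (- 1) pi.
have di := integrableD_EFin (resolvent_integrable mu t0) pNi.
have dE : stieltjes mu t - (\int[mu]_x (resolvent_poly c t n).[x])%R =
    (\int[mu]_x ((x ^+ 2 + t)^-1 + (- 1) * (resolvent_poly c t n).[x]))%R.
  by rewrite RintegralD ?RintegralZl ?mulN1r//; exact: resolvent_integrable.
have approx x : `|x| <= b ->
    0 <= (x ^+ 2 + t)^-1 + (- 1) * (resolvent_poly c t n).[x] <= (1 - t / c) ^+ n / t.
  move=> xb; rewrite mulN1r; apply: resolvent_poly_approx => //.
  apply: le_trans bc; rewrite lerD2r -(real_normK (num_real x)).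
  by rewrite lerXn2r ?nnegrE// (le_trans _ xb).
rewrite dE; apply/andP; split.
  rewrite -(Rintegral_cstT mu 0); apply: le_Rintegral_supported => //.
    exact: integrable_cst.
  by move=> x /approx/andP[].
rewrite -(Rintegral_cstT mu ((1 - t / c) ^+ n / t)); apply: le_Rintegral_supported => //.
  exact: integrable_cst.
by move=> x /approx/andP[].
Qed.

End Supported.

Section LawSupport.
Variables (R : realType) (P : ncProbSpace R).
Implicit Types (X Z : P -> P) (mu : probability R R).

Lemma nc_bound X : nc_alg P X -> exists2 b : R, 0 < b & forall u, hnorm (X u) <= b * hnorm u.
Proof.
move=> /nc_bounded[_ [c Xc]]; exists (`|c| + 1) => [|u]; first by rewrite ltr_wpDl.
apply: le_trans (Xc u) _; rewrite ler_wpM2r ?hnorm_ge0//.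
by apply: le_trans (ler_norm c) _; rewrite lerDl.
Qed.

Lemma hnorm_iter X (b : R) k u : 0 <= b -> (forall u, hnorm (X u) <= b * hnorm u) ->
  hnorm (iter k X u) <= b ^+ k * hnorm u.
Proof.
move=> b0 Xb; elim: k => [|k IH]; first by rewrite expr0 mul1r.
by rewrite iterS exprS -mulrA; apply: le_trans (Xb _) _; rewrite ler_wpM2l.
Qed.

(** Chebyshev's inequality with the moment of order [2k]: [(2 b)^(2k)] times the mass outside is at
    most [2 b^(2k)], so the mass is at most [2 / 4^k] for every [k]. Doubling [b] produces the
    geometric decay. *)
Lemma law_supported X mu (b : R) : sa_var X -> has_law X mu -> 0 < b ->
  (forall u, hnorm (X u) <= b * hnorm u) -> supported mu (2 * b).
Proof.
move=> [MX sX] lawX b0 Xb; have b20 : 0 < 2 * b by lra.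
set A := [set x : R | 2 * b < `|x|].
have mA : measurable A by exact: measurable_outside.
have cheb k : (mu A <= (2 * 4^-1 ^+ k)%:E)%E.
  have mk := law_moment_integrable lawX (k + k).
  have : ((((2 * b) ^+ (k + k))%:E * mu A) <= \int[mu]_x (x ^+ (k + k))%:E)%E.
    rewrite -integral_cst// integral_mkcond; apply: le_integralT => x; rewrite patchE.
    case: ifPn => [|_]; last by rewrite lee_fin exprD -expr2 sqr_ge0.
    rewrite inE /A /= => xA; rewrite lee_fin !exprD -!expr2 -(real_normK (num_real (x ^+ k))).
    by rewrite normrX lerXn2r ?nnegrE ?exprn_ge0 ?(ltW b20)// lerXn2r ?nnegrE ?(ltW b20)// ltW.
  rewrite integral_EFin//.
  have -> : (\int[mu]_x (x ^+ (k + k)))%R = retau (iter (k + k) X).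
    by rewrite /retau (law_moment lawX).
  have moment_le : retau (iter (k + k) X) <= 2 * b ^+ (k + k).
    apply: le_trans (ler_norm _) _; apply: retau_le_norm; rewrite ?exprn_gt0//.
    - exact: nc_iter.
    - exact: selfadjoint_iter.
    - by move=> u; apply: hnorm_iter => //; exact: ltW.
  have fA : mu A \is a fin_num by rewrite fin_num_measure.
  rewrite -(fineK fA) -EFinM !lee_fin => H.
  have p0 : 0 < (2 * b) ^+ (k + k) by rewrite exprn_gt0.
  rewrite -(ler_pM2l p0); apply: le_trans H (le_trans moment_le _).
  rewrite mulrCA ler_pM2l// exprMn [_ * b ^+ _]mulrC -mulrA ler_peMr ?exprn_ge0 ?(ltW b0)//.
  rewrite exprD -exprMn -natrM -exprMn mulfV ?expr1n// pnatr_eq0//.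
apply/eqP; rewrite eq_le measure_ge0 andbT.
have c0 : (2 * 4^-1 ^+ k)%:E @[k --> \oo] --> (0%:E : \bar R).
  apply: cvg_EFin; first by near=> k.
  rewrite [X in _ --> X](_ : 0 = 2 * 0 :> R); last by rewrite mulr0.
  by apply: cvgMr; apply: cvg_expr; rewrite ger0_norm//; lra.
apply: (@le_trans _ _ (0%:E)%E) => //; rewrite -(cvg_lim _ c0)//; apply: lime_ge.
  by apply/cvg_ex; eexists; exact: c0.
by near=> k; exact: cheb.
Unshelve. all: by end_near. Qed.

Lemma selfadjoint_inverse (A Z : P -> P) : selfadjoint A -> is_inverse A Z -> selfadjoint Z.
Proof.
move=> sA [_ AZ ZA] u v; have AZu w : A (Z w) = w by have := congr1 (@^~ w) AZ.
by rewrite -{1}(AZu v) -sA AZu.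
Qed.

Lemma resolvent_poly0_ge (c x : R) n : 0 < c -> (0 < n)%N -> x ^+ 2 <= c ->
  (x ^+ 2 + c / n%:R)^-1 <= (resolvent_poly c 0 n).[x].
Proof.
move=> c0 n0 xc; have x0 := sqr_ge0 x.
have n0' : 0 < n%:R :> R by rewrite ltr0n.
have cn0 : 0 < c / n%:R by rewrite divr_gt0.
have := @horner_resolvent_poly R c 0 n x; rewrite addr0.
(* At [x = 0] all [n] terms of the series are 1 and equality holds. *)
have [x2|x2] := eqVneq (x ^+ 2) 0.
  move=> _; rewrite /resolvent_poly hornerZ horner_sum.
  under eq_bigr do rewrite horner_exp horner_base x2 addr0 mul0r subr0 expr1n.
  by rewrite sumr_const card_ord x2 add0r invf_div mulrC.
have {}x2 : 0 < x ^+ 2 by rewrite lt_neqAle eq_sym x2.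
move=> H; rewrite -(ler_pM2l x2) H.
have s01 : 0 <= x ^+ 2 / c <= 1 by rewrite divr_ge0 ?(ltW c0)//= ler_pdivrMr// mul1r.
have := one_subX_le n s01; move: (_ ^+ n) => r Hr.
rewrite ler_pdivrMr ?addr_gt0//.
have -> : (1 - r) * (x ^+ 2 + c / n%:R) = x ^+ 2 + c / n%:R * (1 - r * (1 + n%:R * (x ^+ 2 / c))).
  by field; rewrite !gt_eqF.
by rewrite lerDl mulr_ge0 ?(ltW cn0)// subr_ge0.
Qed.

(** With [p] a truncated series for [1 / X^2] and [r = 1 - X^2 p], expansion gives [r Z r = Z - q],
    where [q = 2 p - p X^2 p]. The left side is positive, so the trace of [q(X)] is at most that of
    [Z], while on the support [q >= p >= 1 / (x^2 + t)]. *)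
Lemma stieltjes_le_retau_inverse X mu Z t : sa_var X -> has_law X mu ->
  is_inverse (X \o X) Z -> 0 < t -> stieltjes mu t <= retau Z.
Proof.
move=> [MX sX] lawX invZ t0; have [MZ XXZ ZXX] := invZ.
have lX := nc_linear MX; have lZ := nc_linear MZ.
have sZ : selfadjoint Z by apply: selfadjoint_inverse invZ; exact: adjoint_comp.
have [b b0 Xb] := nc_bound MX.
have mub := law_supported (conj MX sX) lawX b0 Xb.
(* This [n] makes [c = n t] dominate [x^2] on the support while [c / n] is exactly [t]. *)
have [n _ /(_ n (leqnn n)) nb] := nbhs_infty_gtr ((2 * b) ^+ 2 / t).
have n0 : (0 < n)%N by rewrite -(ltr0n R); apply: le_lt_trans nb; rewrite divr_ge0 ?sqr_ge0 ?ltW.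
pose c := n%:R * t; have c0 : 0 < c by rewrite mulr_gt0// ltr0n.
have bc : (2 * b) ^+ 2 <= c by rewrite /c -ler_pdivrMr// ltW.
have tE : c / n%:R = t by rewrite /c mulrAC mulfV ?mul1r// pnatr_eq0 -lt0n.
pose p := resolvent_poly c 0 n; pose q := p + p - p * ('X^2 * p).
pose r := polop X (1 - 'X^2 * p).
have rE : 1 - 'X^2 * p = (1 - c^-1 *: ('X^2 + 0%:P)) ^+ n.
  by have := @resolvent_polyM R c 0 n; rewrite addr0 -/p => ->; rewrite subKr.
have sr : selfadjoint r by exact: selfadjoint_polop.
have Mr : nc_alg P r by exact: nc_polop.
have X2 : polop X 'X^2 = X \o X by rewrite expr2 polopM// polopX.
have polopB p1 p2 : polop X (p1 - p2) = polop X p1 - polop X p2.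
  by rewrite -scaleN1r polopD polopZ rmorphN1 scaleN1r.
have rZr : r \o Z \o r = Z - polop X q.
  have ZXXE w : Z (X (X w)) = w by have := congr1 (@^~ w) ZXX.
  have XXZE w : X (X (Z w)) = w by have := congr1 (@^~ w) XXZ.
  apply/funext => u /=.
  have ru w : r w = w - X (X (polop X p w)) by rewrite /r polopB polop1 polopM// X2.
  have ru' w : r w = w - polop X p (X (X w)).
    by rewrite /r mulrC polopB polop1 polopM// X2.
  rewrite (ru u) (linopB _ _ lZ) ZXXE ru' -[(Z - polop X q) u]/(Z u - polop X q u).
  rewrite (linopB _ _ lX) (linopB _ _ lX) XXZE (linopB _ _ (polop_linear lX p)).
  rewrite /q polopB polopD (polopM lX p) (polopM lX 'X^2) X2.
  rewrite -[(_ - _ : P -> P) u]/(polop X p u + polop X p u - polop X p (X (X (polop X p u)))).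
  by rewrite -addrA -opprD addrA.
have rZr0 : 0 <= retau (r \o Z \o r).
  (* Since [Z X X Z = Z], the product has the form of an adjoint times an operator. *)
  have -> : r \o Z \o r = (r \o Z \o X) \o (X \o Z \o r).
    apply/funext => u /=; congr (r _); have := congr1 (@^~ (Z (r u))) ZXX.
    by move=> /= ->.
  apply: retau_adj_ge0; try by do ?[exact: Mr|exact: MX|exact: MZ|apply: nc_comp].
  by move=> u v; exact: (adjoint_comp (adjoint_comp sX sZ) sr u v).
have Mq : nc_alg P (polop X q) by exact: nc_polop.
have : retau (polop X q) <= retau Z by rewrite -subr_ge0 -retau_sub// -rZr.
apply: le_trans; rewrite /retau (retau_polop _ MX lawX) /=.
have mom := law_moments_integrable lawX.
apply: (le_Rintegral_supported mub).
- exact: resolvent_integrable.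
- exact: integrable_horner.
move=> x xb; have xc : x ^+ 2 <= c.
  apply: le_trans bc; rewrite -(real_normK (num_real x)).
  by rewrite lerXn2r ?nnegrE// (le_trans _ xb).
have pge := resolvent_poly0_ge c0 n0 xc; rewrite tE in pge.
have r0 : 0 <= 1 - x ^+ 2 * p.[x].
  have := congr1 (fun h : {poly R} => h.[x]) rE.
  rewrite /= hornerD hornerN hornerC hornerM hornerXn horner_exp horner_base addr0 => ->.
  by rewrite exprn_ge0// subr_ge0 ler_pdivrMr// mul1r.
apply: le_trans pge _; rewrite /q -/p.
have -> : (p + p - p * ('X^2 * p)).[x] = p.[x] + p.[x] * (1 - x ^+ 2 * p.[x]).
  rewrite hornerD hornerN hornerM (hornerM 'X^2) hornerXn hornerD.
  by rewrite mulrBr mulr1 addrA.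
rewrite lerDl mulr_ge0//; apply: le_trans (resolvent_poly0_ge c0 n0 xc).
by rewrite ltW// tE resolvent_gt0.
Qed.

Lemma inv_sq_le_retau_inverse X mu Z : sa_var X -> has_law X mu ->
  is_inverse (X \o X) Z -> (inv_sq_integral mu <= (retau Z)%:E)%E.
Proof.
move=> saX lawX invZ.
have gcvg : (\int[mu]_x ((x ^+ 2 + mesh R n)^-1)%:E)%E @[n --> \oo] --> inv_sq_integral mu.
  apply: cvg_integral_nondecreasing => [n|n x|x m n mn|x].
  - by apply/measurable_EFinP; apply: measurable_resolvent; exact: mesh_gt0.
  - by rewrite lee_fin ltW// resolvent_gt0// mesh_gt0.
  - rewrite lee_fin lef_pV2 ?posrE ?ltr_wpDl ?sqr_ge0 ?mesh_gt0// lerD2l /mesh.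
    by rewrite lef_pV2 ?posrE ?exprn_gt0// ler_eXn2l// ltr1n.
  - exact: cvg_inv_mesh (sqr_ge0 x).
rewrite -(cvg_lim _ gcvg)//; apply: lime_le; first by apply/cvg_ex; eexists; exact: gcvg.
near=> n; have m0 := mesh_gt0 R n.
rewrite integral_EFin; last exact: resolvent_integrable.
by rewrite lee_fin; exact: stieltjes_le_retau_inverse saX lawX invZ m0.
Unshelve. all: by end_near. Qed.

End LawSupport.

(** * Classical independence *)

Section JointResolvent.
Variables (R : realType) (P : ncProbSpace R) (X Y : P -> P) (mu : probability R R).
Hypotheses (saX : sa_var X) (saY : sa_var Y).
Hypotheses (lawX : has_law X mu) (lawY : has_law Y mu).
Hypothesis indep : classically_independent X Y.
Local Notation rc := (real_complex R).
Implicit Types (x y : R) (n k i j : nat).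

Let MX : nc_alg P X := saX.1.
Let MY : nc_alg P Y := saY.1.
Let sX : selfadjoint X := saX.2.
Let sY : selfadjoint Y := saY.2.
Let lX : linear X := nc_linear MX.
Let lY : linear Y := nc_linear MY.
Let mom : moments_integrable mu := law_moments_integrable lawX.

Definition sum_sq : P -> P := (X \o X) + (Y \o Y).

Variable c : R.
Hypothesis c0 : 0 < c.

Definition contraction : P -> P := id - rc c^-1 *: sum_sq.

Lemma contractionE u : contraction u = u - rc c^-1 *: (X (X u) + Y (Y u)).
Proof. by []. Qed.

Lemma nc_sum_sq : nc_alg P sum_sq.
Proof. by apply: nc_add; exact: nc_comp. Qed.

Lemma selfadjoint_sum_sq : selfadjoint sum_sq.
Proof.
rewrite /sum_sq -[X \o X]scale1r -(rmorph1 rc).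
by apply: adjoint_rlin; exact: adjoint_comp.
Qed.

Lemma nc_contraction : nc_alg P contraction.
Proof. by apply: nc_sub; [exact: nc_id|apply: nc_scale; exact: nc_sum_sq]. Qed.

Lemma selfadjoint_contraction : selfadjoint contraction.
Proof.
have -> : contraction = rc (- c^-1) *: sum_sq + id.
  by apply/funext => u; rewrite addrC rmorphN scaleNr.
apply: adjoint_rlin; first exact: selfadjoint_sum_sq.
exact: selfadjoint_id.
Qed.

(** The monomial factor closes the induction on [k]: expanding one power of the contraction raises
    [i] or [j] by 2. *)
Definition joint_kernel k i j x y : R :=
  (1 - (x ^+ 2 + y ^+ 2) / c) ^+ k * (x ^+ i * y ^+ j).

Lemma joint_kernelS k i j x y : joint_kernel k.+1 i j x y =
  joint_kernel k i j x y + (- c^-1) * (joint_kernel k i.+2 j x y + joint_kernel k i j.+2 x y).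
Proof. by rewrite /joint_kernel exprSr !exprS expr0; ring. Qed.

(** The case [k = 0] is classical independence; the induction step moves [Y] past powers of [X] by
    commutation. Integrability is carried along because each step splits integrals of sums. *)
Lemma joint_moment k i j :
  [/\ forall x, mu.-integrable setT (EFin \o joint_kernel k i j x),
      mu.-integrable setT (EFin \o (fun x => (\int[mu]_y joint_kernel k i j x y)%R))
    & retau (iter k contraction \o (iter i X \o iter j Y)) =
      (\int[mu]_x (\int[mu]_y joint_kernel k i j x y))%R].
Proof.
elim: k i j => [|k IH] i j.
  have kE x : joint_kernel 0 i j x = fun y => x ^+ i * y ^+ j.
    by apply/funext => y; rewrite /joint_kernel expr0 mul1r.
  have intE x : (\int[mu]_y joint_kernel 0 i j x y)%R = x ^+ i * (\int[mu]_y (y ^+ j))%R.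
    by rewrite kE RintegralZl//; exact: mom.
  split => [x||].
  - by rewrite kE; apply: integrableZ_EFin; exact: mom.
  - under [X in EFin \o X]eq_fun do rewrite intE mulrC.
    by apply: integrableZ_EFin; exact: mom.
  - under eq_Rintegral do rewrite intE.
    rewrite RintegralZr//.
    rewrite -[iter 0 contraction \o _]/(iter i X \o iter j Y) /retau.
    have [_ ->] := indep.
    by rewrite (law_moment lawX) (law_moment lawY) ReMl.
have [i1 i2 i3] := IH i j; have [j1 j2 j3] := IH i.+2 j; have [k1 k2 k3] := IH i j.+2.
have jk1 x := integrableD_EFin (j1 x) (k1 x).
have cjk1 x := integrableZ_EFin (- c^-1) (jk1 x).
have jk2 := integrableD_EFin j2 k2; have cjk2 := integrableZ_EFin (- c^-1) jk2.
have kE x : joint_kernel k.+1 i j x = fun y =>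
    joint_kernel k i j x y + (- c^-1) * (joint_kernel k i.+2 j x y + joint_kernel k i j.+2 x y).
  by apply/funext => y; exact: joint_kernelS.
have intE x : (\int[mu]_y joint_kernel k.+1 i j x y)%R =
    (\int[mu]_y joint_kernel k i j x y)%R + (- c^-1) *
    ((\int[mu]_y joint_kernel k i.+2 j x y)%R + (\int[mu]_y joint_kernel k i j.+2 x y)%R).
  by rewrite kE RintegralD// RintegralZl// RintegralD.
split => [x||].
- by rewrite kE; exact: integrableD_EFin (i1 x) (cjk1 x).
- under [X in EFin \o X]eq_fun do rewrite intE.
  exact: integrableD_EFin i2 cjk2.
- under eq_Rintegral do rewrite intE.
  rewrite RintegralD// RintegralZl// RintegralD// -i3 -j3 -k3.
  have Mk a b : nc_alg P (iter k contraction \o (iter a X \o iter b Y)).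
    apply: nc_comp; first by apply: nc_iter; exact: nc_contraction.
    by apply: nc_comp; exact: nc_iter.
  rewrite -retau_add// -retau_scale; last exact: nc_add.
  rewrite -retau_add//; last by apply: nc_scale; exact: nc_add.
  congr retau; apply/funext => u.
  have lk : linear (iter k contraction) by apply: nc_linear; apply: nc_iter; exact: nc_contraction.
  rewrite -[LHS]/(iter k.+1 contraction (iter i X (iter j Y u))) iterSr contractionE.
  rewrite (linopB _ _ lk) (linopZ _ _ lk) (linopD _ _ lk) rmorphN scaleNr.
  congr (_ - _ *: (_ + _)).
  have XY w : X (Y w) = Y (X w) by have [/(congr1 (@^~ w))] := indep.
  have XiY w : Y (iter i X w) = iter i X (Y w).
    by elim: i {IH i1 i2 i3 j1 j2 j3 k1 k2 k3 jk1 cjk1 jk2 cjk2 kE intE} => //= i IHi;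
      rewrite -XY IHi.
  by rewrite !XiY.
Qed.

Lemma joint_kernel00 k x y : joint_kernel k 0 0 x y = (1 - (x ^+ 2 + y ^+ 2) / c) ^+ k.
Proof. by rewrite /joint_kernel !expr0 !mulr1. Qed.

Lemma contraction_moment k :
  [/\ forall x, mu.-integrable setT (EFin \o (fun y => (1 - (x ^+ 2 + y ^+ 2) / c) ^+ k)),
      mu.-integrable setT
        (EFin \o (fun x => (\int[mu]_y (1 - (x ^+ 2 + y ^+ 2) / c) ^+ k)%R))
    & retau (iter k contraction) =
      (\int[mu]_x (\int[mu]_y (1 - (x ^+ 2 + y ^+ 2) / c) ^+ k))%R].
Proof.
have := joint_moment k 0 0.
have -> : joint_kernel k 0 0 = fun x y => (1 - (x ^+ 2 + y ^+ 2) / c) ^+ k.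
  by apply/funext => x; apply/funext => y; exact: joint_kernel00.
by have -> : iter k contraction \o (iter 0 X \o iter 0 Y) = iter k contraction by [].
Qed.

Variable b : R.
Hypotheses (mub : supported mu b) (bc : 2 * b ^+ 2 <= c).

Lemma joint_bound x y : `|x| <= b -> `|y| <= b -> 0 <= (x ^+ 2 + y ^+ 2) / c <= 1.
Proof.
move=> xb yb; have sq (z : R) : `|z| <= b -> z ^+ 2 <= b ^+ 2.
  by move=> zb; rewrite -(real_normK (num_real z)) lerXn2r ?nnegrE// (le_trans _ zb).
rewrite divr_ge0 ?addr_ge0 ?sqr_ge0 ?(ltW c0)//= ler_pdivrMr// mul1r.
by apply: le_trans bc; rewrite mulr_natl mulr2n; apply: lerD; exact: sq.
Qed.

(** Truncated Neumann series for the inverse of [X^2 + Y^2 = c (1 - contraction)]. *)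
Definition partial_inverse n : P -> P := rc c^-1 *: \sum_(k < n) iter k contraction.

Lemma nc_partial_inverse n : nc_alg P (partial_inverse n).
Proof. by apply: nc_scale; apply: nc_sum => k; apply: nc_iter; exact: nc_contraction. Qed.

Lemma sum_sq_partial_inverse n u :
  sum_sq (partial_inverse n u) = u - iter n contraction u.
Proof.
have lA := nc_linear nc_sum_sq.
rewrite -[partial_inverse n u]/(rc c^-1 *: (\sum_(k < n) iter k contraction) u) fct_sumE.
have A_S w : rc c^-1 *: sum_sq w = w - contraction w by rewrite subKr.
rewrite (linopZ _ _ lA) A_S; elim: n => [|n IH].
  rewrite big_ord0 subrr -A_S (linop0 lA) scaler0 //.
have lS := nc_linear nc_contraction.
rewrite big_ord_recr /= (linopD _ _ lS) opprD addrACA IH.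
by rewrite addrA subrK.
Qed.

(** The trace is a double integral of a truncated geometric series with ratio in [[0, 1]] on the
    support, which lies below its full sum. *)
Lemma retau_partial_inverse_le n :
  ((2 * retau (partial_inverse n))%:E <= inv_sum_sq_integral mu)%E.
Proof.
pose h k x y := (1 - (x ^+ 2 + y ^+ 2) / c) ^+ k.
pose H x y := \sum_(k < n) 2 / c * h k x y.
have hi k x : mu.-integrable setT (EFin \o h k x) by have [+ _ _] := contraction_moment k; apply.
have hI k : mu.-integrable setT (EFin \o (fun x => (\int[mu]_y h k x y)%R)).
  by have [_ + _] := contraction_moment k.
have sum_int (I : finType) (f : I -> R -> R) : (forall e, mu.-integrable setT (EFin \o f e)) ->
    mu.-integrable setT (EFin \o (fun x => \sum_e f e x)) /\
    (\int[mu]_x \sum_e f e x)%R = \sum_e (\int[mu]_x f e x)%R.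
  move=> fi; have sE : EFin \o (fun x => \sum_e f e x) = (fun x => \sum_e (f e x)%:E)%E.
    by apply/funext => x /=; rewrite sumEFin.
  have si : mu.-integrable setT (EFin \o (fun x => \sum_e f e x)).
    by rewrite sE; apply: integrable_sum => // e _; exact: fi.
  split=> //; apply: EFin_inj; rewrite -integral_EFin//.
  under eq_integral do rewrite -sumEFin.
  by rewrite integral_sum// -sumEFin; apply: eq_bigr => e _; rewrite integral_EFin.
have [Hi HI] : (forall x, mu.-integrable setT (EFin \o H x)) /\
    forall x, (\int[mu]_y H x y)%R = \sum_(k < n) 2 / c * (\int[mu]_y h k x y)%R.
  split=> x; have [| + +] := sum_int _ (fun (k : 'I_n) y => 2 / c * h k x y).
  - by move=> k; apply: integrableZ_EFin.
  - by [].
  - by move=> k; apply: integrableZ_EFin.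
  - by move=> _ ->; apply: eq_bigr => k _; rewrite RintegralZl.
have [HHi HHI] := sum_int _ (fun (k : 'I_n) x => 2 / c * (\int[mu]_y h k x y)%R)
  (fun k : 'I_n => integrableZ_EFin (2 / c) (hI k)).
have -> : 2 * retau (partial_inverse n) = (\int[mu]_x (\int[mu]_y H x y))%R.
  under eq_Rintegral do rewrite HI.
  rewrite HHI retau_scale; last first.
    by apply: nc_sum => k; apply: nc_iter; exact: nc_contraction.
  rewrite retau_sum; last by move=> k; apply: nc_iter; exact: nc_contraction.
  rewrite mulrA mulr_sumr; apply: eq_bigr => k _.
  by have [_ _ ->] := contraction_moment k; rewrite RintegralZl.
have inv_ge0 x y : (0 <= 2%:E * (x ^+ 2 + y ^+ 2)%:E^-1 :> \bar R)%E.
  rewrite inver; case: ifP => [_|_]; first by rewrite mulry gtr0_sg// mul1e leey.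
  by rewrite lee_fin mulr_ge0// invr_ge0 addr_ge0// sqr_ge0.
apply: (le_integral_supported mub) => [|x|x xb].
- by under [X in EFin \o X]eq_fun do rewrite HI.
- by apply: integral_ge0 => y _; exact: inv_ge0.
apply: (le_integral_supported mub) => // y yb.
rewrite inver; case: eqVneq => [_|s0]; first by rewrite mulry gtr0_sg// mul1e leey.
have sgt0 : 0 < x ^+ 2 + y ^+ 2 by rewrite lt_neqAle eq_sym s0 addr_ge0// sqr_ge0.
rewrite -EFinM lee_fin /H -mulr_sumr -mulrA ler_pM2l// -(ler_pM2l sgt0) mulfV//.
have /andP[q0 q1] := joint_bound xb yb; rewrite /h.
have := subrX1 (1 - (x ^+ 2 + y ^+ 2) / c) n.
set q := (x ^+ 2 + y ^+ 2) / c in q0 q1 *.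
have -> : (x ^+ 2 + y ^+ 2) * (c^-1 * \sum_(k < n) (1 - q) ^+ k) =
    - ((1 - q - 1) * \sum_(k < n) (1 - q) ^+ k) by rewrite mulrA -/q; ring.
move=> <-; have : 0 <= (1 - q) ^+ n by rewrite exprn_ge0// subr_ge0.
by lra.
Qed.

(** Dropping [y^2] only increases the contraction, so its powers are bounded by [(1 - x^2 / c)^n],
    and [one_subX_le] leads to the transform of a single law. *)
Lemma retau_contraction_sqr_le n : (0 < n)%N ->
  retau (iter (n + n)%N contraction) <=
    c / n%:R * stieltjes mu (c / n%:R).
Proof.
move=> n0; have n0' : 0 < n%:R :> R by rewrite ltr0n.
have cn0 : 0 < c / n%:R by rewrite divr_gt0.
have [i1 i2 ->] := contraction_moment (n + n).
rewrite /stieltjes -RintegralZl//; last exact: resolvent_integrable.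
apply: (le_Rintegral_supported mub) => //.
  by apply: integrableZ_EFin; exact: resolvent_integrable.
move=> x xb; rewrite -(Rintegral_cstT mu (_ * _)).
apply: (le_Rintegral_supported mub) => //; first exact: integrable_cst.
move=> y yb; have x0 := sqr_ge0 x; have y0 := sqr_ge0 y.
have /andP[q0 q1] := joint_bound xb yb.
have xq : 0 <= x ^+ 2 / c <= 1.
  rewrite divr_ge0 ?(ltW c0)//= (le_trans _ q1)// ler_pM2r ?invr_gt0//; lra.
apply: (@le_trans _ _ ((1 - x ^+ 2 / c) ^+ n)).
  apply: (@le_trans _ _ ((1 - (x ^+ 2 + y ^+ 2) / c) ^+ n)).
    by rewrite exprD ler_piMr ?exprn_ge0 ?exprn_ile1 ?subr_ge0// lerBlDr lerDl.
  have qx : x ^+ 2 / c <= (x ^+ 2 + y ^+ 2) / c by rewrite ler_pM2r ?invr_gt0//; lra.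
  by rewrite lerXn2r ?nnegrE ?subr_ge0// ?lerB//; case/andP: xq.
have := one_subX_le n xq; move: (_ ^+ n) => r Hr.
rewrite ler_pdivlMr ?ltr_wpDl//.
have -> : r * (x ^+ 2 + c / n%:R) = c / n%:R * (r * (1 + n%:R * (x ^+ 2 / c))).
  by field; rewrite !gt_eqF.
by rewrite ler_piMr ?(ltW cn0).
Qed.

(** [W] is a partial inverse plus [W] times the [n]-th power of the contraction. By Cauchy-Schwarz
    the squared trace of this remainder is at most a constant over [n]; invertibility of [X]
    provides the constant by bounding the transforms uniformly in [t]. *)
Lemma retau_inverse_le W : invertible_op X -> is_inverse sum_sq W ->
  ((2 * retau W)%:E <= inv_sum_sq_integral mu)%E.
Proof.
move=> [V [MV XV VX]] invW; have [MW AW WA] := invW.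
have sW : selfadjoint W by apply: selfadjoint_inverse invW; exact: selfadjoint_sum_sq.
have invVV : is_inverse (X \o X) (V \o V).
  split; first exact: nc_comp.
    by apply/funext => u /=; have /(congr1 (@^~ (V u)))/= -> := XV; have /(congr1 (@^~ u)) := XV.
  by apply/funext => u /=; have /(congr1 (@^~ (X u)))/= -> := VX; have /(congr1 (@^~ u)) := VX.
pose K := retau (V \o V).
have gK t : 0 < t -> stieltjes mu t <= K by exact: stieltjes_le_retau_inverse saX lawX invVV.
have lW := nc_linear MW.
have WE n : W = partial_inverse n + (W \o iter n contraction).
  apply/funext => u; have /(congr1 (@^~ (partial_inverse n u)))/= := WA.
  rewrite sum_sq_partial_inverse (linopB _ _ lW) => H.
  by rewrite -[RHS]/(partial_inverse n u + W (iter n contraction u)) -H subrK.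
have MS n : nc_alg P (iter n contraction) by apply: nc_iter; exact: nc_contraction.
have sS n : selfadjoint (iter n contraction).
  by apply: selfadjoint_iter; exact: selfadjoint_contraction.
have WS_le n : (0 < n)%N ->
    retau (W \o iter n contraction) ^+ 2 <= retau (W \o W) * (c / n%:R * K).
  move=> n0; apply: le_trans (retau_cauchy_schwarz MW MW (MS n) (MS n) sW (sS n)) _.
  rewrite ler_wpM2l ?retau_adj_ge0//.
  have -> : iter n contraction \o iter n contraction = iter (n + n) contraction.
    by apply/funext => u; rewrite iterD.
  apply: le_trans (retau_contraction_sqr_le n0) _.
  by rewrite ler_pM2l ?gK// divr_gt0// ltr0n.
have I0 : (0 <= inv_sum_sq_integral mu)%E.
  by apply: le_trans (retau_partial_inverse_le 0); rewrite /retau /partial_inverse big_ord0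
    scaler0 tau_zero mulr0.
case: (inv_sum_sq_integral mu) I0 retau_partial_inverse_le => [I|_ _|//]; last exact: leey.
rewrite lee_fin => I0 PI; rewrite lee_fin leNgt; apply/negP => WI.
(* If the claim failed, the remainder would have trace at least [d] for every [n], contradicting its
   decay. *)
pose d := (2 * retau W - I) / 2; have d0 : 0 < d by rewrite divr_gt0// subr_gt0.
have dn n : (0 < n)%N -> d ^+ 2 * n%:R <= retau (W \o W) * (c * K).
  move=> n0; have n0' : 0 < n%:R :> R by rewrite ltr0n.
  rewrite -ler_pdivlMr//; apply: (@le_trans _ _ (retau (W \o iter n contraction) ^+ 2)).
    have dW : d <= retau (W \o iter n contraction).
      have := PI n; rewrite lee_fin; have := congr1 (@retau R P) (WE n).
      rewrite (retau_add (nc_partial_inverse n) (nc_comp MW (MS n))).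
      by rewrite /d; lra.
    by rewrite lerXn2r ?nnegrE ?(ltW d0)// (le_trans (ltW d0)).
  apply: le_trans (WS_le n n0) _; rewrite le_eqVlt; apply/orP; left; apply/eqP.
  by field; rewrite gt_eqF.
have [n _ /(_ n.+1 (leqnSn n))] := nbhs_infty_gtr (retau (W \o W) * (c * K) / d ^+ 2).
rewrite /= ltr_pdivrMr ?exprn_gt0// ltNge => /negP; apply.
by rewrite mulrC; exact: dn.
Qed.

End JointResolvent.

(** * Norm convergence *)

Section OperatorConvergence.
Variables (R : realType) (P : ncProbSpace R).
Implicit Types (A X Y : P -> P) (b e : R) (j k n : nat).

Lemma opnorm_ub A u : nc_alg P A -> hnorm u <= 1 -> hnorm (A u) <= opnorm A.
Proof.
move=> MA u1; have [b b0 Ab] := nc_bound MA; apply: ub_le_sup; last by exists u.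
by exists b => _ [v /= v1 <-]; apply: le_trans (Ab v) _; rewrite ler_piMr// ltW.
Qed.

Lemma opnorm_ge0 A : nc_alg P A -> 0 <= opnorm A.
Proof.
by move=> MA; apply: le_trans (hnorm_ge0 (A 0)) (opnorm_ub MA _); rewrite hnorm0 ler01.
Qed.

Lemma le_opnorm A u : nc_alg P A -> hnorm (A u) <= opnorm A * hnorm u.
Proof.
move=> MA; have lA := nc_linear MA.
have [->|u0] := eqVneq u 0; first by rewrite (linop0 lA) !hnorm0 mulr0.
have nu0 : 0 < hnorm u.
  rewrite lt_neqAle hnorm_ge0 andbT eq_sym; apply/eqP => /hnorm0_eq0 u00.
  by rewrite u00 eqxx in u0.
rewrite -ler_pdivrMr//.
have <- : hnorm (A (real_complex R (hnorm u)^-1 *: u)) = hnorm (A u) / hnorm u.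
  by rewrite (linopZ _ _ lA) hnormZ gtr0_norm ?invr_gt0// mulrC.
by apply: opnorm_ub => //; rewrite hnormZ gtr0_norm ?invr_gt0// mulVf ?gt_eqF.
Qed.

Lemma retau_le_norm0 A e : nc_alg P A -> selfadjoint A -> 0 <= e ->
  (forall u, hnorm (A u) <= e * hnorm u) -> `|retau A| <= 2 * e.
Proof.
move=> MA sA e0 Ae; apply/ler_addgt0Pr => d d0.
have ed : 0 < e + d / 2 by rewrite ltr_wpDl// divr_gt0.
apply: le_trans (retau_le_norm MA sA ed _) _.
  by move=> u; apply: le_trans (Ae u) _; rewrite ler_wpM2r ?hnorm_ge0// lerDl divr_ge0// ltW.
by rewrite mulrDr mulrCA mulfV ?mulr1// pnatr_eq0.
Qed.

(** Telescoping through [Y (Y^j - X^j) + (Y - X) X^j]. The constant is chosen before the operators,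
    hence is uniform along a sequence with a common bound. *)
Lemma hnorm_iter_diff b j : 0 <= b -> exists2 C, 0 <= C & forall X Y e u, linear Y ->
  (forall v, hnorm (X v) <= b * hnorm v) -> (forall v, hnorm (Y v) <= b * hnorm v) ->
  0 <= e -> (forall v, hnorm (Y v - X v) <= e * hnorm v) ->
  hnorm (iter j Y u - iter j X u) <= C * e * hnorm u.
Proof.
move=> b0; elim: j => [|j [C C0 IH]].
  by exists 0 => // X Y e u *; rewrite subrr hnorm0 !mul0r.
exists (b * C + b ^+ j) => [|X Y e u lY Xb Yb e0 YXe].
  by rewrite addr_ge0 ?mulr_ge0 ?exprn_ge0.
have -> : iter j.+1 Y u - iter j.+1 X u =
    Y (iter j Y u - iter j X u) + (Y (iter j X u) - X (iter j X u)).
  by rewrite (linopB _ _ lY) addrA subrK.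
apply: le_trans (hnormD _ _) _; rewrite !mulrDl; apply: lerD.
  by apply: le_trans (Yb _) _; rewrite -!mulrA ler_wpM2l// mulrA; exact: IH.
apply: le_trans (YXe _) _; rewrite [_ * e]mulrC -mulrA ler_wpM2l//.
exact: hnorm_iter.
Qed.

Variables (X_ : nat -> P -> P) (X : P -> P).
Variables (mu_ : nat -> probability R R) (mu : probability R R).
Hypotheses (saX_ : forall k, sa_var (X_ k)) (lawX_ : forall k, has_law (X_ k) (mu_ k)).
Hypotheses (saX : sa_var X) (lawX : has_law X mu).
Hypothesis X_cvg : opnorm (X_ k - X) @[k --> \oo] --> 0.

Lemma uniform_bound : exists2 b, 0 < b & (forall u, hnorm (X u) <= b * hnorm u) /\
  \forall k \near \oo, forall u, hnorm (X_ k u) <= b * hnorm u.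
Proof.
have [b b0 Xb] := nc_bound saX.1; exists (b + 1); first by rewrite addr_gt0.
split=> [u|]; first by apply: le_trans (Xb u) _; rewrite ler_wpM2r ?hnorm_ge0// lerDl.
have near1 : \forall k \near \oo, opnorm (X_ k - X) < 1 by exact: (cvgr_lt _ X_cvg _ ltr01).
apply: filterS near1 => k k1 u.
have -> : X_ k u = X u + (X_ k - X) u by rewrite -[(X_ k - X) u]/(X_ k u - X u) addrC subrK.
apply: le_trans (hnormD _ _) _; rewrite mulrDl; apply: lerD => //.
apply: le_trans (le_opnorm _ (nc_sub (saX_ k).1 saX.1)) _.
by rewrite ler_wpM2r ?hnorm_ge0// ltW.
Qed.

Lemma moment_cvg j :
  (\int[mu_ k]_x (x ^+ j))%R @[k --> \oo] --> (\int[mu]_x (x ^+ j))%R.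
Proof.
have -> : (fun k => (\int[mu_ k]_x (x ^+ j))%R) = (fun k => retau (iter j (X_ k))).
  by apply/funext => k; rewrite /retau (law_moment (lawX_ k)).
have -> : (\int[mu]_x (x ^+ j))%R = retau (iter j X) by rewrite /retau (law_moment lawX).
have [b b0 [Xb X_b]] := uniform_bound.
have [C C0 HC] := hnorm_iter_diff j (ltW b0).
have e_ge0 k : 0 <= opnorm (X_ k - X).
  by apply: opnorm_ge0; exact: nc_sub (saX_ k).1 saX.1.
have diff : \forall k \near \oo,
    `|retau (iter j (X_ k)) - retau (iter j X)| <= 2 * (C * opnorm (X_ k - X)).
  apply: filterS X_b => k X_kb; have MXk := (saX_ k).1; have MX := saX.1.
  rewrite -retau_sub; try exact: nc_iter.
  apply: retau_le_norm0.
  - by apply: nc_sub; exact: nc_iter.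
  - have -> : iter j (X_ k) - iter j X = real_complex R (-1) *: iter j X + iter j (X_ k).
      by rewrite rmorphN1 scaleN1r addrC.
    by apply: adjoint_rlin; apply: selfadjoint_iter; [exact: saX.2|exact: (saX_ k).2].
  - exact: mulr_ge0.
  - move=> u; apply: HC => //; first exact: nc_linear.
    by move=> v; exact: (le_opnorm v (nc_sub MXk MX)).
have c0 : 2 * (C * opnorm (X_ k - X)) @[k --> \oo] --> 0.
  rewrite [X in _ --> X](_ : 0 = 2 * (C * 0)); last by rewrite !mulr0.
  by apply: cvgMr; apply: cvgMr.
have lo : retau (iter j X) - 2 * (C * opnorm (X_ k - X)) @[k --> \oo] --> retau (iter j X).
  by rewrite -[X in _ --> X]subr0; apply: cvgB => //; exact: cvg_cst.
have hi : retau (iter j X) + 2 * (C * opnorm (X_ k - X)) @[k --> \oo] --> retau (iter j X).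
  by rewrite -[X in _ --> X]addr0; apply: cvgD => //; exact: cvg_cst.
apply: (squeeze_cvgr _ lo hi); near=> k.
by rewrite -ler_distl; near: k.
Unshelve. all: by end_near. Qed.

Lemma horner_cvg (p : {poly R}) :
  (\int[mu_ k]_x p.[x])%R @[k --> \oo] --> (\int[mu]_x p.[x])%R.
Proof.
have psum n : \sum_(i < n) p`_i * (\int[mu_ k]_x (x ^+ i))%R @[k --> \oo] -->
    \sum_(i < n) p`_i * (\int[mu]_x (x ^+ i))%R.
  elim: n => [|n IH].
    by rewrite big_ord0; under eq_fun do rewrite big_ord0; exact: cvg_cst.
  rewrite big_ord_recr; under eq_fun do rewrite big_ord_recr.
  by apply: cvgD => //; apply: cvgMr; exact: moment_cvg.
rewrite (Rintegral_horner (law_moments_integrable lawX)).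
have -> : (fun k => (\int[mu_ k]_x p.[x])%R) =
    fun k => \sum_(i < size p) p`_i * (\int[mu_ k]_x (x ^+ i))%R.
  by apply/funext => k; exact: Rintegral_horner (law_moments_integrable (lawX_ k)) p.
exact: psum.
Qed.

(** The three-epsilon argument: a common bound on the operators supports all late laws in one
    interval, where a single polynomial approximates the resolvent, and integrals of polynomials
    converge. *)
Lemma stieltjes_cvg t : 0 < t -> stieltjes (mu_ k) t @[k --> \oo] --> stieltjes mu t.
Proof.
move=> t0; have [b b0 [Xb X_b]] := uniform_bound.
pose c := (2 * b) ^+ 2 + t; have c0 : 0 < c by rewrite ltr_wpDl// sqr_ge0.
have mub := law_supported saX lawX b0 Xb.
have q01 : 0 <= 1 - t / c < 1.
  rewrite subr_ge0 ler_pdivrMr// mul1r lerDr sqr_ge0/=.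
  by rewrite ltrBlDr ltrDl divr_gt0.
apply/cvgrPdist_lt => d d0.
have [n nd] : exists n, (1 - t / c) ^+ n / t < d / 3.
  have qc : (1 - t / c) ^+ n / t @[n --> \oo] --> 0.
    rewrite [X in _ --> X](_ : 0 = 0 / t); last by rewrite mul0r.
    by apply: cvgMl; apply: cvg_expr; case/andP: q01 => ? ?; rewrite ger0_norm.
  by have [n _ /(_ n (leqnn n))] := cvgr_lt _ qc _ (divr_gt0 d0 (ltr0n R 3)); exists n.
pose p := resolvent_poly c t n.
have pc := @horner_cvg p; move/cvgrPdist_lt : pc => /(_ _ (divr_gt0 d0 (ltr0n R 3))) pc.
have /andP[l1 l2] := stieltjes_approx mub (law_moments_integrable lawX) n t0 (lexx c).
near=> k.
have X_kb : forall u, hnorm (X_ k u) <= b * hnorm u by near: k.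
have pk : `|(\int[mu]_x p.[x])%R - (\int[mu_ k]_x p.[x])%R| < d / 3 by near: k.
have mukb := law_supported (saX_ k) (lawX_ k) b0 X_kb.
have /andP[k1 k2] := stieltjes_approx mukb (law_moments_integrable (lawX_ k)) n t0 (lexx c).
move: pk l1 l2 k1 k2; rewrite -/p !ltr_norml => /andP[p1 p2] l1 l2 k1 k2.
by apply/andP; split; lra.
Unshelve. all: by end_near. Qed.

End OperatorConvergence.

(** * Boolean independence *)

Definition scale_fun (R : realType) (a x : R) : R := a * x.

Lemma measurable_scale_fun (R : realType) (a : R) : measurable_fun setT (scale_fun a).
Proof. exact: mulrl_measurable. Qed.

HB.instance Definition _ (R : realType) (a : R) :=
  isMeasurableFun.Build _ _ R R (scale_fun a) (measurable_scale_fun a).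

Definition scaled_law (R : realType) (a : R) (mu : probability R R) : probability R R :=
  distribution mu (scale_fun a).

Section ScaledLaw.
Variables (R : realType) (a : R) (mu : probability R R).

Lemma scaled_law_symmetric : symmetric_law mu -> symmetric_law (scaled_law a mu).
Proof.
move=> smu A mA.
have mA' : measurable (scale_fun a @^-1` A).
  by rewrite -[_ @^-1` _]setTI; exact: (measurable_scale_fun a).
rewrite -[RHS](smu _ mA').
have -> : -%R @^-1` (scale_fun a @^-1` A) = scale_fun a @^-1` (-%R @^-1` A).
  by apply/seteqP; split => x /=; rewrite /scale_fun mulrN.
by [].
Qed.

Lemma integral_scaled_law (f : R -> R) : measurable_fun setT f ->
  mu.-integrable setT (EFin \o (fun x => f (a * x))) ->
  (scaled_law a mu).-integrable setT (EFin \o f) /\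
  (\int[scaled_law a mu]_x f x)%R = (\int[mu]_x f (a * x))%R.
Proof.
move=> mf fi; have mEf : measurable_fun setT (EFin \o f) by exact/measurable_EFinP.
have ms := measurable_scale_fun a; split.
  by apply: integrable_pushforward.
by rewrite /Rintegral [X in fine X](integral_pushforward ms mEf).
Qed.

End ScaledLaw.

Section ScaledOperator.
Variables (R : realType) (P : ncProbSpace R).
Local Notation rc := (real_complex R).
Implicit Types (X Y : P -> P) (a b : R).

Lemma iter_scale a X k : linear X -> iter k (rc a *: X) = rc (a ^+ k) *: iter k X.
Proof.
move=> lX; elim: k => [|k IH].
  by apply/funext => u; rewrite /= expr0 -[RHS]/(rc 1 *: u) rmorph1 scale1r.
apply/funext => u; rewrite iterS IH -[LHS]/(rc a *: X (rc (a ^+ k) *: iter k X u)).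
by rewrite linopZ// scalerA -rmorphM -exprS.
Qed.

Lemma sa_var_scale a X : sa_var X -> sa_var (rc a *: X).
Proof.
move=> [MX sX]; split; first exact: nc_scale.
rewrite -[rc a *: X]addr0; apply: adjoint_rlin => // u v.
by rewrite -[(0 : P -> P) u]/(0 : P) -[(0 : P -> P) v]/(0 : P) linear0l linear0r.
Qed.

Lemma sa_var_add X Y : sa_var X -> sa_var Y -> sa_var (X + Y).
Proof.
move=> [MX sX] [MY sY]; split; first exact: nc_add.
by rewrite -[X]scale1r -(rmorph1 rc); exact: adjoint_rlin.
Qed.

Lemma has_law_scale a X (mu : probability R R) : sa_var X -> has_law X mu ->
  has_law (rc a *: X) (scaled_law a mu).
Proof.
move=> [MX _] lawX k; have lX := nc_linear MX.
have mi := law_moment_integrable lawX k.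
have [| |si sE] := @integral_scaled_law R a mu (fun x => x ^+ k).
- exact: exprn_measurable.
- by under [X in EFin \o X]eq_fun do rewrite exprMn; exact: integrableZ_EFin.
split; first exact: si.
rewrite iter_scale// tau_scale ?(law_moment lawX); last exact: nc_iter.
by rewrite sE -rmorphM -RintegralZl//; congr rc; apply: eq_Rintegral => x _; rewrite exprMn.
Qed.

Lemma nc_alt_word X Y s : nc_alg P X -> nc_alg P Y -> nc_alg P (alt_word X Y s).
Proof.
elim: s X Y => [|k s IH] X Y MX MY; first exact: nc_id.
by apply: nc_comp; [exact: nc_iter|exact: IH].
Qed.

(** Word and product of moments acquire the same scalar, so each factorization identity survives
    rescaling. *)
Lemma alt_word_scale a b X Y s : nc_alg P X -> nc_alg P Y -> exists r : R,
  alt_word (rc a *: X) (rc b *: Y) s = rc r *: alt_word X Y s /\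
  alt_moment (rc a *: X) (rc b *: Y) s = rc r * alt_moment X Y s.
Proof.
elim: s X Y a b => [|k s IH] X Y a b MX MY.
  exists 1; split; last by rewrite rmorph1 mul1r.
  by apply/funext => u; rewrite -[RHS]/(rc 1 *: u) rmorph1 scale1r.
have [r [rw rm]] := IH Y X b a MY MX; exists (a ^+ k * r); split.
  apply/funext => u /=; rewrite rw iter_scale; last exact: nc_linear.
  rewrite -[LHS]/(rc (a ^+ k) *: iter k X (rc r *: alt_word Y X s u)).
  rewrite linopZ; last by apply: linear_iter; exact: nc_linear.
  by rewrite scalerA -rmorphM.
rewrite /= rm iter_scale; last exact: nc_linear.
rewrite tau_scale; last exact: nc_iter.
by rewrite rmorphM mulrACA.
Qed.

Lemma boolean_independent_scale a b X Y : nc_alg P X -> nc_alg P Y ->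
  boolean_independent X Y -> boolean_independent (rc a *: X) (rc b *: Y).
Proof.
move=> MX MY ind s s1; have [i1 i2] := ind s s1.
have [r [-> ->]] := alt_word_scale a b s MX MY.
have [r' [-> ->]] := alt_word_scale b a s MY MX.
by rewrite !tau_scale ?i1 ?i2//; exact: nc_alt_word.
Qed.

End ScaledOperator.

(** * Factorization of words and polynomials *)

Fixpoint letter_word (T : Type) (X Y : T -> T) (l : seq bool) : T -> T :=
  if l is b :: l' then (if b then X else Y) \o letter_word X Y l' else id.

Section Factorization.
Variables (R : realType) (P : ncProbSpace R).
Local Notation rc := (real_complex R).
Implicit Types (X Y w : P -> P) (l : seq bool) (k : nat).

(** Boolean independence speaks of alternating blocks, while expanding a polynomial in [X + Y]
    yields arbitrary words. A new letter either enlarges the first block or opens a block of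
    exponent 1, so the induction treats both leading letters at once. *)
Lemma alt_word_of_letters X Y l : exists s, [/\ all (leq 1) s, s != [::]
  & X \o letter_word X Y l = alt_word X Y s].
Proof.
suff : exists s s', [/\ all (leq 1) s, s != [::], X \o letter_word X Y l = alt_word X Y s,
    all (leq 1) s' /\ s' != [::] & Y \o letter_word X Y l = alt_word Y X s'].
  by move=> [s [_ [s1 s0 E _ _]]]; exists s.
elim: l => [|b l [s [s' [s1 s0 E [s1' s0'] E']]]].
  by exists [:: 1%N], [:: 1%N]; split.
case: b.
- case: s s1 s0 E => [//|k s] s1 _ E; exists (k.+1 :: s), (1%N :: k :: s).
  by split => //=; rewrite ?E//; case/andP: s1.
- case: s' s1' s0' E' => [//|k s'] s1' _ E'; exists (1%N :: k :: s'), (k.+1 :: s').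
  by split => //=; rewrite ?E'//; case/andP: s1'.
Qed.

Lemma letter_wordC X Y l : letter_word X Y l = letter_word Y X (map negb l).
Proof. by elim: l => //= -[] l ->. Qed.

(** The operators [w] before which a leading block of [X] splits off as soon as [Y] follows it.
    Quantifying over the word [l] makes the property stable under prepending letters to [w]; being
    linear in [w], it then reaches polynomials in [X + Y]. *)
Definition factors X Y w := nc_alg P w /\ forall l k,
  retau (iter k.+1 X \o (Y \o (letter_word X Y l \o w))) =
  retau (iter k.+1 X) * retau (Y \o (letter_word X Y l \o w)).

Lemma nc_letter_word X Y l : nc_alg P X -> nc_alg P Y -> nc_alg P (letter_word X Y l).
Proof.
by move=> MX MY; elim: l => [|[] l IH] /=; [exact: nc_id|exact: nc_comp|exact: nc_comp].
Qed.

Lemma factors_id X Y (mu : probability R R) : has_law X mu -> boolean_independent X Y ->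
  factors X Y id.
Proof.
move=> lawX ind; split=> [|l k]; first exact: nc_id.
have [s [s1 s0 E]] := alt_word_of_letters Y X (map negb l).
rewrite -letter_wordC in E.
have -> : Y \o (letter_word X Y l \o id) = alt_word Y X s by rewrite -E.
have [fac _] := ind (k.+1 :: s) s1; have [_ facY] := ind s s1.
rewrite /retau -[iter k.+1 X \o alt_word Y X s]/(alt_word X Y (k.+1 :: s)) fac.
(* The real part is multiplicative here because the moments of [X] are real. *)
by rewrite [alt_moment _ _ _]/= -facY (law_moment lawX) ReMl.
Qed.

Lemma letter_word_rcons X Y l b : letter_word X Y (rcons l b) =
  letter_word X Y l \o (if b then X else Y).
Proof. by elim: l => //= c l ->. Qed.

Lemma factors_letter X Y w b : nc_alg P X -> nc_alg P Y ->
  factors X Y w -> factors X Y ((if b then X else Y) \o w).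
Proof.
move=> MX MY [Mw fw]; split=> [|l k]; first by apply: nc_comp => //; case: b.
by have := fw (rcons l b) k; rewrite letter_word_rcons.
Qed.

Lemma factors_lin X Y w w' (r : R) : nc_alg P X -> nc_alg P Y ->
  factors X Y w -> factors X Y w' -> factors X Y (rc r *: w + w').
Proof.
move=> MX MY [Mw fw] [Mw' fw']; split=> [|l k]; first exact: nc_lin.
pose A := Y \o letter_word X Y l.
have MA : nc_alg P A by apply: nc_comp => //; exact: nc_letter_word.
have lA := nc_linear MA; have MXk := nc_iter k.+1 MX; have lXk := nc_linear MXk.
have AE : Y \o (letter_word X Y l \o (rc r *: w + w')) = rc r *: (A \o w) + (A \o w').
  by apply/funext => u; exact: lA.
have XAE : iter k.+1 X \o (rc r *: (A \o w) + (A \o w')) =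
    rc r *: (iter k.+1 X \o (A \o w)) + (iter k.+1 X \o (A \o w')).
  by apply/funext => u; exact: lXk.
have MAw := nc_comp MA Mw; have MAw' := nc_comp MA Mw'.
have MXAw := nc_comp MXk MAw; have MXAw' := nc_comp MXk MAw'.
rewrite AE XAE !retau_add ?retau_scale//; try exact: nc_scale.
by rewrite (fw l k) (fw' l k) mulrDr mulrCA.
Qed.

Lemma factors_polop X Y (mu : probability R R) (p : {poly R}) :
  nc_alg P X -> nc_alg P Y -> has_law X mu -> boolean_independent X Y ->
  factors X Y (polop (X + Y) p).
Proof.
move=> MX MY lawX ind; have lX := nc_linear MX; have lY := nc_linear MY.
have lZ : linear (X + Y) by apply: nc_linear; exact: nc_add.
have fid := factors_id lawX ind.
elim/poly_ind: p => [|p c IH].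
  have -> : polop (X + Y) 0 = rc (-1) *: id + id.
    by apply/funext => u; rewrite /polop size_poly0 big_ord0 rmorphN1 scaleN1r addNr.
  exact: factors_lin.
rewrite mulrC (addrC ('X * p)) polopD polopC (polopXl lZ).
apply: factors_lin => //.
have -> : (X + Y) \o polop (X + Y) p =
    rc 1 *: (X \o polop (X + Y) p) + (Y \o polop (X + Y) p).
  by rewrite rmorph1 scale1r.
apply: factors_lin => //; first exact: (@factors_letter X Y _ true).
exact: (@factors_letter X Y _ false).
Qed.

(** Only polynomials without constant term split off: a constant would leave a word beginning with
    [Y]. The induction on [q] trades its lowest coefficient for one more power of the variable in
    front. *)
Lemma retau_polop_factor X Y w (q : {poly R}) : nc_alg P X -> nc_alg P Y -> factors X Y w ->
  retau (polop X ('X * q) \o (Y \o w)) = retau (polop X ('X * q)) * retau (Y \o w).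
Proof.
move=> MX MY [Mw fw]; have lX := nc_linear MX; have MYw := nc_comp MY Mw.
suff H k : retau (polop X ('X^(k.+1) * q) \o (Y \o w)) =
    retau (polop X ('X^(k.+1) * q)) * retau (Y \o w) by exact: (H 0%N).
have Xn n : polop X 'X^n = iter n X.
  elim: n => [|n IHn]; first by rewrite expr0 polop1.
  by rewrite exprS polopXl// IHn.
elim/poly_ind: q k => [|q c IH] k.
  have -> : polop X ('X^(k.+1) * 0) = 0.
    by rewrite mulr0; apply/funext => u; rewrite /polop size_poly0 big_ord0.
  by rewrite (_ : 0 \o _ = 0)// /retau tau_zero mul0r.
have -> : 'X^(k.+1) * (q * 'X + c%:P) = c *: 'X^(k.+1) + 'X^(k.+2) * q.
  by rewrite mulrDr [_ * c%:P]mulrC mul_polyC [q * _]mulrC mulrA -exprSr addrC.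
rewrite polopD polopZ Xn; set Q := polop X _.
have MQ : nc_alg P Q by exact: nc_polop.
have MXk := nc_iter k.+1 MX.
have -> : (rc c *: iter k.+1 X + Q) \o (Y \o w) =
  rc c *: (iter k.+1 X \o (Y \o w)) + (Q \o (Y \o w)) by [].
have M1 := nc_comp MXk MYw; have M2 := nc_comp MQ MYw.
rewrite !retau_add ?retau_scale//; try exact: nc_scale.
by rewrite IH (fw [::] k) mulrDl mulrA.
Qed.

End Factorization.

Lemma symmetric_odd_integral (R : realType) (mu : probability R R) (f : R -> R) :
  symmetric_law mu -> mu.-integrable setT (EFin \o f) -> (forall x, f (- x) = - f x) ->
  (\int[mu]_x f x)%R = 0.
Proof.
move=> smu fi fodd; have mf := measurable_int mu fi.
have mN : measurable_fun setT (-%R : R -> R) by exact: oppr_measurable.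
have fNi : mu.-integrable setT (EFin \o (fun x => (- 1) * f x)) by exact: integrableZ_EFin.
have : (\int[mu]_x (f x)%:E = \int[mu]_x (f (- x))%:E)%E.
  have := integral_pushforward mN mf (mu := mu) (D := setT).
  rewrite preimage_setT => <- //; last first.
    by have -> : (EFin \o f) \o -%R = EFin \o (fun x => (- 1) * f x)
      by apply/funext => x /=; rewrite fodd mulN1r.
  apply: eq_measure_integral => A mA _; exact/esym/smu.
under [RHS]eq_integral do rewrite fodd -mulN1r.
rewrite !integral_EFin// RintegralZl// => -[]; lra.
Qed.

(** * The resolvent of a sum of Boolean independent variables *)

Section BooleanResolvent.
Variables (R : realType) (P : ncProbSpace R) (X Y : P -> P).
Variables (mu nu rho : probability R R).
Hypotheses (saX : sa_var X) (saY : sa_var Y).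
Hypotheses (lawX : has_law X mu) (lawY : has_law Y nu) (lawZ : has_law (X + Y) rho).
Hypotheses (smu : symmetric_law mu) (snu : symmetric_law nu).
Hypothesis ind : boolean_independent X Y.
Implicit Types (n k : nat).

Let MX : nc_alg P X := saX.1.
Let MY : nc_alg P Y := saY.1.
Let Z : P -> P := X + Y.

Let saZ : sa_var Z := sa_var_add saX saY.
Let MZ : nc_alg P Z := saZ.1.
Let lX : linear X := nc_linear MX.
Let lY : linear Y := nc_linear MY.
Let lZ : linear Z := nc_linear MZ.

Variables (t b : R).
Hypothesis t0 : 0 < t.
Hypotheses (mub : supported mu b) (nub : supported nu b) (rhob : supported rho b).

Let c := b ^+ 2 + t.
Let q := 1 - t / c.

Lemma c_gt0 : 0 < c. Proof. by rewrite ltr_wpDl// sqr_ge0. Qed.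

Lemma q_ge0_lt1 : 0 <= q < 1.
Proof.
rewrite subr_ge0 ler_pdivrMr ?c_gt0// mul1r lerDr sqr_ge0/=.
by rewrite ltrBlDr ltrDl divr_gt0// c_gt0.
Qed.

Lemma q_expn_ge0 n : 0 <= q ^+ n.
Proof. by have /andP[q0 _] := q_ge0_lt1; exact: exprn_ge0. Qed.

(** [e n] approximates [1 / (x^2 + t)], and [r n = 1 - (x^2 + t) e n] is its remainder, between 0
    and [q^n] on the common support. *)
Let e n : {poly R} := resolvent_poly c t n.
Let r n : {poly R} := (1 - c^-1 *: ('X^2 + t%:P)) ^+ n.

Lemma e_r_relation n : 'X^2 * e n = 1 - r n - t *: e n.
Proof.
have := @resolvent_polyM R c t n; rewrite -/(e n) -/(r n) mulrDl mul_polyC => <-.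
by rewrite addrK.
Qed.

Lemma sqr_le_supp x : `|x| <= b -> x ^+ 2 <= b ^+ 2.
Proof. by move=> xb; rewrite -(real_normK (num_real x)) lerXn2r ?nnegrE// (le_trans _ xb). Qed.

Lemma r_bound n x : `|x| <= b -> 0 <= (r n).[x] <= q ^+ n.
Proof.
move=> xb; have x2 := sqr_le_supp xb; have x0 := sqr_ge0 x; have cgt := c_gt0.
rewrite /r horner_exp horner_base.
have s0 : 0 <= 1 - (x ^+ 2 + t) / c by rewrite subr_ge0 ler_pdivrMr// mul1r lerD2r.
have sq : 1 - (x ^+ 2 + t) / c <= q.
  by rewrite lerB// ler_pM2r ?invr_gt0// lerDr.
by rewrite exprn_ge0//= lerXn2r// nnegrE (le_trans s0).
Qed.

Lemma e_bound n x : `|x| <= b -> 0 <= (e n).[x] <= t^-1.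
Proof.
move=> xb; have cgt := c_gt0; have x0 := sqr_ge0 x.
have y0 : 0 < x ^+ 2 + t by rewrite ltr_wpDl.
have /andP[r0 r1] := r_bound n xb.
have q1 : q ^+ n <= 1 by have /andP[? ?] := q_ge0_lt1; rewrite exprn_ile1// ltW.
have := @horner_resolvent_poly R c t n x.
have -> : (1 - (x ^+ 2 + t) / c) ^+ n = (r n).[x] by rewrite /r horner_exp horner_base.
rewrite -/(e n) => eE; rewrite -(pmulr_rge0 _ y0) eE subr_ge0 (le_trans r1 q1)/=.
apply: (@le_trans _ _ (x ^+ 2 + t)^-1); last exact: resolvent_le.
by rewrite -(ler_pM2l y0) eE mulfV ?gt_eqF// lerBlDr lerDl.
Qed.

Section OneLaw.
Variable mu' : probability R R.
Hypotheses (mom : moments_integrable mu') (mub' : supported mu' b).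

Lemma Rintegral_horner_bound (p : {poly R}) (M : R) : 0 <= M ->
  (forall x, `|x| <= b -> `|p.[x]| <= M) -> `|(\int[mu']_x p.[x])%R| <= M.
Proof.
move=> M0 pM; have pi := integrable_horner mom p.
have cst_int (a : R) := integrable_cst mu' a.
rewrite ler_norml; apply/andP; split.
  rewrite -(Rintegral_cstT mu' (- M)); apply: (le_Rintegral_supported mub') => // x /pM.
  by rewrite ler_norml => /andP[].
rewrite -[leRHS](Rintegral_cstT mu' M); apply: (le_Rintegral_supported mub') => // x /pM.
by rewrite ler_norml => /andP[].
Qed.

Lemma cvg_q : q ^+ n @[n --> \oo] --> 0.
Proof. by have /andP[? ?] := q_ge0_lt1; apply: cvg_expr; rewrite ger0_norm. Qed.

Lemma cvg_e : (\int[mu']_x (e n).[x])%R @[n --> \oo] --> stieltjes mu' t.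
Proof.
have qt : stieltjes mu' t - q ^+ n / t @[n --> \oo] --> stieltjes mu' t.
  rewrite -[X in _ --> X]subr0 -[X in _ - X](mul0r t^-1).
  by apply: cvgB; [exact: cvg_cst|apply: cvgMl; exact: cvg_q].
apply: (squeeze_cvgr _ qt (cvg_cst (stieltjes mu' t))); near=> n.
have := stieltjes_approx mub' mom n t0 (lexx c).
by rewrite -/(e n) -/q => /andP[]; lra.
Unshelve. all: by end_near. Qed.

Lemma cvg0_le (u v : nat -> R) : (forall n, `|u n| <= v n) ->
  v n @[n --> \oo] --> 0 -> u n @[n --> \oo] --> 0.
Proof.
move=> uv v0; have nv0 : - v n @[n --> \oo] --> 0 by rewrite -oppr0; exact: cvgN.
apply: (squeeze_cvgr _ nv0 v0); near=> n.
by rewrite -ler_norml.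
Unshelve. all: by end_near. Qed.

Lemma cvg_r : (\int[mu']_x (r n).[x])%R @[n --> \oo] --> 0.
Proof.
apply: (cvg0_le _ cvg_q) => n; apply: Rintegral_horner_bound => [|x xb].
  exact: q_expn_ge0.
by have /andP[r0 r1] := r_bound n xb; rewrite ger0_norm.
Qed.

End OneLaw.

(** [U] and [Z] do not commute, so the product has no joint law; Cauchy-Schwarz separates it into
    integrals against the two laws. *)
Lemma retau_polop_mul_bound U (p p' : {poly R}) (M M' : R) (mu' : probability R R) :
  sa_var U -> has_law U mu' -> supported mu' b -> 0 <= M -> 0 <= M' ->
  (forall x, `|x| <= b -> `|p.[x]| <= M) -> (forall x, `|x| <= b -> `|p'.[x]| <= M') ->
  `|retau (polop U p \o polop Z p')| <= M * M'.
Proof.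
move=> [MU sU] lawU mub' M0 M'0 pM pM'; have lU := nc_linear MU.
have sqb (s : {poly R}) (K : R) (m : probability R R) : 0 <= K -> moments_integrable m ->
    supported m b -> (forall x, `|x| <= b -> `|s.[x]| <= K) ->
    (\int[m]_x (s * s).[x])%R <= K ^+ 2.
  move=> K0 mm mb sK; apply: le_trans (ler_norm _) _.
  apply: (Rintegral_horner_bound mm mb) => [|x xb]; first exact: sqr_ge0.
  by rewrite hornerM normrM -expr2 lerXn2r ?nnegrE// sK.
rewrite -(@ler_pXn2r _ 2)// ?nnegrE ?mulr_ge0// exprMn real_normK ?num_real//.
have sp := selfadjoint_polop sU p; have sp' := selfadjoint_polop saZ.2 p'.
have Mp : nc_alg P (polop U p) by exact: nc_polop.
have Mp' : nc_alg P (polop Z p') by exact: nc_polop.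
apply: le_trans (retau_cauchy_schwarz Mp Mp Mp' Mp' sp sp') _.
rewrite -!polopM// /retau (retau_polop _ MU lawU) (retau_polop _ MZ lawZ) /=.
apply: ler_pM; last 2 first.
- by apply: sqb => //; exact: law_moments_integrable lawU.
- by apply: sqb => //; exact: law_moments_integrable lawZ.
- by apply: Rintegral_ge0 => x _; rewrite hornerM -expr2 sqr_ge0.
- by apply: Rintegral_ge0 => x _; rewrite hornerM -expr2 sqr_ge0.
Qed.

Let E n : P -> P := polop Z (e n).

Lemma resolvent_relation n u : X (Z (E n u)) + Y (Z (E n u)) =
  u - polop Z (r n) u - real_complex R t *: E n u.
Proof.
rewrite -[LHS]/(Z (Z (E n u))).
have := congr1 (fun p => polop Z p u) (e_r_relation n).
rewrite expr2 -mulrA !polopXl// => ZZE; rewrite -[LHS]/((Z \o (Z \o E n)) u) ZZE.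
have polopB p1 p2 : polop Z (p1 - p2) = polop Z p1 - polop Z p2.
  by rewrite -scaleN1r polopD polopZ rmorphN1 scaleN1r.
by rewrite !polopB polop1 polopZ.
Qed.

Section OneSide.
Variables (U V : P -> P) (mu' : probability R R).
Hypotheses (saU : sa_var U) (MV : nc_alg P V) (ZE : Z = U + V).
Hypotheses (lawU : has_law U mu') (smu' : symmetric_law mu') (mub' : supported mu' b).
Hypothesis fE : forall n, factors U V (E n).
Hypothesis fZE : forall n, factors U V (Z \o E n).

Let delta n : R := (\int[mu']_x ('X * ('X * e n)).[x])%R.

Definition side_error n : R :=
  retau (polop U ('X^2 * r n) \o polop Z (e n)) - retau (polop U ('X^2 * e n) \o polop Z (r n)).

(** Up to remainders, [E] is the inverse of [Z^2 + t] and [L] is [U^2 / (U^2 + t)]. Applying [L] to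
    [(U^2 + t) E = 1 - U V E - V Z E] gives [U^2 E = L - L U V E - L V Z E]. The trace of the middle
    term vanishes by symmetry, and that of the last one factors. The trace [delta n] of [L] tends to
    [1 - t * stieltjes mu' t]. *)
Lemma side_relation n : retau (U \o (Z \o E n)) =
  delta n * (1 - retau (V \o (Z \o E n))) + side_error n.
Proof.
have [MU sU] := saU; have lU := nc_linear MU; have lV := nc_linear MV.
have mom := law_moments_integrable lawU.
have ME : nc_alg P (E n) by exact: nc_polop.
have odd0 (p : {poly R}) : (forall x, p.[- x] = - p.[x]) -> retau (polop U p) = 0.
  move=> podd; rewrite /retau (retau_polop _ MU lawU) /=.
  by apply: symmetric_odd_integral => //; exact: integrable_horner.
have e_even x : (e n).[- x] = (e n).[x].
  rewrite /e /resolvent_poly !hornerZ !horner_sum; congr (_ * _); apply: eq_bigr => k _.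
  by rewrite !horner_exp !horner_base sqrrN.
have MVE : nc_alg P (V \o E n) by exact: nc_comp.
have MVZE : nc_alg P (V \o (Z \o E n)) by apply: nc_comp => //; exact: nc_comp.
have MUUE : nc_alg P (U \o (U \o E n)) by apply: nc_comp => //; exact: nc_comp.
have UZE : U \o (Z \o E n) = (U \o (U \o E n)) + (U \o (V \o E n)).
  by apply/funext => u; rewrite ZE /= -[(U + V) _]/(U (E n u) + V (E n u)) linopD.
(* The factor split off is the first moment of a symmetric law. *)
have UVE0 : retau (U \o (V \o E n)) = 0.
  have := retau_polop_factor 1 MU MV (fE n); rewrite mulr1 polopX// => ->.
  rewrite -{1}(polopX lU) odd0 ?mul0r// => x; by rewrite !hornerX.
rewrite UZE retau_add ?UVE0 ?addr0//; last exact: nc_comp.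
pose L := polop U ('X * ('X * e n)).
have ML : nc_alg P L by exact: nc_polop.
have lL := nc_linear ML.
have LL : retau L = delta n by rewrite /retau (retau_polop _ MU lawU).
pose rZ := polop Z (r n); have MrZ : nc_alg P rZ by exact: nc_polop.
(* Apply [L] to [(U^2 + t) E = 1 - r(Z) - U V E - V Z E]. *)
have LHS_E : L \o ((U \o (U \o E n)) + real_complex R t *: E n) =
    (U \o (U \o E n)) - (polop U ('X^2 * r n) \o E n).
  apply/funext => u.
  have := congr1 (fun p => polop U ('X^2 * p) (E n u)) (@resolvent_polyM R c t n).
  rewrite -/(e n) -/(r n).
  have -> : 'X^2 * (('X^2 + t%:P) * e n) = ('X * ('X * e n)) * ('X^2 + t%:P) :> {poly R}.
    by rewrite expr2; ring.
  have -> : 'X^2 * (1 - r n) = 'X * ('X * 1) - 'X^2 * r n :> {poly R}.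
    by rewrite mulrBr mulr1 expr2 mulr1.
  rewrite polopM// polopD polopC.
  have -> : polop U 'X^2 = U \o U by rewrite expr2 -[X in 'X * X]mulr1 !polopXl// polop1.
  have -> : polop U ('X * ('X * 1) - 'X^2 * r n) = (U \o U) - polop U ('X^2 * r n).
    by rewrite -scaleN1r polopD polopZ rmorphN1 scaleN1r !polopXl// polop1.
  by [].
have RHS_E : (U \o (U \o E n)) + real_complex R t *: E n =
    id - rZ - ((U \o (V \o E n)) + (V \o (Z \o E n))).
  apply/funext => u; have := resolvent_relation n u.
  have ZZ : X (Z (E n u)) + Y (Z (E n u)) = U (U (E n u)) + U (V (E n u)) + V (Z (E n u)).
    rewrite -[LHS]/(Z (Z (E n u))) {1}ZE -[LHS]/(U (Z (E n u)) + V (Z (E n u))).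
    by rewrite {1}ZE -[(U + V) _]/(U (E n u) + V (E n u)) linopD.
  rewrite ZZ => H.
  rewrite -[RHS]/(u - rZ u - (U (V (E n u)) + V (Z (E n u)))).
  rewrite -[LHS]/(U (U (E n u)) + real_complex R t *: E n u).
  apply/eqP; rewrite eq_sym subr_eq; apply/eqP.
  move/eqP : H; rewrite -/rZ eq_sym subr_eq => /eqP ->.
  by rewrite -!addrA; congr (_ + _); rewrite addrA addrC.
have LRHS : L \o (id - rZ - ((U \o (V \o E n)) + (V \o (Z \o E n)))) =
    L - (L \o rZ) - ((L \o (U \o (V \o E n))) + (L \o (V \o (Z \o E n)))).
  apply/funext => u.
  rewrite -[LHS]/(L (u - rZ u - (U (V (E n u)) + V (Z (E n u))))).
  by rewrite !(linopB _ _ lL) (linopD _ _ lL).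
have LU : L \o U = polop U ('X * ('X * 'X * e n)).
  rewrite /L -[X in _ \o X](polopX lU) -polopM//; congr polop; ring.
have MUVE : nc_alg P (U \o (V \o E n)) by exact: nc_comp.
(* [L U] is the odd polynomial [x^3 e n] evaluated at [U]. *)
have LUVE0 : retau (L \o (U \o (V \o E n))) = 0.
  have -> : L \o (U \o (V \o E n)) = polop U ('X * ('X * 'X * e n)) \o (V \o E n) by rewrite -LU.
  rewrite (retau_polop_factor _ MU MV (fE n)) odd0 ?mul0r// => x.
  by rewrite !hornerM !hornerX e_even; ring.
have LVZE : retau (L \o (V \o (Z \o E n))) = delta n * retau (V \o (Z \o E n)).
  by rewrite (retau_polop_factor _ MU MV (fZE n)) -LL.
have key : retau (U \o (U \o E n)) - retau (polop U ('X^2 * r n) \o E n) =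
    delta n - retau (L \o rZ) - delta n * retau (V \o (Z \o E n)).
  have Mr' : nc_alg P (polop U ('X^2 * r n) \o E n) by apply: nc_comp => //; exact: nc_polop.
  have MLr := nc_comp ML MrZ; have MLU := nc_comp ML MUVE; have MLV := nc_comp ML MVZE.
  rewrite -retau_sub// -LHS_E RHS_E LRHS retau_sub; [|exact: nc_sub|exact: nc_add].
  by rewrite retau_sub// retau_add// LUVE0 LVZE LL add0r.
have LE : L = polop U ('X^2 * e n) by rewrite /L mulrA -expr2.
by rewrite /side_error -/(E n) -/rZ -LE; lra.
Qed.

Lemma cvg_side_error : side_error n @[n --> \oo] --> 0.
Proof.
have mom := law_moments_integrable lawU.
have b2 := sqr_ge0 b.
apply: (@cvg0_le _ (fun n => (b ^+ 2 / t) * q ^+ n + q ^+ n)) => [n|]; last first.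
  rewrite [X in _ --> X](_ : 0 = b ^+ 2 / t * 0 + 0); last by rewrite mulr0 addr0.
  by apply: cvgD; [apply: cvgMr|]; exact: cvg_q.
have qn := q_expn_ge0 n; have q1 : q ^+ n <= 1.
  by have /andP[? ?] := q_ge0_lt1; rewrite exprn_ile1// ltW.
have bound1 : `|retau (polop U ('X^2 * r n) \o polop Z (e n))| <= b ^+ 2 * q ^+ n * t^-1.
  have M0 : 0 <= b ^+ 2 * q ^+ n by exact: mulr_ge0.
  have M'0 : 0 <= t^-1 by rewrite invr_ge0 ltW.
  apply: (retau_polop_mul_bound saU lawU mub' M0 M'0) => x xb.
    have /andP[r0 r1] := r_bound n xb.
    have x0 := sqr_ge0 x; have xr0 : 0 <= x ^+ 2 * (r n).[x] by exact: mulr_ge0.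
    by rewrite hornerM hornerXn ger0_norm//; apply: ler_pM => //; exact: sqr_le_supp.
  by have /andP[e0 e1] := e_bound n xb; rewrite ger0_norm.
(* By [e_r_relation], [x^2 e n] is at most 1 on the support, uniformly in [n]. *)
have bound2 : `|retau (polop U ('X^2 * e n) \o polop Z (r n))| <= 1 * q ^+ n.
  apply: (retau_polop_mul_bound saU lawU mub' ler01 qn) => x xb; last first.
    by have /andP[r0 r1] := r_bound n xb; rewrite ger0_norm.
  have /andP[e0 e1] := e_bound n xb; have /andP[r0 r1] := r_bound n xb.
  have x0 := sqr_ge0 x.
  have xe0 : 0 <= x ^+ 2 * (e n).[x] by rewrite mulr_ge0.
  have := congr1 (fun p : {poly R} => p.[x]) (e_r_relation n).
  rewrite /= hornerM hornerXn hornerD hornerN (hornerZ t) hornerD hornerN hornerC => xe.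
  rewrite ger0_norm// xe; have : 0 <= t * (e n).[x] by rewrite mulr_ge0// ltW.
  by lra.
rewrite /side_error; apply: le_trans (ler_normB _ _) _.
by rewrite -[leRHS](congr2 +%R (mulrAC _ _ _) (mul1r _)); exact: lerD.
Qed.

Lemma cvg_delta : delta n @[n --> \oo] --> 1 - t * stieltjes mu' t.
Proof.
have mom := law_moments_integrable lawU.
have -> : delta = fun n => 1 - (\int[mu']_x (r n).[x])%R - t * (\int[mu']_x (e n).[x])%R.
  apply/funext => n; rewrite /delta mulrA -expr2 e_r_relation.
  have ri := integrable_horner mom (r n); have ei := integrable_horner mom (e n).
  have nri := integrableZ_EFin (- 1) ri; have nei := integrableZ_EFin (- t) ei.
  have i1 := integrable_cst mu' 1; have i2 := integrableD_EFin i1 nri.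
  transitivity (\int[mu']_x ((1 + (- 1) * (r n).[x]) + (- t) * (e n).[x]))%R.
    by apply: eq_Rintegral => x _; rewrite !(hornerD, hornerN, hornerZ, hornerC); ring.
  rewrite RintegralD// RintegralD// !RintegralZl// Rintegral_cstT; ring.
rewrite -[X in X - _]subr0; apply: cvgB.
  by apply: cvgB; [exact: cvg_cst|exact: cvg_r].
by apply: cvgMr; exact: cvg_e.
Qed.

End OneSide.

(** The side relations form a linear system [x = dX (1 - y)], [y = dY (1 - x)] up to errors, whose
    sum [x + y] tends to [1 - t * stieltjes rho t] through the law of [X + Y]. The unknowns are
    eliminated at finite [n], since only their sum has a known limit. At the limit [dX = 1 - A] and
    [dY = 1 - B]. *)
Lemma boolean_stieltjes :
  let A := t * stieltjes mu t in let B := t * stieltjes nu t in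
  (A + B - A * B) * (t * stieltjes rho t) = A * B.
Proof.
move=> A B.
have indC : boolean_independent Y X by move=> s s1; have [? ?] := ind s1.
have fE n : factors X Y (E n) by exact: factors_polop lawX ind.
have ZYX : Z = Y + X by rewrite /Z addrC.
have fE' n : factors Y X (E n) by rewrite /E ZYX; exact: factors_polop lawY indC.
have ZEE n : Z \o E n = polop Z ('X * e n) by rewrite polopXl.
have fZE n : factors X Y (Z \o E n) by rewrite ZEE; exact: factors_polop lawX ind.
have fZE' n : factors Y X (Z \o E n) by rewrite ZEE ZYX; exact: factors_polop lawY indC.
have relX := side_relation saX MY erefl lawX smu fE fZE.
have relY := side_relation saY MX ZYX lawY snu fE' fZE'.
have cX := cvg_side_error saX lawX mub; have cY := cvg_side_error saY lawY nub.
have dX := cvg_delta lawX mub; have dY := cvg_delta lawY nub.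
move: relX relY cX cY dX dY.
set x := fun n => retau (X \o (Z \o E n)); set y := fun n => retau (Y \o (Z \o E n)).
set eX := side_error X; set eY := side_error Y.
set dX := fun n => (\int[mu]_x _)%R; set dY := fun n => (\int[nu]_x _)%R.
move=> relX relY cX cY cdX cdY.
pose s n := 1 - (\int[rho]_x (r n).[x])%R - t * (\int[rho]_x (e n).[x])%R.
have xy n : x n + y n = s n.
  have MXZE : nc_alg P (X \o (Z \o E n)).
    by do 2!apply: nc_comp => //; exact: nc_polop.
  have MYZE : nc_alg P (Y \o (Z \o E n)).
    by do 2!apply: nc_comp => //; exact: nc_polop.
  rewrite /x /y -retau_add//.
  have -> : (X \o (Z \o E n)) + (Y \o (Z \o E n)) =
      id - polop Z (r n) - real_complex R t *: E n.
    by apply/funext => u; exact: resolvent_relation.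
  have Mr : nc_alg P (polop Z (r n)) by exact: nc_polop.
  have ME : nc_alg P (E n) by exact: nc_polop.
  rewrite retau_sub; [|by apply: nc_sub => //; exact: nc_id|exact: nc_scale].
  rewrite retau_sub ?retau_id ?retau_scale//; last exact: nc_id.
  by rewrite /s /retau !(retau_polop _ MZ lawZ).
have momZ := law_moments_integrable lawZ.
have cs : s n @[n --> \oo] --> 1 - t * stieltjes rho t.
  rewrite -[X in X - _]subr0; apply: cvgB.
    by apply: cvgB; [exact: cvg_cst|exact: cvg_r].
  by apply: cvgMr; exact: cvg_e.
have cl : (1 - dX n * dY n) * s n @[n --> \oo] -->
    (1 - (1 - A) * (1 - B)) * (1 - t * stieltjes rho t).
  by apply: cvgM => //; apply: cvgB; [exact: cvg_cst|exact: cvgM].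
have cr : (dX n * (1 - dY n) + dY n * (1 - dX n)) + (eX n * (1 - dY n) + eY n * (1 - dX n))
    @[n --> \oo] --> ((1 - A) * (1 - (1 - B)) + (1 - B) * (1 - (1 - A))) +
      (0 * (1 - (1 - B)) + 0 * (1 - (1 - A))).
  have c1 : 1 - dX n @[n --> \oo] --> 1 - (1 - A) by apply: cvgB => //; exact: cvg_cst.
  have c2 : 1 - dY n @[n --> \oo] --> 1 - (1 - B) by apply: cvgB => //; exact: cvg_cst.
  by apply: cvgD; apply: cvgD; exact: cvgM.
have eqn : (fun n => (1 - dX n * dY n) * s n) =
    fun n => (dX n * (1 - dY n) + dY n * (1 - dX n)) + (eX n * (1 - dY n) + eY n * (1 - dX n)).
  apply/funext => n; rewrite -xy; have := relX n; have := relY n.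
  rewrite -/(x n) -/(y n) -/(dX n) -/(dY n) -/(eX n) -/(eY n).
  move: (x n) (y n) (dX n) (dY n) (eX n) (eY n) => a1 a2 a3 a4 a5 a6 H1 H2.
  have -> : (1 - a3 * a4) * (a1 + a2) = (a1 - a3 * a4 * a1) + (a2 - a3 * a4 * a2) by ring.
  have -> : a1 - a3 * a4 * a1 = a3 * (1 - a4) + a5 - a3 * a6.
    by rewrite {1}H2 {1}H1; ring.
  have -> : a2 - a3 * a4 * a2 = a4 * (1 - a3) + a6 - a4 * a5.
    by rewrite {1}H1 {1}H2; ring.
  ring.
rewrite eqn in cl; have := cvg_lim (@Rhausdorff R) cl; rewrite (cvg_lim (@Rhausdorff R) cr).
by move=> /(_ eventually_filter); clearbody A B; move: (t * stieltjes rho t) => g; lra.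
Qed.

End BooleanResolvent.

(** * Convexity along Boolean sums *)

Lemma stieltjes_scaled_le (R : realType) (mu : probability R R) (theta t : R) :
  0 <= theta <= 1 -> 0 < t ->
  stieltjes (scaled_law (Num.sqrt theta) mu) t *
    (theta + (1 - theta) * (t * stieltjes mu t)) <= stieltjes mu t.
Proof.
move=> /andP[theta0 theta1] t0; set W := stieltjes mu t.
have W0 : 0 < W by exact: stieltjes_gt0.
set d := theta + _; have d0 : 0 < d.
  have : 0 <= (1 - theta) * (t * W) by rewrite mulr_ge0 ?subr_ge0// mulr_ge0// ltW.
  rewrite /d; move: theta0; rewrite le_eqVlt => /predU1P[<- _|]; last by lra.
  by rewrite subr0 add0r mul1r mulr_gt0.
have ms := @measurable_scale_fun R (Num.sqrt theta).
have fi : mu.-integrable setT (EFin \o (fun x => ((Num.sqrt theta * x) ^+ 2 + t)^-1)).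
  apply: (@bounded_integrable _ _ _ t^-1) => [|x].
    exact: (measurableT_comp (measurable_resolvent t0) ms).
  by rewrite gtr0_norm ?resolvent_gt0// resolvent_le.
rewrite /stieltjes; have [_ ->] := integral_scaled_law (measurable_resolvent t0) fi.
rewrite -ler_pdivlMr//.
have wi := integrableZ_EFin (theta / d ^+ 2) (resolvent_integrable mu t0).
have ci := integrable_cst mu (W / d - theta / d ^+ 2 * W).
(* The tangent is affine in [(x^2 + t)^-1], whose mean is [W], so it integrates to its value [W / d]
   at [W]. *)
have -> : W / d = (\int[mu]_x (theta / d ^+ 2 * (x ^+ 2 + t)^-1 +
    (W / d - theta / d ^+ 2 * W)))%R.
  have ri := resolvent_integrable mu t0.
  rewrite RintegralD// RintegralZl// Rintegral_cstT -[(\int[mu]_x _)%R]/W.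
  by rewrite addrC subrK.
apply: le_Rintegral => //; first exact: integrableD_EFin.
(* The integrand [w / (theta + (1 - theta) t w)] is concave in [w = (x^2 + t)^-1], hence
   below its tangent at [w = W]. *)
move=> x _; rewrite exprMn sqr_sqrtr// -subr_ge0.
have y0 : 0 < x ^+ 2 + t by rewrite ltr_wpDl// sqr_ge0.
have e0 : 0 < theta * x ^+ 2 + t by rewrite ltr_wpDl// mulr_ge0// sqr_ge0.
have -> : theta / d ^+ 2 * (x ^+ 2 + t)^-1 + (W / d - theta / d ^+ 2 * W) -
    (theta * x ^+ 2 + t)^-1 =
    theta * ((1 - theta) * t) * ((x ^+ 2 + t)^-1 - W) ^+ 2 *
      ((x ^+ 2 + t) / ((theta * x ^+ 2 + t) * d ^+ 2)).
  by move/lt0r_neq0: d0; rewrite /d => d0; field; rewrite d0 !gt_eqF.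
apply: mulr_ge0; last by rewrite divr_ge0 ?(ltW y0)// mulr_ge0 ?(ltW e0)// sqr_ge0.
by rewrite mulr_ge0 ?sqr_ge0// mulr_ge0// mulr_ge0 ?subr_ge0// ltW.
Qed.

(** The identity says [1/g = 1/a + 1/b - 1]. Inverting the hypotheses on [a] and [b] produces
    [1 - theta] and [theta], which cancel the [-1] and leave [1/g >= theta / A + (1 - theta) / B];
    the weighted harmonic mean is then at most the arithmetic one. *)
Lemma harmonic_le (R : realType) (theta A B a b g : R) : 0 <= theta <= 1 ->
  0 < A -> 0 < B -> 0 < a -> 0 < b -> 0 < g ->
  a * (theta + (1 - theta) * A) <= A -> b * (1 - theta + theta * B) <= B ->
  (a + b - a * b) * g = a * b -> g <= theta * A + (1 - theta) * B.
Proof.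
move=> /andP[theta0 theta1] A0 B0 a0 b0 g0 aA bB abg.
have gE : g^-1 = a^-1 + b^-1 - 1.
  have -> : a^-1 + b^-1 - 1 = (a + b - a * b) / (a * b) by field; rewrite !gt_eqF.
  apply: (mulfI (lt0r_neq0 g0)); rewrite mulfV ?gt_eqF// mulrA [g * _]mulrC abg mulfV//.
  by rewrite mulf_neq0 ?gt_eqF.
have aE : theta / A + (1 - theta) <= a^-1.
  rewrite -(ler_pM2l a0) mulfV ?gt_eqF// -(ler_pM2r A0) mul1r; apply: le_trans aA.
  by rewrite le_eqVlt; apply/orP; left; apply/eqP; field; rewrite gt_eqF.
have bE : (1 - theta) / B + theta <= b^-1.
  rewrite -(ler_pM2l b0) mulfV ?gt_eqF// -(ler_pM2r B0) mul1r; apply: le_trans bB.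
  by rewrite le_eqVlt; apply/orP; left; apply/eqP; field; rewrite gt_eqF.
set m := theta * A + _; pose s := theta / A + (1 - theta) / B.
have sg : s <= g^-1 by rewrite gE /s; lra.
have m0 : 0 <= m by rewrite addr_ge0 ?mulr_ge0 ?subr_ge0// ltW.
have ms : 1 <= m * s.
  rewrite -subr_ge0 (_ : m * s - 1 = theta * (1 - theta) * ((A - B) ^+ 2 / (A * B))).
    by apply: mulr_ge0; [rewrite mulr_ge0 ?subr_ge0|rewrite divr_ge0 ?sqr_ge0// mulr_ge0// ltW].
  by rewrite /m /s; field; rewrite !gt_eqF.
rewrite -[leLHS]mul1r -ler_pdivlMr//; apply: le_trans ms _.
by rewrite ler_wpM2l.
Qed.

Lemma riemann_convex_le (R : realType) (F G H : R -> R) (a b : R) n :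
  (forall t, 0 < t -> F t <= a * G t + b * H t) ->
  riemann n F <= a * riemann n G + b * riemann n H.
Proof.
move=> FGH; rewrite /riemann !mulr_sumr -big_split/=; apply: ler_sum => i _.
by rewrite mulrCA [b * _]mulrCA -mulrDr ler_pM2l ?mesh_gt0// FGH// node_gt0.
Qed.

Section BooleanConvexity.
Variables (R : realType) (P : ncProbSpace R) (X Y : P -> P).
Variables (mu nu rho : probability R R) (theta : R).
Hypotheses (saX : sa_var X) (saY : sa_var Y).
Hypotheses (lawX : has_law X mu) (lawY : has_law Y nu).
Hypotheses (smu : symmetric_law mu) (snu : symmetric_law nu).
Hypothesis ind : boolean_independent X Y.
Hypothesis theta01 : 0 <= theta <= 1.
Local Notation rc := (real_complex R).
Local Notation U := (rc (Num.sqrt theta) *: X).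
Local Notation V := (rc (Num.sqrt (1 - theta)) *: Y).
Hypothesis lawZ : has_law (U + V) rho.

Lemma common_support : exists b : R,
  [/\ supported (scaled_law (Num.sqrt theta) mu) b,
      supported (scaled_law (Num.sqrt (1 - theta)) nu) b & supported rho b].
Proof.
have saU := sa_var_scale (Num.sqrt theta) saX.
have saV := sa_var_scale (Num.sqrt (1 - theta)) saY.
have saZ := sa_var_add saU saV.
have [b1 b10 Ub] := nc_bound saU.1; have [b2 b20 Vb] := nc_bound saV.1.
have [b3 b30 Zb] := nc_bound saZ.1.
have s1 := law_supported saU (has_law_scale (Num.sqrt theta) saX lawX) b10 Ub.
have s2 := law_supported saV (has_law_scale (Num.sqrt (1 - theta)) saY lawY) b20 Vb.
have s3 := law_supported saZ lawZ b30 Zb.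
exists (2 * b1 + 2 * b2 + 2 * b3).
by split; [apply: (supportedW s1)|apply: (supportedW s2)|apply: (supportedW s3)]; lra.
Qed.

Lemma stieltjes_boolean_le t : 0 < t ->
  stieltjes rho t <= theta * stieltjes mu t + (1 - theta) * stieltjes nu t.
Proof.
move=> t0; have [b [s1 s2 s3]] := common_support.
have bs := boolean_stieltjes (sa_var_scale (Num.sqrt theta) saX)
  (sa_var_scale (Num.sqrt (1 - theta)) saY) (has_law_scale _ saX lawX)
  (has_law_scale _ saY lawY) lawZ (scaled_law_symmetric _ smu) (scaled_law_symmetric _ snu)
  (boolean_independent_scale _ _ saX.1 saY.1 ind) t0 s1 s2 s3.
have theta01' : 0 <= 1 - theta <= 1.
  by have /andP[? ?] := theta01; apply/andP; split; lra.
have gt0 (m : probability R R) : 0 < t * stieltjes m t by rewrite mulr_gt0// stieltjes_gt0.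
rewrite -(ler_pM2l t0) mulrDr ![t * (_ * _)]mulrCA.
apply: harmonic_le bs; rewrite ?gt0//.
  by rewrite -mulrA ler_pM2l// stieltjes_scaled_le.
by rewrite -mulrA ler_pM2l// -[X in _ + X * _](subKr 1) stieltjes_scaled_le.
Qed.

Lemma stieltjes_sqr_boolean_le t : 0 < t ->
  stieltjes rho t ^+ 2 <= theta * stieltjes mu t ^+ 2 + (1 - theta) * stieltjes nu t ^+ 2.
Proof.
move=> t0; have := stieltjes_boolean_le t0.
have := stieltjes_gt0 rho t0; have := stieltjes_gt0 mu t0; have := stieltjes_gt0 nu t0.
move: (stieltjes rho t) (stieltjes mu t) (stieltjes nu t) => g x y y0 x0 g0 gxy.
apply: (@le_trans _ _ ((theta * x + (1 - theta) * y) ^+ 2)).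
  by rewrite lerXn2r ?nnegrE ?(le_trans _ gxy)// ltW.
rewrite -subr_ge0 (_ : _ - _ = theta * (1 - theta) * (x - y) ^+ 2); last by ring.
by have /andP[? ?] := theta01; rewrite mulr_ge0 ?sqr_ge0// mulr_ge0// subr_ge0.
Qed.

Let theta0 : (0 <= theta%:E)%E. Proof. by rewrite lee_fin; case/andP: theta01. Qed.

Let theta1 : (0 <= (1 - theta)%:E)%E.
Proof. by rewrite lee_fin subr_ge0; case/andP: theta01. Qed.

Lemma boolean_fisher_convex :
  (boolean_fisher rho <=
    theta%:E * boolean_fisher mu + (1 - theta)%:E * boolean_fisher nu)%E.
Proof.
have fcvg := @cvg_boolean_fisher R rho.
rewrite -(cvg_lim _ fcvg)//; apply: lime_le; first by apply/cvg_ex; exists (boolean_fisher rho).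
near=> n.
apply: (@le_trans _ _ (theta%:E * (riemann n (fun t => stieltjes mu t ^+ 2))%:E +
    (1 - theta)%:E * (riemann n (fun t => stieltjes nu t ^+ 2))%:E)%E).
  by rewrite -!EFinM -EFinD lee_fin; apply: riemann_convex_le; exact: stieltjes_sqr_boolean_le.
by apply: leeD; apply: lee_wpmul2l => //; exact: riemann_le_boolean_fisher.
Unshelve. all: by end_near. Qed.

(** The transform inequality enters with reversed sign between the upper brackets of the two
    entropies and the lower bracket of the third. [C] collects the second moments in the error,
    which the mesh sends to 0. *)
Lemma boolean_entropy_concave :
  (theta%:E * boolean_entropy mu + (1 - theta)%:E * boolean_entropy nu <=
    boolean_entropy rho)%E.
Proof.
have sqX := law_moment_integrable lawX 2; have sqY := law_moment_integrable lawY 2.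
have sqZ := law_moment_integrable lawZ 2.
set C := theta * (\int[mu]_x (x ^+ 2))%R + (1 - theta) * (\int[nu]_x (x ^+ 2))%R.
have ecvg : (log_energy rho n)%:E + (2^-1 * (mesh R n * C))%:E @[n --> \oo] -->
    (boolean_entropy rho + 0%:E)%E.
  apply: cvgeD; first exact: fin_num_adde_defl.
    exact: cvg_log_energy.
  apply: cvg_EFin; first by near=> n.
  rewrite [X in _ --> X](_ : 0 = 2^-1 * (0 * C)); last by rewrite mul0r mulr0.
  by apply: cvgMr; apply: cvgMl; exact: cvg_mesh.
rewrite -[leRHS]adde0 -(cvg_lim _ ecvg)//; apply: lime_ge.
  by apply/cvg_ex; eexists; exact: ecvg.
near=> n.
have Gmu := lee_wpmul2l theta0 (boolean_entropy_le_stieltjes sqX n).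
have Gnu := lee_wpmul2l theta1 (boolean_entropy_le_stieltjes sqY n).
apply: le_trans (leeD Gmu Gnu) _; rewrite -!EFinM -!EFinD lee_fin.
have := stieltjes_le_log_energy sqZ n.
have := @riemann_convex_le _ _ _ _ _ _ n stieltjes_boolean_le.
by rewrite /C; lra.
Unshelve. all: by end_near. Qed.

End BooleanConvexity.

Lemma two_retau_inverse_le (R : realType) (P : ncProbSpace R) (X Y W : P -> P)
    (mu : probability R R) : sa_var X -> has_law X mu -> sa_var Y -> has_law Y mu ->
  classically_independent X Y -> invertible_op X -> is_inverse (sum_sq X Y) W ->
  ((complex.Re (nc_tau P (2%:R *: W)))%:E <= inv_sum_sq_integral mu)%E.
Proof.
move=> saX lawX saY lawY indep invX invW; have [MW _ _] := invW.
have [b b0 Xb] := nc_bound saX.1.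
have mub := law_supported saX lawX b0 Xb.
have c0 : 0 < 2 * (2 * b) ^+ 2 by rewrite mulr_gt0// exprn_gt0// mulr_gt0.
have -> : complex.Re (nc_tau P (2%:R *: W)) = 2 * retau W.
  by rewrite -(rmorph_nat (real_complex R)) -[LHS]/(retau (real_complex R 2%:R *: W)) retau_scale.
exact: (retau_inverse_le saX saY lawX lawY indep c0 mub (lexx _) invX invW).
Qed.

Theorem proposition1p8 (R : realType) :
  (* (1) *)
  (forall (P : ncProbSpace R) (X : P -> P) (mu : probability R R),
     sa_var X -> has_law X mu -> symmetric_law mu ->
     [/\ (inv_sum_sq_integral mu <= boolean_fisher mu)%E,
         (boolean_fisher mu <= inv_sq_integral mu)%E,
         forall X' W : P -> P,
           sa_var X' -> has_law X' mu -> classically_independent X X' ->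
           invertible_op X -> is_inverse ((X \o X) + (X' \o X')) W ->
           ((complex.Re (nc_tau P (2%:R *: W)))%:E <= boolean_fisher mu)%E
       & forall Z : P -> P, is_inverse (X \o X) Z ->
           (boolean_fisher mu <= (complex.Re (nc_tau P Z))%:E)%E]) /\
  (* (2) *)
  [/\ upper_semicontinuous (fun mu : csProb R => boolean_entropy (sval mu)),
      lower_semicontinuous
        (fun mu : set_type (@symmetric_csProb R) =>
           boolean_fisher (sval (set_val mu)))
    & forall (P : ncProbSpace R) (X_ : nat -> P -> P) (X : P -> P)
             (mu_ : nat -> probability R R) (mu : probability R R),
        (forall k, [/\ sa_var (X_ k), has_law (X_ k) (mu_ k)
                     & symmetric_law (mu_ k)]) ->
        sa_var X -> has_law X mu -> symmetric_law mu ->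
        (fun k => opnorm (X_ k - X)) @ \oo --> (0 : R) ->
        (limn_esup (fun k => boolean_entropy (mu_ k)) <= boolean_entropy mu)%E /\
        (boolean_fisher mu <= limn_einf (fun k => boolean_fisher (mu_ k)))%E] /\
  (* (3) *)
  (forall (P : ncProbSpace R) (X Y : P -> P) (mu nu : probability R R),
     sa_var X -> has_law X mu -> symmetric_law mu ->
     sa_var Y -> has_law Y nu -> symmetric_law nu ->
     boolean_independent X Y ->
     forall theta : R, 0 <= theta <= 1 ->
     forall rho : probability R R,
       has_law (real_complex R (Num.sqrt theta) *: X
                + real_complex R (Num.sqrt (1 - theta)) *: Y) rho ->
       (theta%:E * boolean_entropy mu + (1 - theta)%:E * boolean_entropy nu
          <= boolean_entropy rho)%E /\
       (boolean_fisher rho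
          <= theta%:E * boolean_fisher mu + (1 - theta)%:E * boolean_fisher nu)%E).
Proof.
split=> [P X mu saX lawX smu|].
  split=> [||X' W saX' lawX' indep invX invW|Z invZ].
  - exact: inv_sum_sq_le_boolean_fisher.
  - exact: boolean_fisher_le_inv_sq.
  - apply: le_trans (inv_sum_sq_le_boolean_fisher mu).
    exact: two_retau_inverse_le saX lawX saX' lawX' indep invX invW.
  - apply: le_trans (boolean_fisher_le_inv_sq mu) _.
    exact: inv_sq_le_retau_inverse saX lawX invZ.
split; first split.
- exact: boolean_entropy_usc.
- exact: boolean_fisher_symmetric_lsc.
- move=> P X_ X mu_ mu H saX lawX _ X_cvg.
  have saX_ k : sa_var (X_ k) by have [] := H k.
  have lawX_ k : has_law (X_ k) (mu_ k) by have [] := H k.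
  have g_cvg := stieltjes_cvg saX_ lawX_ saX lawX X_cvg.
  split; last exact: boolean_fisher_seq_lsc.
  apply: boolean_entropy_seq_usc => //.
  + by move=> k; exact: law_moment_integrable (lawX_ k) 2.
  + exact: law_moment_integrable lawX 2.
  + exact: (moment_cvg saX_ lawX_ saX lawX X_cvg).
- move=> P X Y mu nu saX lawX smu saY lawY snu ind theta theta01 rho lawZ; split.
  + exact: boolean_entropy_concave saX saY lawX lawY smu snu ind theta01 lawZ.
  + exact: boolean_fisher_convex saX saY lawX lawY smu snu ind theta01 lawZ.
Qed.
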